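(* Let $\nu\in\mathcal{R}$, let $U$ be a nonempty open subset of $\mathbb{R}^d$, and let $\Pi$ be a Poisson point measure on $(0,1]\times U$ with intensity $\nu\otimes\mathcal{L}^d(\cdot\cap U)$. Let $F_\nu=\{y\in\mathbb{R}^d:\int_{(0,1]\times U}\mathbf{1}_{\{|y-x|<r\}}\,\Pi(dr,dx)=\infty\}$. If $\nu\notin\mathcal{R}_d$, then almost surely $F_\nu$ has full Lebesgue measure in $U$. If $\nu\in\mathcal{R}_d$, then almost surely $F_\nu$ is $\nu$-describable in $U$.
   Context: A Poisson point measure on a locally compact second-countable space $S$ with Radon intensity $\pi$ is a random point measure $\Pi$ such that $\Pi(E)$ is Poisson with parameter $\pi(E)$ for every Borel $E$, and $\Pi(E_1),\dots,\Pi(E_n)$ are independent for pairwise disjoint Borel $E_1,\dots,E_n$. Fix $d\ge1$ and a norm $|\cdot|$ on $\mathbb{R}^d$ (diameters are taken with respect to it); $\mathcal{L}^d$ is Lebesgue measure. A gauge function is a function $g:[0,\infty]\to[0,\infty]$ that is nondecreasing on a neighbourhood of $0$ and satisfies $\lim_{r\to0}g(r)=g(0)=0$, $g(\infty)=\infty$; $\mathfrak{G}$ denotes the set of gauge functions. $\mathcal{H}^g$ is the Hausdorff $g$-measure: $\mathcal{H}^g(E)=\lim_{\delta\downarrow0}\inf\{\sum_ng(\mathrm{diam}\,C_n):E\subseteq\bigcup_nC_n,\ \mathrm{diam}\,C_n\le\delta\}$. The $d$-normalization of $g$ is $g_d(r)=r^d\inf_{0<\rho\le r}g(\rho)/\rho^d$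 for $r\in(0,\infty)$, $g_d(0)=0$, $g_d(\infty)=\infty$; $g$ is $d$-normalized if $g=g_d$ on a neighbourhood of $0$. Let $\ell_g=\liminf_{r\to0}g(r)/r^d$, $\mathfrak{G}^\infty=\{g\in\mathfrak{G}:\ell_g=\infty\}$, $\mathfrak{G}^*=\{g\in\mathfrak{G}:\ell_g\in(0,\infty]\}$. For $d$-normalized gauge functions $g,h$ write $h\prec g$ if $h(r)/g(r)$ increases monotonically to $\infty$ as $r\downarrow0$ (with the convention that $h\prec g$ for every $h$ if $g$ vanishes on a neighbourhood of $0$). Dyadic cubes are the sets $2^{-j}(k+[0,1)^d)$, $j\in\mathbb{Z}$, $k\in\mathbb{Z}^d$. For a $d$-normalized gauge function $h$, let $\varepsilon_h$ be the supremum of those $\varepsilon>0$ such that $h$ is nondecreasing on $[0,\varepsilon]$ and $r\mapsto h(r)/r^d$ is nonincreasing on $(0,\varepsilon]$, and let $\mathcal{M}^h_\infty(E)=\inf\sum_nh(\mathrm{diam}\,\lambda_n)$, the infimum over all countable coverings of $E$ by dyadic cubes $\lambda_n$ of diameter less than $\varepsilon_h$. For a gauge function $g$ and a nonempty open set $U\subseteq\mathbb{R}^d$, the large intersection class $G^g(U)$ is the collection of $G_\delta$ subsets $F\subseteq\mathbb{R}^d$ such that $\mathcal{M}^h_\infty(F\cap V)=\mathcal{M}^h_\infty(V)$ for every $d$-normalized gauge function $h$ with $h\prec g_d$ and every open $V\subseteq U$. Let $\mathcal{Z}(U)$ be the set of Borel sets $E$ with $\mathcal{L}^d(E\cap U)=0$;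 for such $E$, the majorizing collection is $\mathfrak{M}(E,U)=\{g\in\mathfrak{G}^\infty:\mathcal{H}^g(E\cap U)=0\}$ and the minorizing collection is $\mathfrak{m}(E,U)=\{g\in\mathfrak{G}^*:\exists F\in G^g(U),\ F\subseteq E\}$. Let $\mathcal{R}$ be the set of positive Borel measures $\mathfrak{n}$ on $(0,1]$ with infinite total mass and $\mathfrak{n}([\rho,1])<\infty$ for all $\rho\in(0,1]$, and $\mathcal{R}_d=\{\mathfrak{n}\in\mathcal{R}:\int_{(0,1]}r^d\,\mathfrak{n}(dr)<\infty\}$. For $\mathfrak{n}\in\mathcal{R}_d$, $\mathfrak{G}(\mathfrak{n})=\{g\in\mathfrak{G}^\infty:\int_{(0,1]}g_d\,d\mathfrak{n}=\infty\}$ and $\mathfrak{G}(\mathfrak{n})^\complement=\mathfrak{G}^\infty\setminus\mathfrak{G}(\mathfrak{n})$. A set $E$ is $\mathfrak{n}$-describable in $U$ if $E\in\mathcal{Z}(U)$, $\mathfrak{M}(E,U)=\mathfrak{G}(\mathfrak{n})^\complement$ and $\mathfrak{m}(E,U)\cap\mathfrak{G}^\infty=\mathfrak{G}(\mathfrak{n})$. For $\mathfrak{s}\in[0,d)$, $\mathfrak{G}(\mathfrak{s})$ is the set of $g\in\mathfrak{G}^\infty$ such that for every $s>\mathfrak{s}$, $g_d(r)$ is not $o(r^s)$ as $r\to0$; $E$ is $\mathfrak{s}$-describable in $U$ if $E\in\mathcal{Z}(U)$, $\mathfrak{M}(E,U)=\mathfrak{G}^\infty\setminus\mathfrak{G}(\mathfrak{s})$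 and $\mathfrak{m}(E,U)\cap\mathfrak{G}^\infty=\mathfrak{G}(\mathfrak{s})$. *)

(* Defs.v *)
From HB Require Import structures.
From mathcomp Require Import all_boot all_order all_algebra.
From mathcomp Require Import all_classical all_reals all_analysis.
From mathcomp Require Import measurable_realfun lebesgue_measure lebesgue_integral.

Set Implicit Arguments.
Unset Strict Implicit.
Unset Printing Implicit Defensive.

Import Order.TTheory GRing.Theory Num.Theory.
Import numFieldNormedType.Exports.

Local Open Scope classical_set_scope.
Local Open Scope ring_scope.

Definition is_norm (R : realType) (d : nat) (N : 'rV[R]_d -> R) : Prop :=
  (forall x, N x = 0 -> x = 0) /\
  (forall (c : R) x, N (c *: x) = `|c| * N x) /\
  (forall x y, N (x + y) <= N x + N y).

Definition diamN (R : realType) (d : nat) (N : 'rV[R]_d -> R)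
  (C : set 'rV[R]_d) : \bar R :=
  if C == set0 then 0%E
  else ereal_sup [set z | exists x y, C x /\ C y /\ z = (N (x - y))%:E].

Definition box (R : realType) (d : nat) (a b : 'rV[R]_d) : set 'rV[R]_d :=
  [set x | forall i : 'I_d, a ord0 i <= x ord0 i < b ord0 i].

Definition boxvol (R : realType) (d : nat) (a b : 'rV[R]_d) : R :=
  \prod_(i < d) Num.max 0 (b ord0 i - a ord0 i).

Definition lebesgue_d (R : realType) (d : nat) (E : set 'rV[R]_d) : \bar R :=
  ereal_inf [set s | exists (a b : nat -> 'rV[R]_d),
    E `<=` \bigcup_n box (a n) (b n) /\
    s = (\sum_(n <oo) (boxvol (a n) (b n))%:E)%E].

Definition borel_d (R : realType) (d : nat) (E : set 'rV[R]_d) : Prop :=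
  <<s [set A | open A] >> E.

Definition G_delta (R : realType) (d : nat) (F : set 'rV[R]_d) : Prop :=
  exists O : nat -> set 'rV[R]_d, (forall n, open (O n)) /\ F = \bigcap_n O n.

Definition gauge (R : realType) (g : \bar R -> \bar R) : Prop :=
  (forall x : \bar R, (0 <= x)%E -> (0 <= g x)%E) /\
  (exists2 e : R, 0 < e & forall r s : R, 0 <= r -> r <= s -> s <= e ->
       (g r%:E <= g s%:E)%E) /\
  g 0%E = 0%E /\
  (fun r : R => g r%:E) @ 0^'+ --> 0%E /\
  g +oo%E = +oo%E.

Definition ell (R : realType) (d : nat) (g : \bar R -> \bar R) : \bar R :=
  ereal_sup [set ereal_inf [set (g r%:E * (r ^- d)%:E)%E | r in [set r : R | 0 < r < e]]
            | e in [set e : R | 0 < e]].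

Definition G_infty (R : realType) (d : nat) : set (\bar R -> \bar R) :=
  [set g | gauge g /\ ell d g = +oo%E].

Definition G_star (R : realType) (d : nat) : set (\bar R -> \bar R) :=
  [set g | gauge g /\ (0 < ell d g)%E].

Definition gd (R : realType) (d : nat) (g : \bar R -> \bar R) : \bar R -> \bar R :=
  fun x => match x with
  | EFin r => if r <= 0 then 0%E
              else ((r ^+ d)%:E *
                    ereal_inf [set (g rho%:E * (rho ^- d)%:E)%E
                               | rho in [set rho : R | (0 < rho <= r)%R]])%E
  | +oo%E => +oo%E
  | -oo%E => 0%E
  end.

Definition d_normalized (R : realType) (d : nat) (g : \bar R -> \bar R) : Prop :=
  exists2 e : R, 0 < e & forall r : R, 0 <= r -> r <= e -> g r%:E = gd d g r%:E.

Definition prec (R : realType) (h g : \bar R -> \bar R) : Prop :=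
  (exists2 e : R, 0 < e & forall r : R, 0 <= r -> r <= e -> g r%:E = 0%E) \/
  (let ratio := fun r : R => fine (h r%:E) / fine (g r%:E) in
   (exists2 e : R, 0 < e & forall r s : R, 0 < r -> r <= s -> s <= e ->
       (0 < g r%:E)%E /\ ratio s <= ratio r) /\
   (forall M : R, exists2 e : R, 0 < e & forall r : R, 0 < r -> r < e -> M < ratio r)).

Definition hausdorff_delta (R : realType) (d : nat) (N : 'rV[R]_d -> R)
  (g : \bar R -> \bar R) (delta : R) (E : set 'rV[R]_d) : \bar R :=
  ereal_inf [set s | exists C : nat -> set 'rV[R]_d,
    E `<=` \bigcup_n C n /\ (forall n, (diamN N (C n) <= delta%:E)%E) /\
    s = (\sum_(n <oo) g (diamN N (C n)))%E].

(* H^g(E) = lim_{delta -> 0+} H^g_delta(E); the map is nonincreasing in delta,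
   so the limit is the supremum over delta > 0 *)
Definition hausdorff (R : realType) (d : nat) (N : 'rV[R]_d -> R)
  (g : \bar R -> \bar R) (E : set 'rV[R]_d) : \bar R :=
  ereal_sup [set hausdorff_delta N g delta E | delta in [set delta : R | 0 < delta]].

Definition dcube (R : realType) (d : nat) (j : int) (k : 'I_d -> int) : set 'rV[R]_d :=
  [set x | forall i : 'I_d,
     (k i)%:~R <= (2 : R) ^ j * x ord0 i < (k i)%:~R + 1].

Definition eps_h (R : realType) (d : nat) (h : \bar R -> \bar R) : \bar R :=
  ereal_sup [set e%:E | e in [set e : R | 0 < e /\
     (forall r s : R, 0 <= r -> r <= s -> s <= e -> (h r%:E <= h s%:E)%E) /\
     (forall r s : R, 0 < r -> r <= s -> s <= e ->
        (h s%:E * (s ^- d)%:E <= h r%:E * (r ^- d)%:E)%E)]].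

(** M^h_oo : dyadic net content (coverings by countably many dyadic cubes of
    diameter < eps_h; empty members allow finite coverings) *)
Definition Minf (R : realType) (d : nat) (N : 'rV[R]_d -> R)
  (h : \bar R -> \bar R) (E : set 'rV[R]_d) : \bar R :=
  ereal_inf [set s | exists lam : nat -> set 'rV[R]_d,
    (forall n, lam n = set0 \/
       ((exists j k, lam n = dcube j k) /\ (diamN N (lam n) < eps_h d h)%E)) /\
    E `<=` \bigcup_n lam n /\
    s = (\sum_(n <oo) h (diamN N (lam n)))%E].

Definition large_int (R : realType) (d : nat) (N : 'rV[R]_d -> R)
  (g : \bar R -> \bar R) (U : set 'rV[R]_d) : set (set 'rV[R]_d) :=
  [set F | G_delta F /\
    forall h : \bar R -> \bar R, gauge h -> d_normalized d h -> prec h (gd d g) ->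
    forall V : set 'rV[R]_d, open V -> V `<=` U ->
      Minf N h (F `&` V) = Minf N h V].

Definition Zset (R : realType) (d : nat) (U : set 'rV[R]_d) : set (set 'rV[R]_d) :=
  [set E | borel_d E /\ lebesgue_d (E `&` U) = 0%E].

Definition Maj (R : realType) (d : nat) (N : 'rV[R]_d -> R)
  (E U : set 'rV[R]_d) : set (\bar R -> \bar R) :=
  [set g | G_infty d g /\ hausdorff N g (E `&` U) = 0%E].

Definition Min (R : realType) (d : nat) (N : 'rV[R]_d -> R)
  (E U : set 'rV[R]_d) : set (\bar R -> \bar R) :=
  [set g | G_star d g /\ exists2 F, large_int N g U F & F `<=` E].

Definition classR (R : realType) (nu : {measure set R -> \bar R}) : Prop :=
  nu (~` `]0%R, 1%R]%classic) = 0%E /\ nu `]0%R, 1%R]%classic = +oo%E /\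
  (forall rho : R, 0 < rho <= 1 -> (nu `[rho, 1%R]%classic < +oo)%E).

Definition classRd (R : realType) (d : nat) (nu : {measure set R -> \bar R}) : Prop :=
  classR nu /\ (\int[nu]_(r in `]0%R, 1%R]%classic) (r ^+ d)%:E < +oo)%E.

Definition Gnu (R : realType) (d : nat) (nu : {measure set R -> \bar R})
  : set (\bar R -> \bar R) :=
  [set g | G_infty d g /\ (\int[nu]_(r in `]0%R, 1%R]%classic) gd d g r%:E)%E = +oo%E].

Definition nu_describable (R : realType) (d : nat) (N : 'rV[R]_d -> R)
  (nu : {measure set R -> \bar R}) (E U : set 'rV[R]_d) : Prop :=
  Zset U E /\
  Maj N E U = G_infty d `\` Gnu d nu /\
  Min N E U `&` G_infty d = Gnu d nu.

Definition Sp (R : realType) (d : nat) := (R * 'rV[R]_d)%type.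

Definition BSp (R : realType) (d : nat) :=
  g_sigma_algebraType [set A : set (Sp R d) | open A].

Definition Sset (R : realType) (d : nat) (U : set 'rV[R]_d) : set (BSp R d) :=
  [set z | 0 < z.1 <= 1 /\ U z.2].

(** intensity nu (x) L^d( . cap U), as the outer measure generated by
    measurable rectangles I x box (Caratheodory extension) *)
Definition intensity (R : realType) (d : nat) (nu : {measure set R -> \bar R})
  (U : set 'rV[R]_d) (E : set (BSp R d)) : \bar R :=
  ereal_inf [set s | exists (I : nat -> set R) (a b : nat -> 'rV[R]_d),
    (forall n, measurable (I n)) /\
    E `&` Sset U `<=` \bigcup_n [set z : BSp R d | I n z.1 /\ box (a n) (b n) z.2] /\
    s = (\sum_(n <oo) (nu (I n) * (boxvol (a n) (b n))%:E))%E].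

Definition poisson_point_measure (R : realType) (d : nat)
  (dO : measure_display) (Omega : measurableType dO) (P : probability Omega R)
  (S : set (BSp R d)) (pi : set (BSp R d) -> \bar R)
  (Pi : Omega -> {measure set (BSp R d) -> \bar R}) : Prop :=
  (forall w (E : set (BSp R d)), measurable E ->
      Pi w E = +oo%E \/ exists k : nat, Pi w E = (k%:R)%:E) /\
  (forall w, Pi w (~` S) = 0%E) /\
  (forall E : set (BSp R d), measurable E -> measurable_fun setT (fun w => Pi w E)) /\
  (forall E : set (BSp R d), measurable E ->
     (pi E = +oo%E -> P [set w | Pi w E = +oo%E] = 1%E) /\
     (forall l : R, pi E = l%:E -> forall k : nat,
        P [set w | Pi w E = (k%:R)%:E] = (expR (- l) * l ^+ k / (k`!)%:R)%:E)) /\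
  (forall (n : nat) (E : 'I_n -> set (BSp R d)) (A : 'I_n -> set (\bar R)),
     (forall i, measurable (E i)) ->
     (forall i j, i != j -> E i `&` E j = set0) ->
     (forall i, measurable (A i)) ->
     P (\bigcap_(i in [set: 'I_n]) [set w | A i (Pi w (E i))]) =
     (\prod_(i < n) P [set w | A i (Pi w (E i))])%E).

Definition Fnu (R : realType) (d : nat) (N : 'rV[R]_d -> R)
  (dO : measure_display) (Omega : measurableType dO) (U : set 'rV[R]_d)
  (Pi : Omega -> {measure set (BSp R d) -> \bar R}) (w : Omega) : set 'rV[R]_d :=
  [set y | (\int[Pi w]_(z in Sset U) (\1_[set z : BSp R d | N (y - z.2) < z.1] z)%:E)%E
           = +oo%E].

(* Main.v *)
(**
Let [m s] be the mass of [nu] on radii above the diameter [delta s] of the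
dyadic cubes of generation [s], and let [lev j] be the first [s] at which [m s]
exceeds a multiple of [2 ^ (j d)].  Almost surely the number of points of [Pi]
in a box with radius above [delta s] is [O (1 + m s)], and at least half of the
generation [j] subcubes of a given cube contain the centre of a ball of radius
above [delta (lev j)], for all large [j].  Everything else is deterministic.

The first property bounds the cost of the natural covering of [F_nu] by
[\sum_s (m (s+1) - m s) g(delta s)], which is comparable to the integral of [g].
From the second one, a greedy choice of disjoint cubes lying in the open sets
which shrink to [F_nu] shows that a covering of [F_nu] inside a cube costs at
least [1/16] of the gauge of that cube as soon as the integral of [g_d] diverges.
Passing to a slightly larger gauge turns [1/16] into [1] (the small cubes of a
covering have negligible cost for the former gauge), and a Baire type argument
transfers the bound to the intersection.  The strict comparisons between gauges
are handled by composing [g_d] with the envelopes [inf_k (b_k + c_k t)], which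
are chosen so that convergence, or divergence, of the sums is preserved.
*)
Require Import Defs.
From HB Require Import structures.
From mathcomp Require Import all_boot all_order all_algebra.
From mathcomp Require Import all_classical all_reals all_analysis.
From mathcomp Require Import measurable_realfun lebesgue_measure lebesgue_integral.
From mathcomp Require Import ring lra zify.

Set Implicit Arguments.
Unset Strict Implicit.
Unset Printing Implicit Defensive.

Import Order.TTheory GRing.Theory Num.Theory.
Import numFieldNormedType.Exports.

Local Open Scope classical_set_scope.
Local Open Scope ring_scope.

(** Gauges form an uncountable family, so the exceptional null set must not depend on them: the two
    almost sure properties involve only [nu], [U] and dyadic cubes, and all gauges are then treated
    on one fixed outcome. Every cube of generation [j] has diameter [delta j], so a gauge enters
    only through its values at these diameters. The greedy choice is a mass transference. In the
    typical case a hit at generation [j] yields a cube of generation [lev j] inside the open set, of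
    weight [v (lev j)]; it is selected through an enclosing cube whose volume is comparable to
    [v (lev j)], up to normalisation. Conflicts between choices are then controlled by counting and
    volume alone, and the volume gained at generation [j] is of order [2 ^ (j d) v (lev j)], whose
    sum diverges with the integral. Passing to a larger gauge needs a ratio tending to infinity, so
    the envelopes serve in both directions: below [g_d] to show that a Hausdorff measure is not
    zero, above [g_d] to exclude a large intersection subset. *)

(** * Sums over sets of indices *)

Section Esum.
Context {R : realType}.
Local Open Scope ereal_scope.

Lemma le_esum_inj (T T' : choiceType) (A : set T) (B : set T') (f : T -> T')
    (a : T -> \bar R) (b : T' -> \bar R) :
  (forall t, A t -> B (f t)) -> set_inj A f ->
  (forall t, A t -> a t <= b (f t)) -> (forall t, B t -> 0 <= b t) ->
  \esum_(t in A) a t <= \esum_(t in B) b t.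
Proof.
move=> fAB finj ab b0; apply: (@le_trans _ _ (\esum_(t in A) b (f t))).
  exact: le_esum.
rewrite -(esum_image A f b) //.
rewrite -[X in X <= _](_ : \esum_(t in B `&` (f @` A)) b t = _); last first.
  by congr esum; apply/setIidr => _ [t At <-]; exact: fAB.
rewrite [leRHS](esumID (f @` A)) //.
by rewrite leeDl // esum_ge0 // => t [/b0].
Qed.

Lemma subset_le_esum (T : choiceType) (A B : set T) (a : T -> \bar R) :
  A `<=` B -> (forall t, B t -> 0 <= a t) ->
  \esum_(t in A) a t <= \esum_(t in B) a t.
Proof. by move=> AB a0; apply: (@le_esum_inj _ _ _ _ id). Qed.

Lemma le_esum_cover (T J : choiceType) (A : set T) (D : set J) (F : J -> set T)
    (a : T -> \bar R) :
  A `<=` \bigcup_(j in D) F j -> (forall j t, D j -> F j t -> 0 <= a t) ->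
  \esum_(t in A) a t <= \esum_(j in D) \esum_(t in F j) a t.
Proof.
move=> AF a0.
have [[t0 At0]|nA] := pselect (exists t, A t); last first.
  rewrite esum1; first by apply: esum_ge0 => j Dj; apply: esum_ge0 => t; exact: a0 Dj.
  by move=> t At; exfalso; apply: nA; exists t.
have [j0 _ _] := AF _ At0.
rewrite esum_esum //.
have /choice[f fP] (t : T) : exists j, A t -> D j /\ F j t.
  have [/AF[j Dj Fj]|nA] := pselect (A t); first by exists j.
  by exists j0 => /nA.
apply: (@le_esum_inj _ _ _ _ (fun t => (f t, t))) => //=.
  by move=> s t _ _ [].
by move=> [j t] /= [Dj Fj]; exact: a0 Fj.
Qed.

Lemma le_esum_setU (T : choiceType) (A B : set T) (a : T -> \bar R) :
  (forall t, A t -> 0 <= a t) -> (forall t, B t -> 0 <= a t) ->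
  \esum_(t in A `|` B) a t <= \esum_(t in A) a t + \esum_(t in B) a t.
Proof.
move=> a0 b0; rewrite (esumID A) => [|t [/a0|/b0]] //.
by apply: leeD; apply: subset_le_esum => // t [[]].
Qed.

Lemma esum_disjoint_le (T J : choiceType) (A : set T) (D : set J)
    (F : J -> set T) (a : T -> \bar R) :
  (forall j, D j -> F j `<=` A) ->
  (forall i j t, D i -> D j -> F i t -> F j t -> i = j) ->
  (forall t, A t -> 0 <= a t) ->
  \esum_(j in D) \esum_(t in F j) a t <= \esum_(t in A) a t.
Proof.
move=> FA Fdis a0; rewrite esum_esum => [|j t Dj /(FA j Dj)]; last exact: a0.
apply: (@le_esum_inj _ _ _ _ snd) => //=.
- by move=> [j t] /= [Dj Ft]; exact: (FA j).
- move=> [i s] [j t]; rewrite !inE /= => -[Di Fs] [Dj Ft] st.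
  by subst t; rewrite (Fdis i j s).
Qed.

Lemma esumZ (T : choiceType) (A : set T) (c : R) (a : T -> \bar R) :
  (0 < c)%R -> (forall t, A t -> 0 <= a t) ->
  \esum_(t in A) (c%:E * a t) = c%:E * \esum_(t in A) a t.
Proof.
have le (e : R) (b : T -> \bar R) : (0 < e)%R -> (forall t, 0 <= b t) ->
    \esum_(t in A) (e%:E * b t) <= e%:E * \esum_(t in A) b t.
  move=> e0 b0; apply: ge_ereal_sup => _ [X [finX XA] <-].
  rewrite -ge0_mule_fsumr //.
  apply: lee_wpmul2l; first by rewrite lee_fin ltW.
  by apply: esum_ge; exists X.
move=> c0; wlog a0 : a / forall t, 0 <= a t => [h aA|_].
  pose a' t := if t \in A then a t else 0.
  have aE t : A t -> a t = a' t by move=> At; rewrite /a' mem_set.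
  rewrite (eq_esum (b := fun t => c%:E * a' t)) => [|t /aE ->//].
  rewrite h //; first by congr (_ * _); apply: eq_esum => t /aE ->.
  - by move=> t; rewrite /a'; case: ifPn => // /[!inE]; exact: aA.
  - by move=> t At; rewrite -aE //; exact: aA.
apply/eqP; rewrite eq_le le //=.
have ca0 t : 0 <= c%:E * a t by rewrite mule_ge0 // lee_fin ltW.
have cV (x : \bar R) : c^-1%:E * (c%:E * x) = x.
  by rewrite muleA -EFinM mulVf ?gt_eqF // mul1e.
(* The opposite inequality is the one just proved, for the factor [c^-1]. *)
have := @le (c^-1)%R (fun t => c%:E * a t) _ ca0; rewrite invr_gt0 => /(_ c0).
under eq_esum do rewrite cV.
move=> h; apply: (@le_trans _ _ (c%:E * (c^-1%:E * \esum_(t in A) (c%:E * a t)))).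
  by apply: lee_wpmul2l h; rewrite lee_fin ltW.
by rewrite muleA -EFinM mulfV ?gt_eqF // mul1e.
Qed.

Lemma esum_pickle (T : countType) (A : set T) (a : T -> \bar R) :
  (forall t, A t -> 0 <= a t) ->
  \sum_(n <oo) (if pickle_inv n is Some t then if t \in A then a t else 0 else 0)
  <= \esum_(t in A) a t.
Proof.
move=> a0; rewrite nneseries_esumT; last first.
  move=> n; case: pickle_inv => // t; case: ifPn => // /[!inE]; exact: a0.
have [[t0 At0]|nA] := pselect (exists t, A t); last first.
  rewrite esum1; first exact: esum_ge0.
  move=> n _; case: pickle_inv => // t; case: ifPn => // /[!inE] At.
  by exfalso; apply: nA; exists t.
pose I := [set n | exists2 t, pickle_inv n = Some t & A t].
rewrite [leLHS](_ : _ = \esum_(n in I) (if pickle_inv n is Some t then a t else 0)); last first.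
  rewrite [RHS]esum_mkcond; apply: eq_esum => n _; rewrite /I.
  case: (boolP (n \in _)); rewrite ?(inE, notin_setE) /=.
    by move=> [t -> At]; rewrite mem_set.
  case: pickle_inv => // t nn; case: ifPn => // /[!inE] At.
  by exfalso; apply: nn; exists t.
apply: (@le_esum_inj _ _ _ _ (fun n => odflt t0 (pickle_inv n))) => //.
- by move=> n [t -> At].
- move=> m n; rewrite !inE => -[s ms As] [t nt At]; rewrite ms nt /= => st.
  have := @pickle_invK T m; have := @pickle_invK T n.
  by rewrite ms nt /= st => -> ->.
- by move=> n [t -> _].
Qed.
End Esum.

(** * Dyadic cubes *)

Section Pow2.
Context {R : realType}.

Lemma pow2_gt0 (j : int) : 0 < (2 : R) ^ j.
Proof. by rewrite exprz_gt0. Qed.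

Lemma pow2D (i j : int) : (2 : R) ^ (i + j) = 2 ^ i * 2 ^ j.
Proof. by rewrite expfzDr // pnatr_eq0. Qed.

Lemma pow2V (j : int) : (2 : R) ^ (- j) * 2 ^ j = 1.
Proof. by rewrite -pow2D addNr expr0z. Qed.

Lemma ler_pow2 (i j : int) : ((2 : R) ^ i <= 2 ^ j) = (i <= j).
Proof. by rewrite ler_eXz2l // ltr1n. Qed.

Lemma pow2S (j : int) : (2 : R) ^ (j + 1) = 2 * 2 ^ j.
Proof. by rewrite pow2D expr1z mulrC. Qed.

Lemma pow2_int (n : nat) : (2 : R) ^ (n%:Z) = ((2 ^ n)%N%:Z)%:~R.
Proof. by rewrite -pmulrn -exprnP; exact/esym/natrX. Qed.

Lemma pow2_small (e : R) : 0 < e ->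
  exists n : nat, forall j : int, n%:Z <= j -> 2 ^ (- j) < e.
Proof.
move=> e0; exists (Num.bound e^-1) => j nj.
have /archi_boundP : 0 <= e^-1 by rewrite invr_ge0 ltW.
set n := Num.bound _ in nj * => en.
apply: (@le_lt_trans _ _ (2 ^ (- n%:Z))); first by rewrite ler_pow2 lerN2.
rewrite -invr_expz invf_plt ?posrE ?pow2_gt0 //.
apply: (lt_le_trans en); rewrite -exprnP.
have -> : (2 : R) ^+ n = (2 ^ n)%N%:R by exact/esym/natrX.
by rewrite ler_nat ltnW // ltn_expl.
Qed.
End Pow2.

Section Cubes.
Context {R : realType} {d : nat}.
Local Notation V := 'rV[R]_d.

(** Generation and integer position. Finite functions keep the index type countable, as sums over
    sets of cubes and enumerations by [pickle] require. *)
Definition cidx : countType := (int * {ffun 'I_d -> int})%type.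

Definition cube (c : cidx) : set V := dcube c.1 c.2.

Definition cof (j : int) (x : V) : cidx :=
  (j, [ffun i => Num.floor (2 ^ j * x ord0 i)]).

Definition corner (c : cidx) : V := \row_i ((c.2 i)%:~R * 2 ^ (- c.1)).

Definition ucorner (c : cidx) : V := \row_i (((c.2 i)%:~R + 1) * 2 ^ (- c.1)).

Definition clcube (c : cidx) : set V :=
  [set x | forall i, corner c ord0 i <= x ord0 i <= ucorner c ord0 i].

Definition sub (c c' : cidx) : Prop := c'.1 <= c.1 /\ cube c `<=` cube c'.

(** A decreasing sequence of half-open cubes may have empty intersection; keeping the closed cube
    inside the previous cube restores compactness. *)
Definition inner (c c' : cidx) : Prop := c'.1 < c.1 /\ clcube c `<=` cube c'.

Definition vol (c : cidx) : R := (2 ^ (- c.1)) ^+ d.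

Lemma cubeP (c : cidx) x : cube c x <-> cof c.1 x = c.
Proof.
case: c => j k; split=> [cx|<-] /=.
  congr (_, _); apply/ffunP => i; rewrite ffunE; apply: floor_def.
  by rewrite intrD; exact: cx.
move=> i /=; rewrite ffunE /=.
by have := floor_itv (2 ^ j * x ord0 i); rewrite intrD.
Qed.

Lemma cube_cof j x : cube (cof j x) x.
Proof. exact/cubeP. Qed.

Lemma cube_uniq (c c' : cidx) x : c.1 = c'.1 -> cube c x -> cube c' x -> c = c'.
Proof. by move=> e /cubeP <- /cubeP <-; rewrite e. Qed.

Lemma cube_box (c : cidx) : cube c = box (corner c) (ucorner c).
Proof.
apply/seteqP; split=> x cx i; have := cx i; rewrite !mxE /=.
  move=> /andP[l u].
  by rewrite -ler_pdivlMr ?invr_gt0 ?pow2_gt0 // -invr_expz invrK mulrC l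
    -ltr_pdivrMr ?invr_gt0 ?pow2_gt0 // invrK mulrC u.
move=> /andP[]; rewrite -invr_expz => l u.
rewrite -ler_pdivrMl ?pow2_gt0 // mulrC l /=.
by rewrite -ltr_pdivlMl ?pow2_gt0 // mulrC.
Qed.

Lemma cube_corner (c : cidx) : cube c (corner c).
Proof.
move=> i /=; rewrite !mxE mulrCA -pow2D subrr expr0z mulr1 lexx /=.
by rewrite ltrDl ltr01.
Qed.

Lemma boxvol_cube (c : cidx) : boxvol (corner c) (ucorner c) = vol c.
Proof.
rewrite /boxvol /vol (eq_bigr (fun=> 2 ^ (- c.1))).
  by rewrite prodr_const card_ord.
move=> i _; rewrite !mxE -mulrBl addrAC subrr add0r mul1r.
by apply/max_idPr; rewrite ltW ?pow2_gt0.
Qed.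

Lemma vol_gt0 (c : cidx) : 0 < vol c.
Proof. by rewrite exprn_gt0 ?pow2_gt0. Qed.

Lemma cube_clcube (c : cidx) : cube c `<=` clcube c.
Proof. by rewrite cube_box => x cx i; have /andP[-> /ltW ->] := cx i. Qed.

(** After scaling, both cubes are bounded by integers, and a strict inequality between integers
    leaves a gap of one: a cube that meets a coarser one cannot stick out of it. *)
Lemma cube_nest (c c' : cidx) x : c'.1 <= c.1 -> cube c x -> cube c' x -> sub c c'.
Proof.
move=> c'c cx c'x; split=> // y cy.
have [n cn] : exists n : nat, c.1 = c'.1 + n%:Z.
  by exists `|c.1 - c'.1|%N; lia.
move=> i; have := cx i; have := c'x i; have := cy i.
set k := c.2 i; set k' := c'.2 i; rewrite cn pow2D.
set X := 2 ^ c'.1 * x ord0 i; set Y := 2 ^ c'.1 * y ord0 i.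
have -> : 2 ^ c'.1 * 2 ^ n%:Z * x ord0 i = 2 ^ n%:Z * X by rewrite /X; ring.
have -> : 2 ^ c'.1 * 2 ^ n%:Z * y ord0 i = 2 ^ n%:Z * Y by rewrite /Y; ring.
rewrite -[k'%:~R + 1](intrD _ k' 1) -[k%:~R + 1](intrD _ k 1).
move=> /andP[ky yk] /andP[kx xk] /andP[lx xl].
have p0 := @pow2_gt0 R n%:Z.
rewrite -(ler_pM2l p0) -(ltr_pM2l p0); rewrite -(ler_pM2l p0) in kx.
rewrite -(ltr_pM2l p0) in xk.
rewrite pow2_int -intrM in kx; rewrite pow2_int -intrM in xk.
rewrite pow2_int -!intrM; rewrite pow2_int in lx xl ky yk.
have h1 := le_lt_trans kx xl; rewrite ltr_int in h1.
have h2 := le_lt_trans lx xk; rewrite ltr_int in h2.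
apply/andP; split.
  by apply: le_trans ky; rewrite ler_int; lia.
by apply: (lt_le_trans yk); rewrite ler_int; lia.
Qed.

Lemma sub_refl c : sub c c. Proof. by split. Qed.

Lemma sub_trans c2 c1 c3 : sub c1 c2 -> sub c2 c3 -> sub c1 c3.
Proof.
by move=> [l12 s12] [l23 s23]; split; [exact: le_trans l12|exact: subset_trans s23].
Qed.

Lemma sub_gen_eq c c' : sub c c' -> c.1 = c'.1 -> c = c'.
Proof.
by move=> [_ s] e; apply: (cube_uniq e (cube_corner c)); apply/s/cube_corner.
Qed.

Lemma sub_antisym c c' : sub c c' -> sub c' c -> c = c'.
Proof.
move=> s [l _]; apply: sub_gen_eq => //.
by apply/eqP; rewrite eq_le l; case: s => ->.
Qed.

Lemma sub_total c c' x : cube c x -> cube c' x -> sub c c' \/ sub c' c.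
Proof.
move=> cx c'x; have [/cube_nest|/ltW/cube_nest] := leP c'.1 c.1.
  by move=> /(_ x cx c'x); left.
by move=> /(_ x c'x cx); right.
Qed.

Lemma inner_sub c c' : inner c c' -> sub c c'.
Proof.
by move=> [l s]; split; first exact: ltW; apply: subset_trans s; exact: cube_clcube.
Qed.

Lemma cof_sub (c : cidx) j x : cube c x -> c.1 <= j -> sub (cof j x) c.
Proof. by move=> cx cj; apply: (cube_nest _ (cube_cof j x)). Qed.

Lemma clcube_dist (c : cidx) x y i : clcube c x -> clcube c y ->
  `|x ord0 i - y ord0 i| <= 2 ^ (- c.1).
Proof.
move=> /(_ i); rewrite !mxE => /andP[a b] /(_ i); rewrite !mxE => /andP[e f].
by rewrite ler_norml; apply/andP; split; lra.
Qed.

Lemma fin_eventually (Q : 'I_d -> int -> Prop) :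
  (forall i, exists n : nat, forall j : int, n%:Z <= j -> Q i j) ->
  exists n : nat, forall j : int, n%:Z <= j -> forall i, Q i j.
Proof.
move=> /choice[f fP]; exists (\max_i f i)%N => j nj i; apply: fP.
by apply: le_trans nj; rewrite lez_nat leq_bigmax.
Qed.

(** Lower faces cause no trouble, as the lower corner of a small cube around [x] stays in [P]; only
    the distance from [x] to the upper faces has to exceed the side. *)
Lemma inner_ex (P : cidx) x : cube P x ->
  exists n : nat, forall j : int, n%:Z <= j -> inner (cof j x) P.
Proof.
move=> Px; have Pbx : box (corner P) (ucorner P) x by rewrite -cube_box.
have [|n nP] := @fin_eventually
    (fun i j => (2 : R) ^ (- j) < ucorner P ord0 i - x ord0 i).
  by move=> i; apply: pow2_small; have /andP[_] := Pbx i; rewrite subr_gt0.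
- exists (maxn n `|P.1|.+1) => j nj.
  have Pj : P.1 < j by lia.
  have sP := cof_sub Px (ltW Pj).
  split=> // y yj; rewrite cube_box => i; apply/andP; split.
    have /andP[+ _] := yj i; apply: le_trans.
    have := sP.2 _ (cube_corner _).
    by rewrite cube_box => /(_ i) /andP[].
  have := clcube_dist i yj (cube_clcube (cube_cof j x)).
  have nj' : n%:Z <= j by lia.
  have /= := nP j nj' i.
  by rewrite ler_norml => h1 /andP[h2 h3]; lra.
Qed.

Lemma open_cube (G : set V) x : open G -> G x ->
  exists n : nat, forall j : int, n%:Z <= j -> cube (cof j x) `<=` G.
Proof.
move=> oG Gx; have : nbhs x G by exact: open_nbhs_nbhs.
move=> /nbhs_ballP[e /= e0 eG].
have [n nP] := pow2_small e0.
exists n => j nj y yj; apply: eG; split=> // i k; rewrite (ord1 i) /ball /=.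
have := clcube_dist k (cube_clcube (cube_cof j x)) (cube_clcube yj).
by move=> /le_lt_trans; apply; exact: nP.
Qed.
End Cubes.

(** * Volumes of boxes and countable coverings *)

Section BoxVolume.
Context {R : realType}.
Local Open Scope ereal_scope.

Lemma integral_indic_cst (dT : measure_display) (T : measurableType dT)
    (mu : {measure set T -> \bar R}) (B : set T) (c : R) :
  measurable B -> (0 <= c)%R ->
  \int[mu]_x (c%:E * (\1_B x)%:E) = c%:E * mu B.
Proof.
move=> mB c0; rewrite ge0_integralZl_EFin //.
- by rewrite integral_indic // setIT.
- by apply/measurable_EFinP; exact: measurable_indic.
Qed.

(** Integration of a pointwise bound over [t]. It stands in for Fubini, both for volumes, one
    coordinate at a time, and for the intensity, with [nu] as the measure. *)
Lemma measure_le_slices (dT : measure_display) (T : measurableType dT)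
    (mu : {measure set T -> \bar R}) (B : set T) (c : R) (A : nat -> set T)
    (e : nat -> R) :
  measurable B -> (0 <= c)%R -> (forall m, measurable (A m)) ->
  (forall m, (0 <= e m)%R) ->
  (forall t, B t -> c%:E <= \sum_(m <oo) (e m)%:E * (\1_(A m) t)%:E) ->
  c%:E * mu B <= \sum_(m <oo) (e m)%:E * mu (A m).
Proof.
move=> mB c0 mA e0 h.
have mI (D : set T) (k : R) : measurable D ->
    measurable_fun setT (fun t : T => k%:E * (\1_D t)%:E).
  by move=> mD; apply: measurable_funeM; apply/measurable_EFinP; exact: measurable_indic.
rewrite -integral_indic_cst //.
rewrite (eq_eseriesr (g := fun m => \int[mu]_x ((e m)%:E * (\1_(A m) x)%:E))); last first.
  by move=> m _; rewrite integral_indic_cst.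
rewrite -integral_nneseries //; last by move=> *; rewrite mule_ge0 ?lee_fin.
apply: ge0_le_integral => //.
- by move=> t _; rewrite mule_ge0 ?lee_fin.
- exact: mI.
- by apply: ge0_emeasurable_sum => // [m t _ _|m _]; rewrite ?mule_ge0 ?lee_fin //; exact: mI.
move=> t _; rewrite indicE; case: (boolP (t \in B)) => [/[!inE] Bt|_].
  by rewrite mule1; exact: h.
by rewrite mule0 nneseries_ge0 // => m _ _; rewrite mule_ge0 ?lee_fin.
by move=> m; exact: mI.
Qed.

(** Points are sequences of which only the first [n] terms are constrained, so that induction on the
    dimension involves no change of type. *)
Definition nbox (n : nat) (a b : nat -> R) : set (nat -> R) :=
  [set x | forall i, (i < n)%N -> (a i <= x i < b i)%R].

Definition nvol (n : nat) (a b : nat -> R) : R :=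
  (\prod_(i < n) Num.max 0 (b i - a i))%R.

Lemma nvol_ge0 n a b : (0 <= nvol n a b)%R.
Proof. by apply: prodr_ge0 => i _; rewrite le_max lexx. Qed.

Lemma lebesgue_measure_itvco (a b : R) :
  lebesgue_measure `[a, b[%classic = (Num.max 0 (b - a))%:E.
Proof.
rewrite lebesgue_measure_itv /= lte_fin; case: ltP => ab.
  by rewrite -EFinB; congr (_%:E); apply/esym/max_idPr; rewrite subr_ge0 ltW.
by congr (_%:E); apply/esym/max_idPl; rewrite subr_le0.
Qed.

(** Induction on the dimension: for each value [t] of the last coordinate, the boxes whose last side
    contains [t] have projections covering the remaining box, and the resulting bounds are
    integrated in [t]. The set [P] records this selection of boxes. *)
Lemma nvol_cover n (a b : nat -> R) (A B : nat -> nat -> R) (P : set nat) :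
  nbox n a b `<=` \bigcup_(m in P) nbox n (A m) (B m) ->
  (nvol n a b)%:E <= \sum_(m <oo) (nvol n (A m) (B m) * \1_P m)%:E.
Proof.
have s0 n' (A' B' : nat -> nat -> R) (P' : set nat) m :
    (0 <= nvol n' (A' m) (B' m) * \1_P' m)%R by rewrite mulr_ge0 ?nvol_ge0.
elim: n a b A B P => [|n IHn] a b A B P cov.
  have [m Pm _] := cov (fun=> 0%R) (fun i i0 => False_ind _ (notF i0)).
  rewrite nneseries_esumT; last by move=> k; rewrite lee_fin.
  apply: (@le_trans _ _ (\esum_(k in [set m]) (nvol 0 (A k) (B k) * \1_P k)%:E)).
    by rewrite esum_set1 ?lee_fin // indicE mem_set // mulr1 /nvol !big_ord0.
  by apply: subset_le_esum => // k _; rewrite lee_fin.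
rewrite {1}/nvol big_ord_recr /= -/(nvol n a b) EFinM -lebesgue_measure_itvco.
rewrite (_ : \sum_(m <oo) _ = \sum_(m <oo) (nvol n (A m) (B m) * \1_P m)%:E *
    lebesgue_measure `[A m n, B m n[%classic); last first.
  apply: eq_eseriesr => m _; rewrite lebesgue_measure_itvco -EFinM; congr (_%:E).
  by rewrite {1}/nvol big_ord_recr /= -/(nvol n _ _) mulrAC.
apply: measure_le_slices => //; first exact: nvol_ge0.
move=> t /=; rewrite in_itv /= => tab.
have := IHn a b A B (P `&` [set m | A m n <= t < B m n]%R).
rewrite (_ : \sum_(m <oo) _ = \sum_(m <oo)
   (nvol n (A m) (B m) * \1_P m)%:E * (\1_(`[A m n, B m n[%classic) t)%:E); last first.
  apply: eq_eseriesr => m _; rewrite -EFinM -mulrA; congr ((_ * _)%:E).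
  rewrite !indicE in_setI; case: (m \in P); rewrite /= ?mul0r // mul1r.
  by congr ((_ : bool)%:R); apply/idP/idP; rewrite !inE /= in_itv.
apply=> x xab; pose y i := if i == n then t else x i.
have [|m Pm my] := cov y.
  move=> i; rewrite ltnS leq_eqVlt /y; case: eqP => [->//|_ /= i_n].
  exact: xab.
exists m.
  by split=> //=; have := my n (ltnSn n); rewrite /y eqxx.
by move=> i i_n; have := my i (ltnW i_n); rewrite /y ltn_eqF.
Qed.

Lemma boxvol_cover (d : nat) (a b : 'rV[R]_d) (A B : nat -> 'rV[R]_d) (P : set nat) :
  box a b `<=` \bigcup_(m in P) box (A m) (B m) ->
  (boxvol a b)%:E <= \sum_(m <oo) (boxvol (A m) (B m) * \1_P m)%:E.
Proof.
move=> cov.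
pose ext (x : 'rV[R]_d) (i : nat) : R := if insub i is Some j then x ord0 j else 0%R.
have extE x (i : 'I_d) : ext x i = x ord0 i by rewrite /ext valK.
have volE u v : nvol d (ext u) (ext v) = boxvol u v.
  by apply: eq_bigr => i _; rewrite !extE.
rewrite -volE; under eq_eseriesr do rewrite -volE.
apply: (nvol_cover (A := fun m => ext (A m)) (B := fun m => ext (B m))) => x xab.
have [|m Pm my] := cov (\row_i x i).
  by move=> i; rewrite mxE -!extE; exact: xab.
exists m => // i i_d; have := my (Ordinal i_d).
by rewrite mxE -!(extE _ (Ordinal i_d)).
Qed.

Lemma boxvol_ge0 (d : nat) (a b : 'rV[R]_d) : (0 <= boxvol a b)%R.
Proof. by apply: prodr_ge0 => i _; rewrite le_max lexx. Qed.

Lemma vol_cover (d : nat) (c : @cidx d) (A : set (@cidx d)) :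
  @cube R d c `<=` \bigcup_(C in A) cube C ->
  (@vol R d c)%:E <= \esum_(C in A) (@vol R d C)%:E.
Proof.
move=> cov; rewrite -boxvol_cube.
pose a n : 'rV[R]_d := if pickle_inv n is Some C then corner C else 0%R.
pose b n : 'rV[R]_d := if pickle_inv n is Some C then ucorner C else 0%R.
pose P : set nat := [set n | exists2 C : @cidx d, pickle_inv n = Some C & A C].
apply: (@le_trans _ _ (\sum_(n <oo) (boxvol (a n) (b n) * \1_P n)%:E)).
  apply: boxvol_cover; rewrite -cube_box => x /cov[C AC Cx].
  exists (pickle C); first by exists C; rewrite ?pickleK_inv.
  by rewrite /a /b pickleK_inv -cube_box.
apply: le_trans (esum_pickle _); last by move=> C _; rewrite lee_fin ltW ?vol_gt0.
apply: lee_nneseries => n _.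
  by move=> _; rewrite lee_fin mulr_ge0 // boxvol_ge0.
rewrite indicE /a /b; case E: pickle_inv => [C|].
  case: (boolP (n \in P)) => [/[!inE] -[C' nC' AC']|_].
    by move: nC' AC'; rewrite E => -[<-] AC; rewrite mem_set // mulr1 boxvol_cube.
  by rewrite mulr0; case: ifP => // _; rewrite lee_fin ltW ?vol_gt0.
case: (boolP (n \in P)) => [/[!inE] -[C']|_]; first by rewrite E.
by rewrite mulr0.
Qed.
End BoxVolume.

(** * Net contents *)

Section Contents.
Context {R : realType} {d : nat}.
Local Notation I := (@cidx d).
Local Notation sub := (@sub R d).
Local Notation cube := (@cube R d).
Local Notation vol := (@vol R d).

(** The values of a gauge at the diameters of cubes, by generation. The third condition says that
    [u j] over the volume of a cube of generation [j] does not decrease with [j], just as [g(r)/r^d]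
    does not decrease when [r] gets smaller. *)
Definition weight (s0 : int) (u : int -> R) : Prop :=
  [/\ forall j, s0 <= j -> 0 < u j,
      forall i j, s0 <= i -> i <= j -> u j <= u i &
      forall i j, s0 <= i -> i <= j ->
        u i * (2 ^ (- j)) ^+ d <= u j * (2 ^ (- i)) ^+ d].

Definition covers (A : set I) (X : set 'rV[R]_d) := X `<=` \bigcup_(C in A) cube C.

(** Volume serves as mass distribution: each [C] inside [lam] costs at least its share
    [u lam.1 * vol C / vol lam], and the volumes add up to at least that of [lam]. *)
Lemma weight_cover s0 u (lam : I) (A : set I) : weight s0 u -> s0 <= lam.1 ->
  (forall C, A C -> sub C lam) -> covers A (cube lam) ->
  ((u lam.1)%:E <= \esum_(C in A) (u C.1)%:E)%E.
Proof.
move=> [u0 _ uv] s0l Al cov.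
have ul := u0 _ s0l; have vl := @vol_gt0 R d lam.
have ul' : 0 < u lam.1 / vol lam by rewrite divr_gt0.
apply: (@le_trans _ _ (\esum_(C in A) ((u lam.1 / vol lam)%:E * (vol C)%:E)%E)).
  rewrite esumZ // => [|t]; last by rewrite lee_fin ltW ?vol_gt0.
  rewrite -[u lam.1 in leLHS](divfK (lt0r_neq0 vl)) EFinM.
  by apply: lee_wpmul2l; [rewrite lee_fin ltW|exact: vol_cover].
apply: le_esum => C AC; rewrite -EFinM lee_fin mulrAC ler_pdivrMr //.
by apply: uv => //; case: (Al _ AC).
Qed.

Lemma expr_small (q e : R) : 0 <= q < 1 -> 0 < e -> exists n, q ^+ n < e.
Proof.
move=> /andP[q0 q1] e0.
have : (fun n => q ^+ n) @ \oo --> (0 : R) by apply: cvg_expr; rewrite ger0_norm.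
move=> /cvgrPdist_lt /(_ e e0) [n _ /(_ n (leqnn n))] /=.
by rewrite sub0r normrN ger0_norm ?exprn_ge0 // => h; exists n.
Qed.

(** * From a proportional content bound to a full one *)

Section SelfImprovement.
Variables (s0 : int) (u v : int -> R) (c : R) (X : set 'rV[R]_d) (T : set I).
Hypotheses (wu : weight s0 u) (wv : weight s0 v) (c01 : 0 < c <= 1).
Hypothesis Tsub : forall lam mu, T lam -> sub mu lam -> T mu.
Hypothesis uv_mono : forall i j, s0 <= i -> i <= j -> u i * v j <= u j * v i.
Hypothesis uv_oo : forall M : R, exists n : int, forall j, n <= j -> M * v j <= u j.
Hypothesis v_content : forall (lam : I) (A : set I), s0 <= lam.1 -> T lam ->
  (forall C, A C -> sub C lam) -> covers A (X `&` cube lam) ->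
  ((c * v lam.1)%:E <= \esum_(C in A) (v C.1)%:E)%E.

(* The cubes of a cheap cover which are much smaller than [lam] have negligible
   [v]-cost, so the large ones already cost a fixed proportion of [u lam.1]. *)
Let improve_step (al : R) : 0 <= al <= 1 ->
  (forall (lam : I) (A : set I), s0 <= lam.1 -> T lam ->
    (forall C, A C -> sub C lam) -> covers A (X `&` cube lam) ->
    ((al * u lam.1)%:E <= \esum_(C in A) (u C.1)%:E)%E) ->
  forall (lam : I) (A : set I), s0 <= lam.1 -> T lam ->
    (forall C, A C -> sub C lam) -> covers A (X `&` cube lam) ->
    (((al + (1 - al) * (c / 2)) * u lam.1)%:E <= \esum_(C in A) (u C.1)%:E)%E.
Proof.
move=> /andP[al0 al1] IH lam A s0l Tl Al cov.
have [u0 _ _] := wu; have [v0 _ _] := wv; have /andP[c0 c1] := c01.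
have ul := u0 _ s0l; have vl := v0 _ s0l.
have As0 C : A C -> s0 <= C.1 by move=> /Al[+ _]; apply: le_trans.
have uA C : A C -> (0 <= (u C.1)%:E)%E by move=> /As0 sC; rewrite lee_fin ltW ?u0.
have vA C : A C -> (0 <= (v C.1)%:E)%E by move=> /As0 sC; rewrite lee_fin ltW ?v0.
set S := (\esum_(C in A) _)%E.
have [Sge|Slt] := leP (u lam.1)%:E S.
  apply: le_trans Sge; rewrite lee_fin ler_piMl ?(ltW ul) //.
  have : 0 <= 1 - al by lra.
  nra.
(* Beyond this generation [u] dominates [v] so much that cubes of total [u]-cost at most [u lam.1]
   have total [v]-cost at most [c * v lam.1 / 2]. *)
have [n nP] := uv_oo (2 * u lam.1 / (c * v lam.1)).
pose J := Order.max n lam.1.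
have nJ : n <= J by rewrite le_max lexx.
have lJ : lam.1 <= J by rewrite le_max lexx orbT.
pose big : set I := [set C | C.1 < J].
pose Sb := (\esum_(C in A `&` big) (u C.1)%:E)%E.
pose Ss := (\esum_(C in A `&` ~` big) (u C.1)%:E)%E.
have SE : S = (Sb + Ss)%E by rewrite /S (esumID big).
have Sb0 : (0 <= Sb)%E by apply: esum_ge0 => C [/uA].
have Ss0 : (0 <= Ss)%E by apply: esum_ge0 => C [/uA].
have Sfin : S \is a fin_num.
  by rewrite ge0_fin_numE ?(lt_trans Slt) ?ltry // SE adde_ge0.
have [Sbfin Ssfin] : Sb \is a fin_num /\ Ss \is a fin_num.
  by move: Sfin; rewrite SE fin_numD => /andP[].
pose k := c * v lam.1 / (2 * u lam.1).
have k0 : 0 < k by rewrite !(divr_gt0, mulr_gt0).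
have Vs : (\esum_(C in A `&` ~` big) (v C.1)%:E <= k%:E * Ss)%E.
  rewrite /Ss -esumZ // => [|C [/uA]//]; apply: le_esum => C [AC /negP]; rewrite -leNgt => JC.
  rewrite -EFinM lee_fin.
  by rewrite -ler_pdivrMl // /k invf_div; exact: nP (le_trans nJ JC).
have Vb : ((u lam.1 / v lam.1)%:E * (\esum_(C in A `&` big) (v C.1)%:E) <= Sb)%E.
  rewrite -esumZ ?divr_gt0 // => [|C [/vA]//]; apply: le_esum => C [AC _].
  rewrite -EFinM lee_fin.
  rewrite mulrAC ler_pdivrMr //; apply: uv_mono => //.
  by case: (Al _ AC).
have := v_content s0l Tl Al cov; rewrite (esumID big) // => Vtot.
have Sbge : c / 2 * u lam.1 <= fine Sb.
  have Vs' : (\esum_(C in A `&` ~` big) (v C.1)%:E <= (c * v lam.1 / 2)%:E)%E.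
    apply: (le_trans Vs); rewrite -(fineK Ssfin) -EFinM lee_fin.
    have SsS : fine Ss <= u lam.1.
      rewrite -lee_fin fineK //; apply/ltW/(le_lt_trans _ Slt).
      by rewrite SE leeDr.
    apply: (@le_trans _ _ (k * u lam.1)); first by rewrite ler_pM2l.
    rewrite /k le_eqVlt; apply/orP; left; apply/eqP; field.
    by rewrite gt_eqF.
  have Vb' : ((c * v lam.1 / 2)%:E <= \esum_(C in A `&` big) (v C.1)%:E)%E.
    rewrite -(leeD2rE _ _ (_ : (c * v lam.1 / 2)%:E \is a fin_num)) //.
    rewrite -EFinD (_ : _ + _ = c * v lam.1); last by field.
    by apply: (le_trans Vtot); rewrite leeD2l.
  rewrite -lee_fin fineK //; apply: le_trans Vb.
  rewrite (_ : c / 2 * _ = u lam.1 / v lam.1 * (c * v lam.1 / 2)); last first.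
    by field; rewrite gt_eqF.
  by rewrite EFinM lee_wpmul2l // lee_fin divr_ge0 ?ltW.
(* [D] fills, at generation [J], the part of [lam] missed by the large cubes. Comparison with volume
   bounds [u lam.1] by [Sb + ED], and the induction hypothesis in each cube of [D] gives
   [al * ED <= Ss]. *)
pose D : set I := [set mu | mu.1 = J /\ sub mu lam /\
                     forall C, A C -> big C -> ~ sub mu C].
pose ED := (\esum_(mu in D) (u mu.1)%:E)%E.
have Ds0 mu : D mu -> s0 <= mu.1 by move=> [-> _]; exact: le_trans lJ.
have ED0 : (0 <= ED)%E by apply: esum_ge0 => mu /Ds0 sm; rewrite lee_fin ltW ?u0.
have cov' : covers (A `&` big `|` D) (cube lam).
  move=> x lx; pose mu := cof J x.
  have mux : cube mu x by exact: cube_cof.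
  have smu : sub mu lam by exact: cof_sub.
  have [[C [AC [bC sC]]]|nC] := pselect (exists C, A C /\ big C /\ sub mu C).
    by exists C; [left|exact: sC.2].
  by exists mu => //; right; split=> //; split=> // C AC bC sC; apply: nC; exists C.
have h1 : ((u lam.1)%:E <= Sb + ED)%E.
  apply: (le_trans (weight_cover wu s0l _ cov')).
    by move=> C [[/Al//]|[_ []]].
  apply: le_esum_setU => C; first by move=> [/uA].
  by move=> /Ds0 sC; rewrite lee_fin ltW ?u0.
have h2 : (\esum_(mu in D) (al * u mu.1)%:E <= Ss)%E.
  pose F (mu : I) := [set C | A C /\ sub C mu].
  apply: (@le_trans _ _ (\esum_(mu in D) \esum_(C in F mu) (u C.1)%:E)%E); last first.
    apply: esum_disjoint_le.
    - move=> mu [muJ _] C [AC sC]; split=> //; rewrite /big /=; apply/negP.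
      by rewrite -leNgt -muJ; case: sC.
    - move=> mu mu' C [muJ _] [mu'J _] [_ s1] [_ s2].
      apply: (@cube_uniq R d _ _ (corner C)); rewrite ?muJ ?mu'J //.
        exact/s1.2/cube_corner.
      exact/s2.2/cube_corner.
    - by move=> C [/uA].
  apply: le_esum => mu Dmu; have [muJ [smu nbig]] := Dmu.
  apply: IH; first exact: Ds0; first exact: Tsub smu.
    by move=> C [].
  move=> x [Xx mux]; have [C AC Cx] := cov x (conj Xx (smu.2 _ mux)).
  exists C => //; split=> //.
  have [//|sC] := sub_total Cx mux.
  have [bC|] := ltP C.1 J; first by case: (nbig C AC bC sC).
  by move=> JC; apply: (cube_nest _ Cx mux); rewrite muJ.
rewrite -(fineK Sfin) lee_fin SE fineD //.
have [al_eq0|al_neq0] := eqVneq al 0.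
  rewrite al_eq0; have := fine_ge0 Ss0; nra.
have al_gt0 : 0 < al by rewrite lt_def al_neq0.
have {}h2 : (al%:E * ED <= Ss)%E.
  apply: le_trans h2; rewrite -esumZ // => C /Ds0 sC.
  by rewrite lee_fin ltW ?u0.
have EDfin : ED \is a fin_num.
  rewrite ge0_fin_numE //; case: ED ED0 h2 {h1} => [r||] //= _; first by rewrite ltry.
  by rewrite gt0_muley ?lte_fin // leye_eq => /eqP e; rewrite e in Ssfin.
move: h1 h2; rewrite -(fineK Sbfin) -(fineK Ssfin) -(fineK EDfin) -EFinD -EFinM !lee_fin.
move=> h1 h2.
nra.
Qed.

(** Each round of the previous step multiplies the missing proportion [1 - al] by [1 - c / 2], so
    that it tends to [0]. *)
Lemma content_improve (lam : I) (A : set I) : s0 <= lam.1 -> T lam ->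
  (forall C, A C -> sub C lam) -> covers A (X `&` cube lam) ->
  ((u lam.1)%:E <= \esum_(C in A) (u C.1)%:E)%E.
Proof.
move=> s0l Tl Al cov; have [u0 _ _] := wu; have ul := u0 _ s0l.
have /andP[c0 c1] := c01.
have q01 : 0 <= 1 - c / 2 < 1 by apply/andP; split; lra.
have all_n n : forall (lam : I) (A : set I), s0 <= lam.1 -> T lam ->
    (forall C, A C -> sub C lam) -> covers A (X `&` cube lam) ->
    (((1 - (1 - c / 2) ^+ n) * u lam.1)%:E <= \esum_(C in A) (u C.1)%:E)%E.
  elim: n => [|n IHn].
    move=> mu B s0m _ Bm _; rewrite expr0 subrr mul0r.
    apply: esum_ge0 => C /Bm[sC _]; rewrite lee_fin ltW // u0 //.
    exact: le_trans sC.
  have := improve_step _ IHn.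
  have -> : 1 - (1 - c / 2) ^+ n + (1 - (1 - (1 - c / 2) ^+ n)) * (c / 2) =
      1 - (1 - c / 2) ^+ n.+1 by rewrite exprS; ring.
  apply; case/andP: q01 => q0 q1.
  by rewrite subr_ge0 exprn_ile1 ?(ltW q1) //= gerBl exprn_ge0.
rewrite leNgt; apply/negP => Slt.
set S := (\esum_(C in A) _)%E in Slt.
have S0 : (0 <= S)%E.
  by have := all_n 0%N lam A s0l Tl Al cov; rewrite expr0 subrr mul0r.
have Sfin : S \is a fin_num by rewrite ge0_fin_numE // (lt_trans Slt) ?ltry.
have e0 : 0 < (u lam.1 - fine S) / u lam.1.
  by rewrite divr_gt0 // subr_gt0 -lte_fin fineK.
have [n nP] := expr_small q01 e0.
have := all_n n lam A s0l Tl Al cov; rewrite -/S -(fineK Sfin) lee_fin.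
move: nP; rewrite ltr_pdivlMr //; set q := _ ^+ n; rewrite mulrBl mul1r.
by rewrite ltrBrDr lerBlDl => h1 h2; have := le_lt_trans h2 h1; rewrite ltxx.
Qed.

End SelfImprovement.
End Contents.

(** * Maximal cubes and the content of countable intersections *)

Section Maximal.
Context {R : realType} {d : nat}.
Local Notation I := (@cidx d).
Local Notation sub := (@sub R d).
Local Notation cube := (@cube R d).

Definition maxcubes (W : set I) : set I :=
  [set C | W C /\ forall C', W C' -> sub C C' -> C' = C].

Lemma maxcubes_ex (W : set I) (s : int) C : (forall C, W C -> s <= C.1) -> W C ->
  exists2 M, maxcubes W M & sub C M.
Proof.
move=> sW WC.
pose p n := `[< exists M, [/\ W M, sub C M & M.1 = s + n%:Z] >].
have exp : exists n, p n.
  exists `|C.1 - s|%N; apply/asboolP; exists C; split=> //; first exact: sub_refl.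
  by have := sW _ WC; lia.
case: (ex_minnP exp) => n /asboolP[M [WM CM Mn]] nmin.
exists M => //; split=> // C' WC' MC'; apply/esym/(sub_gen_eq MC').
have : p `|C'.1 - s|%N.
  apply/asboolP; exists C'; split=> //; first exact: sub_trans MC'.
  by have := sW _ WC'; lia.
move=> /nmin; case: MC' => + _; have := sW _ WC'; lia.
Qed.

Lemma maxcubes_disj (W : set I) C1 C2 C : maxcubes W C1 -> maxcubes W C2 ->
  sub C C1 -> sub C C2 -> C1 = C2.
Proof.
move=> [W1 m1] [W2 m2] s1 s2.
have [s12|s21] := sub_total (s1.2 _ (cube_corner C)) (s2.2 _ (cube_corner C)).
  by rewrite (m1 C2).
by rewrite (m2 C1).
Qed.

(** The supremum of the lower corners, coordinate by coordinate, lies in the closed cube of index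
    [n.+1], hence in the cube of index [n]. *)
Lemma nested_point (f : nat -> I) : (forall n, inner (R := R) (f n.+1) (f n)) ->
  exists x, forall n, cube (f n) x.
Proof.
move=> inn.
have subn m n : (m <= n)%N -> sub (f n) (f m).
  elim: n => [|n IHn]; first by rewrite leqn0 => /eqP ->; exact: sub_refl.
  rewrite leq_eqVlt => /orP[/eqP ->|]; first exact: sub_refl.
  by rewrite ltnS => /IHn; apply: sub_trans; exact: inner_sub.
pose E i := range (fun n => (corner (f n) : 'rV[R]_d) ord0 i).
have bnd i m n : (corner (f m) : 'rV[R]_d) ord0 i <= (ucorner (f n) : 'rV[R]_d) ord0 i.
  have [mn|/ltnW nm] := leqP m n.
    have := (subn _ _ mn).2 _ (cube_corner _); rewrite cube_box => /(_ i) /andP[h _].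
    apply: (le_trans h); rewrite !mxE ler_pM2r ?pow2_gt0 // lerDl.
    exact: ler01.
  have := (subn _ _ nm).2 _ (cube_corner _); rewrite cube_box => /(_ i).
  by move=> /andP[_ /ltW].
have hsE i : has_sup (E i).
  split; first by exists ((corner (f 0%N) : 'rV[R]_d) ord0 i); exists 0%N.
  by exists ((ucorner (f 0%N) : 'rV[R]_d) ord0 i) => _ [m _ <-].
exists (\row_i sup (E i)) => n; apply: (inn n).2 => i.
have -> : (\row_i sup (E i)) ord0 i = sup (E i) by rewrite mxE.
apply/andP; split.
  by apply: (ub_le_sup (hsE i).2); exists n.+1.
by apply: (ge_sup (hsE i).1) => _ [m _ <-]; exact: bnd.
Qed.

(** Baire argument on a covering assumed too cheap. A cube is [bad] if it lies in no covering cube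
    and the covering cubes inside it cost less than its weight. If a bad [Q] had no bad cube inner
    to it within [G k], the maximal subcubes whose inside costs at least their weight would cover
    [G k] in [Q], against the bound for [G k]. Nested bad cubes then shrink to a point of every
    [G k] that no covering cube can contain. *)
Lemma gdelta_content (s0 : int) (u : int -> R) (G : nat -> set 'rV[R]_d)
    (T : set I) : @weight R d s0 u -> (forall k, open (G k)) ->
  (forall lam mu, T lam -> sub mu lam -> T mu) ->
  (forall k (lam : I) (A : set I), s0 <= lam.1 -> T lam ->
    (forall C, A C -> sub C lam) -> covers A (G k `&` cube lam) ->
    ((u lam.1)%:E <= \esum_(C in A) (u C.1)%:E)%E) ->
  forall (lam : I) (A : set I), s0 <= lam.1 -> T lam ->
    (forall C, A C -> sub C lam) -> covers A ((\bigcap_k G k) `&` cube lam) ->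
    ((u lam.1)%:E <= \esum_(C in A) (u C.1)%:E)%E.
Proof.
move=> [u0 _ _] oG Tsub full lam A s0l Tl Al cov.
pose F (Q : I) : set I := [set C | A C /\ sub C Q].
pose cost Q := (\esum_(C in F Q) (u C.1)%:E)%E.
have uA C : A C -> (0 <= (u C.1)%:E)%E.
  by move=> /Al[sC _]; rewrite lee_fin ltW // u0 // (le_trans s0l).
have costA C : A C -> ((u C.1)%:E <= cost C)%E.
  move=> AC; rewrite -[leLHS](@esum_set1 R I C (fun C : I => (u C.1)%:E)) ?uA //.
  apply: subset_le_esum => [_ -> | t [/uA]//].
  by split=> //; exact: sub_refl.
pose bad Q := [/\ sub Q lam, (cost Q < (u Q.1)%:E)%E & forall C, A C -> ~ sub Q C].
rewrite leNgt; apply/negP => cheap.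
have bad0 : bad lam.
  split; first exact: sub_refl.
    rewrite /cost (_ : F lam = A) //; apply/seteqP; split=> C; first by case.
    by move=> AC; split=> //; exact: Al.
  move=> C AC sC; have eC : C = lam by apply: (@sub_antisym R) => //; exact: Al.
  have : ((u lam.1)%:E <= \esum_(C in A) (u C.1)%:E)%E.
    rewrite -{1}eC; apply: (le_trans (costA _ AC)).
    by apply: subset_le_esum => [C' []|].
  by rewrite leNgt cheap.
have step k Q : bad Q -> exists Q', [/\ inner (R := R) Q' Q, cube Q' `<=` G k & bad Q'].
  move=> [sQ cQ nQ]; apply: contrapT => nex.
  have s0Q : s0 <= Q.1 by apply: le_trans sQ.1.
  pose W : set I := [set C | sub C Q /\ ((u C.1)%:E <= cost C)%E].
  have WQ C : W C -> Q.1 <= C.1 by move=> [[]].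
  have := full k Q (maxcubes W) s0Q (Tsub _ _ Tl sQ).
  have h1 C : maxcubes W C -> sub C Q by move=> [[]].
  have h2 : covers (maxcubes W) (G k `&` cube Q).
    move=> x [Gx Qx].
    suff [C WC Cx] : exists2 C, W C & cube C x.
      by have [M WM CM] := maxcubes_ex WQ WC; exists M => //; exact: CM.2.
    have [n nP] := inner_ex Qx; have [m mP] := open_cube (oG k) Gx.
    pose j := (maxn n m)%:Z.
    have iQ : inner (R := R) (cof j x) Q by apply: nP; rewrite /j; lia.
    have GQ : cube (cof j x) `<=` G k by apply: mP; rewrite /j; lia.
    have [c1|c1] := leP (u (cof j x).1)%:E (cost (cof j x)).
      by exists (cof j x); [split=> //; exact: inner_sub|exact: cube_cof].
    have [[C AC sC]|nC] := pselect (exists2 C, A C & sub (cof j x) C).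
      exists C; last by apply: sC.2; exact: cube_cof.
      split; last exact: costA.
      have Cx : cube C x by apply: sC.2; exact: cube_cof.
      by have [//|/(nQ _ AC)] := sub_total Cx Qx.
    exfalso; apply: nex; exists (cof j x); split=> //; split=> //.
      by apply: sub_trans sQ; exact: inner_sub.
    by move=> C AC sC; apply: nC; exists C.
  move=> /(_ h1 h2); rewrite leNgt => /negP; apply.
  apply: le_lt_trans cQ.
  apply: (@le_trans _ _ (\esum_(C in maxcubes W) cost C)%E).
    by apply: le_esum => C [[]].
  apply: esum_disjoint_le.
  - by move=> M /h1 sM C [AC sC]; split=> //; exact: sub_trans sM.
  - by move=> C1 C2 C m1 m2 [_ s1] [_ s2]; exact: (maxcubes_disj m1 m2 s1 s2).
  - by move=> C [/uA].
have /choice[g gP] (kQ : nat * I) : exists Q', bad kQ.2 ->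
    [/\ inner (R := R) Q' kQ.2, cube Q' `<=` G kQ.1 & bad Q'].
  have [/(step kQ.1)[Q' Q'P]|nb] := pselect (bad kQ.2); first by exists Q'.
  by exists kQ.2 => /nb.
pose f := fix f n := if n is m.+1 then g (m, f m) else lam.
have badf n : bad (f n) by elim: n => //= n /(gP (n, _))[].
have inf n : inner (R := R) (f n.+1) (f n) by have [] := gP (n, f n) (badf n).
have [x xP] := nested_point inf.
have Fx : (\bigcap_k G k) x.
  by move=> k _; have [_ + _] := gP (k, f k) (badf k); apply; exact: (xP k.+1).
have [C AC Cx] := cov x (conj Fx (xP 0%N)).
have genf n : lam.1 + n%:Z <= (f n).1.
  elim: n => [|n IHn]; first by rewrite addr0.
  by have [+ _] := inf n; lia.
(* Generations grow by at least one per step, so this bad cube is at least as fine as [C]; both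
   contain [x], hence it lies in [C]. *)
have [_ _ /(_ C AC)] := badf `|C.1 - lam.1|%N; apply.
by apply: cube_nest Cx => //; have := genf `|C.1 - lam.1|%N; lia.
Qed.

(** A covering of [X] in [V] becomes a covering of [V] at no extra cost: a maximal subcube of [V]
    that lies in no covering cube replaces the covering cubes inside it, which cost at least as much
    by hypothesis. *)
Lemma refine_cover (s1 : int) (phi : int -> \bar R) (X V : set 'rV[R]_d) (A : set I) :
  open V -> (forall j, (0 <= phi j)%E) ->
  (forall (lam : I) (B : set I), s1 <= lam.1 -> cube lam `<=` V ->
    (forall C, B C -> sub C lam) -> covers B (X `&` cube lam) ->
    (phi lam.1 <= \esum_(C in B) phi C.1)%E) ->
  covers A (X `&` V) ->
  exists A' : set I, [/\ covers A' V, forall C, A' C -> A C \/ s1 <= C.1 &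
    (\esum_(C in A') phi C.1 <= \esum_(C in A) phi C.1)%E].
Proof.
move=> oV phi0 full cov.
pose W : set I := [set C | s1 <= C.1 /\ cube C `<=` V].
pose M := maxcubes W.
have covM x : V x -> exists2 C, M C & cube C x.
  move=> Vx; have [n nP] := open_cube oV Vx.
  pose j := Order.max s1 n%:Z.
  have Wj : W (cof j x) by split; [rewrite /= le_max lexx|apply: nP; rewrite le_max lexx orbT].
  have [C MC sC] := @maxcubes_ex W s1 _ (fun C => @proj1 _ _) Wj.
  by exists C => //; apply: sC.2; exact: cube_cof.
pose A1 : set I := [set C | A C /\ exists2 m, M m & sub m C].
pose M1 : set I := [set m | M m /\ forall C, A C -> ~ sub m C].
exists (A1 `|` M1); split.
- move=> x /covM[m Mm mx].
  have [[C AC sC]|nC] := pselect (exists2 C, A C & sub m C).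
    by exists C; [left; split=> //; exists m|exact: sC.2].
  by exists m => //; right; split=> // C AC sC; apply: nC; exists C.
- by move=> C [[]|[[[]]]]; [left|right].
pose F (m : I) := [set C | A C /\ sub C m].
apply: (le_trans (le_esum_setU _ _)) => //.
have M1F : (\esum_(m in M1) phi m.1 <= \esum_(C in A `&` ~` A1) phi C.1)%E.
  apply: (@le_trans _ _ (\esum_(m in M1) \esum_(C in F m) phi C.1)%E).
    apply: le_esum => m [Mm nm]; have [[s1m mV] _] := Mm.
    apply: full => // [C []//|x [Xx mx]].
    have [C AC Cx] := cov x (conj Xx (mV _ mx)).
    exists C => //; split=> //.
    by have [//|/(nm _ AC)] := sub_total Cx mx.
  apply: esum_disjoint_le => //.
  - move=> m [Mm nm] C [AC sC]; split=> // -[_ [m' Mm' m'C]].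
    have mm' : m' = m.
      by apply: (maxcubes_disj Mm' Mm (sub_refl m')); exact: sub_trans sC.
    by apply: (nm C) => //; rewrite -mm'.
  - by move=> m m' C [Mm _] [Mm' _] [_ s1'] [_ s2]; exact: (maxcubes_disj Mm Mm' s1' s2).
rewrite [leRHS](esumID A1) // leeD //.
by apply: subset_le_esum => // C A1C; split=> //; case: A1C.
Qed.
End Maximal.

(** * Norms and diameters of cubes *)

Section Norms.
Context {R : realType} {d : nat}.
Local Notation I := (@cidx d).
Local Notation V := 'rV[R]_d.
Variable N : V -> R.
Hypothesis nN : is_norm N.
Hypothesis d0 : (0 < d)%N.

Lemma norm_Z (c : R) x : N (c *: x) = `|c| * N x.
Proof. by have [_ []] := nN. Qed.

Lemma norm_D x y : N (x + y) <= N x + N y.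
Proof. by have [_ []] := nN. Qed.

Lemma norm_zero : N 0 = 0.
Proof. by rewrite -(scale0r 0) norm_Z normr0 mul0r. Qed.

Lemma norm_N x : N (- x) = N x.
Proof. by rewrite -scaleN1r norm_Z normrN1 mul1r. Qed.

Lemma norm_dist x y : N (x - y) = N (y - x).
Proof. by rewrite -norm_N opprB. Qed.

Lemma norm_pos x : 0 <= N x.
Proof. by have := norm_D x (- x); rewrite subrr norm_zero norm_N; lra. Qed.

Lemma norm_sum (J : Type) (r : seq J) (F : J -> V) :
  N (\sum_(j <- r) F j) <= \sum_(j <- r) N (F j).
Proof.
elim/big_ind2 : _ => //; first by rewrite norm_zero.
by move=> x a y b xa yb; apply: (le_trans (norm_D _ _)); exact: lerD.
Qed.

Lemma norm_upper : exists2 C : R, 0 < C &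
  forall (x : V) e, 0 <= e -> (forall i, `|x ord0 i| <= e) -> N x <= C * e.
Proof.
exists (1 + \sum_(i < d) N (delta_mx ord0 i)).
  by rewrite ltr_wpDr // sumr_ge0 // => i _; exact: norm_pos.
move=> x e e0 xe; rewrite [in N _](row_sum_delta x).
apply: (le_trans (norm_sum _ _)); rewrite mulrDl mul1r ler_wpDl // mulr_suml.
by apply: ler_sum => i _; rewrite norm_Z mulrC ler_wpM2l ?norm_pos.
Qed.

Lemma norm_cont : continuous N.
Proof.
move=> x; have [C C0 CP] := norm_upper.
have Fx : Filter (nbhs x) by exact: nbhs_filter.
apply/cvgrPdist_lt => e e0; apply/(@nbhs_ballP R V); exists (e / (2 * C)).
  by rewrite /= divr_gt0 // mulr_gt0.
move=> y [_ xy] /=.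
have d1 : N x - N y <= N (x - y).
  by rewrite lerBlDr; apply: le_trans (norm_D _ _); rewrite subrK.
have d2 : N y - N x <= N (x - y).
  by rewrite norm_dist lerBlDr; apply: le_trans (norm_D _ _); rewrite subrK.
apply: (@le_lt_trans _ _ (N (x - y))); first by rewrite ler_norml; lra.
apply: (@le_lt_trans _ _ (C * (e / (2 * C)))); last first.
  by rewrite mulrC -mulrA invfM mulfVK ?gt_eqF //; lra.
apply: CP; first by rewrite divr_ge0 ?ltW // mulr_gt0.
by move=> i; rewrite !mxE; apply: ltW; exact: xy.
Qed.

Lemma coord_le_norm (x : V) i : `|x ord0 i| <= `|x|.
Proof.
rewrite -[X in _ <= X]/(mx_norm _) mx_normrE.
exact: (le_bigmax _ (fun ij : 'I_1 * 'I_d => `|x ij.1 ij.2|) (ord0, i)).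
Qed.

(** [N] has a positive minimum on the compact unit sphere of the maximum norm, which is nonempty
    because [d] is positive. *)
Lemma norm_lower : exists2 C : R, 0 < C & forall (x : V) i, `|x ord0 i| <= C * N x.
Proof.
pose S := [set x : V | `|x| = 1].
have cS : compact S.
  apply: bounded_closed_compact.
    by exists 1; split=> // M M1 x /= ->; exact: ltW.
  rewrite (_ : S = (fun x : V => `|x|) @^-1` [set 1]) //.
  by apply: closed_comp => [x _|]; [exact: norm_continuous|exact: closed_eq].
have S0 : S !=set0.
  exists (delta_mx ord0 (Ordinal d0)); rewrite /S /=; apply/eqP.
  rewrite eq_le; apply/andP; split.
    rewrite -[X in X <= _]/(mx_norm _) mx_normrE; apply/bigmax_leP; split=> //= -[i j] _.
    by rewrite mxE; case: (_ && _); rewrite ?normr1 ?normr0 ?ler01 ?lexx.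
  by apply: le_trans (coord_le_norm _ (Ordinal d0)); rewrite mxE !eqxx normr1.
have [c Sc cP] := @EVT_min_rV R d N S S0 cS (continuous_subspaceT norm_cont).
have Nc0 : 0 < N c.
  rewrite lt_def norm_pos andbT; apply/eqP => Nc.
  have [/(_ _ Nc) c0 _] := nN; move: Sc; rewrite inE /S /= c0 normr0.
  by move/eqP; rewrite eq_sym oner_eq0.
exists (N c)^-1; first by rewrite invr_gt0.
move=> x i; have [->|x0] := eqVneq x 0.
  by rewrite mxE normr0 norm_zero mulr0.
apply: (le_trans (coord_le_norm _ _)).
have nx0 : 0 < `|x| by rewrite normr_gt0.
have /cP : `|x|^-1 *: x \in S.
  by rewrite inE /S /= normrZ normfV normr_id mulVf ?gt_eqF.
rewrite norm_Z normfV normr_id mulrC ler_pdivlMr // => h.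
by rewrite mulrC ler_pdivlMr // mulrC.
Qed.

(** Every cube is a translated and scaled copy of [[0,1)^d], and [D] is the diameter of the
    latter. *)
Lemma diam_cube : exists2 D : R, 0 < D &
  forall c : I, diamN N (cube c) = (2 ^ (- c.1) * D)%:E.
Proof.
pose c0 : I := (0, [ffun=> 0]).
have c0P (x : V) : cube c0 x <-> forall i, 0 <= x ord0 i < 1.
  by split=> h i; have := h i; rewrite /= ffunE expr0z mul1r add0r.
pose E : set R := [set z | exists x y : V, cube c0 x /\ cube c0 y /\ z = N (x - y)].
have [C C0 CP] := norm_upper.
have Eub : has_ubound E.
  exists (C * 1) => _ [x [y [/c0P cx [/c0P cy ->]]]]; apply: CP => // i.
  by rewrite !mxE ler_norml; have := cx i; have := cy i; lra.
(* Half a basis vector, since the value [1] is excluded from the half-open side; it shows that [D]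
   is positive. *)
pose i0 := Ordinal d0; pose z0 : V := (1 / 2) *: delta_mx ord0 i0.
have Ez : E (N z0).
  exists z0, 0; rewrite subr0; split; last split=> //; apply/c0P => i; rewrite !mxE.
    by case: eqP => _; case: eqP => _ /=; lra.
  by rewrite lexx ltr01.
have Nz0 : 0 < N z0.
  rewrite lt_def norm_pos andbT; apply/eqP => Nz.
  have [/(_ _ Nz) z00 _] := nN.
  have := congr1 (fun x : V => x ord0 i0) z00; rewrite !mxE !eqxx /=; lra.
have D0 : 0 < sup E by apply: (lt_le_trans Nz0); exact: ub_le_sup Ez.
exists (sup E) => // c; set j := c.1.
have p0 := @pow2_gt0 R j.
have cne : cube c != set0 :> set V.
  by apply/set0P; exists (corner c); exact: cube_corner.
rewrite /diamN (negbTE cne); set B := ereal_sup _.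
have kE i : 2 ^ j * ((c.2 i)%:~R * 2 ^ (- j)) = (c.2 i)%:~R :> R.
  by rewrite mulrCA -pow2D subrr expr0z mulr1.
have shift (x : V) i : cube c x -> 0 <= (2 ^ j *: (x - corner c)) ord0 i < 1.
  move=> cx; rewrite !mxE mulrBr kE; have := cx i; rewrite -/j.
  by move: (2 ^ j * _) (_%:~R) => a b; lra.
have Ble : (B <= (2 ^ (- j) * sup E)%:E)%E.
  apply: ge_ereal_sup => _ [x [y [cx [cy ->]]]]; rewrite lee_fin.
  have -> : x - y = 2 ^ (- j) *: (2 ^ j *: (x - corner c) - 2 ^ j *: (y - corner c)).
    by rewrite -scalerBr scalerA pow2V scale1r opprB addrA subrK.
  rewrite norm_Z gtr0_norm ?pow2_gt0 // ler_pM2l ?pow2_gt0 //.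
  apply: (ub_le_sup Eub); eexists; eexists; split; last split; last by [].
    by apply/c0P => i; exact: shift.
  by apply/c0P => i; exact: shift.
have geB (x y : V) : cube c x -> cube c y -> ((N (x - y))%:E <= B)%E.
  by move=> cx cy; apply: ereal_sup_ubound; exists x, y.
have B0 : (0 <= B)%E.
  by have := geB _ _ (cube_corner c) (cube_corner c); rewrite subrr norm_zero.
have Bfin : B \is a fin_num by rewrite ge0_fin_numE // (le_lt_trans Ble) ?ltry.
apply/eqP; rewrite eq_le Ble /= -(fineK Bfin) lee_fin.
rewrite -ler_pdivlMl ?pow2_gt0 // -invr_expz invrK.
apply: ge_sup; first by exists (N z0).
move=> _ [x [y [/c0P cx [/c0P cy ->]]]].
have cj (x' : V) : (forall i, 0 <= x' ord0 i < 1) ->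
    cube c (corner c + 2 ^ (- j) *: x').
  move=> x'01 i; rewrite !mxE -/j mulrDr kE mulrA -pow2D subrr expr0z mul1r.
  by have := x'01 i; move: (_%:~R) => a; lra.
have := geB _ _ (cj x cx) (cj y cy); rewrite -(fineK Bfin) lee_fin.
rewrite opprD addrACA subrr add0r -scalerBr norm_Z gtr0_norm ?pow2_gt0 //.
by rewrite -invr_expz ler_pdivrMl.
Qed.
End Norms.

(** * Poisson counts *)

Section ExpTail.
Context {R : realType}.

(** Termwise comparison: [l ^ k <= 2 ^ (-M) * (2 l) ^ k] for [k >= M], so the tail is bounded
    through the exponential series at [2 l]. *)
Lemma expR_tail (l : R) (M : nat) : 0 <= l ->
  (expR l - \sum_(k < M) l ^+ k / k`!%:R <= 2^-1 ^+ M * expR (2 * l)).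
Proof.
move=> l0.
have c1 : series (exp_coeff l) @ \oo --> expR l by exact: is_cvg_series_exp_coeff.
have c2 : series (exp_coeff (2 * l)) @ \oo --> expR (2 * l)
  by exact: is_cvg_series_exp_coeff.
rewrite lerBlDr.
have c3 : ((fun n => 2^-1 ^+ M * series (exp_coeff (2 * l)) n +
    \sum_(k < M) l ^+ k / k`!%:R) @ \oo -->
    2^-1 ^+ M * expR (2 * l) + \sum_(k < M) l ^+ k / k`!%:R)%R.
  by apply: cvgD; [apply: cvgMr|exact: cvg_cst].
apply: (ler_cvg_to c1 c3); exists M => // n /= Mn.
rewrite /series /= -(big_mkord xpredT (fun k => l ^+ k / k`!%:R)%R).
rewrite [leLHS](@big_cat_nat _ _ _ M) //= addrC lerD2r.
apply: (@le_trans _ _ (2^-1 ^+ M * \sum_(M <= k < n) exp_coeff (2 * l) k))%R.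
  rewrite mulr_sumr; apply: ler_sum_nat => k /andP[Mk _].
  rewrite /exp_coeff /= exprMn !mulrA.
  rewrite ler_wpM2r // ?invr_ge0 // ler_peMl ?exprn_ge0 //.
  rewrite exprVn mulrC ler_pdivlMr ?exprn_gt0 // mul1r.
  by rewrite ler_weXn2l // ler1n.
rewrite ler_pM2l ?exprn_gt0 // [leRHS](@big_cat_nat _ _ _ M) //= lerDr.
by apply: sumr_ge0 => k _; apply: exp_coeff_ge0; rewrite mulr_ge0.
Qed.

End ExpTail.

Section Probability.
Context {R : realType}.
Local Open Scope ereal_scope.

Lemma borel_cantelli_ae (dO : measure_display) (Omega : measurableType dO)
    (P : probability Omega R) (B : nat -> set Omega) (C : R) (J0 : nat) :
  (forall j, measurable (B j)) ->
  (forall j, (J0 <= j)%N -> P (B j) <= (C * 2^-1 ^+ j)%:E) ->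
  {ae P, forall w, exists J, forall j, (J <= j)%N -> ~ B j w}.
Proof.
move=> mB PB.
(* The bound holds only from [J0] on; emptying the earlier events does not change which points lie
   in infinitely many of them. *)
pose F j := if (J0 <= j)%N then B j else set0.
have mF j : measurable (F j) by rewrite /F; case: ifP.
have C0 : (0 <= C)%R.
  have := PB J0 (leqnn _); move/(le_trans (measure_ge0 _ _)); rewrite lee_fin.
  by rewrite pmulr_lge0 // exprn_gt0.
have sF : \sum_(0 <= n <oo) P (F n) < +oo.
  apply: (@le_lt_trans _ _ (\sum_(0 <= n <oo) (C * 2^-1 ^+ n)%:E)).
    apply: lee_nneseries => [n _ _|n _]; first exact: measure_ge0.
    rewrite /F; case: ifP => [/PB//|_]; rewrite measure0 lee_fin.
    by rewrite mulr_ge0.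
  have cg : (series (geometric C 2^-1)) @ \oo --> (C / (1 - 2^-1))%R.
    by apply: cvg_geometric_series; rewrite ger0_norm // invf_lt1 // ltr1n.
  have -> : (fun n => \sum_(0 <= k < n) (C * 2^-1 ^+ k)%:E) =
      EFin \o series (geometric C 2^-1).
    by apply/funext => n; rewrite /= sumEFin.
  rewrite (cvg_lim _ (cvg_EFin _ cg)) //=; first by rewrite ltry.
  by apply: nearW.
have := lim_sup_set_cvg0 mF sF; move=> z.
exists (lim_sup_set F); split => //.
  by apply: bigcap_measurable => [|n _]; [by exists 0%N|apply: bigcup_measurable].
move=> w /= nw n _; apply: contrapT => nex; apply: nw.
exists (maxn n J0) => j nj Bj; apply: nex; exists j => /=.
  by rewrite (leq_trans _ nj) // leq_maxl.
by rewrite /F (leq_trans (leq_maxr _ _) nj).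
Qed.

End Probability.

(** * Measurable sets of the product space and their intensity *)

Section ProductSpace.
Context {R : realType} {d : nat}.
Local Notation V := 'rV[R]_d.
Local Notation I := (@cidx d).

Lemma open_measurable_BSp (A : set (Sp R d)) : open A -> measurable (A : set (BSp R d)).
Proof. by move=> oA; apply: sub_sigma_algebra. Qed.

Lemma measurable_fst_gt (a : R) : measurable ([set z | a < z.1] : set (BSp R d)).
Proof.
apply: open_measurable_BSp.
rewrite (_ : [set z | _] = (fun z : Sp R d => z.1) @^-1` [set x | a < x]) //.
by apply: open_comp => [z _|]; [exact: cvg_fst|exact: open_gt].
Qed.

Lemma measurable_snd_open (X : set V) : open X ->
  measurable ([set z | X z.2] : set (BSp R d)).
Proof.
move=> oX; apply: open_measurable_BSp.
rewrite (_ : [set z | _] = (fun z : Sp R d => z.2) @^-1` X) //.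
by apply: open_comp => // z _; exact: cvg_snd.
Qed.

Lemma open_coord_lt (a : R) i : open [set x : V | x ord0 i < a].
Proof.
rewrite (_ : [set x | _] = (fun x : V => x ord0 i) @^-1` [set y | y < a]) //.
by apply: open_comp => [x _|]; [exact: coord_continuous|exact: open_lt].
Qed.

Lemma measurable_coord_lt (a : R) i :
  measurable ([set z | (z.2 : V) ord0 i < a] : set (BSp R d)).
Proof. by have h := measurable_snd_open (@open_coord_lt a i); exact: h. Qed.

Lemma measurable_snd_box (a b : V) : measurable ([set z | box a b z.2] : set (BSp R d)).
Proof.
rewrite (_ : [set z | _] = \bigcap_(i in [set: 'I_d])
    ([set z : BSp R d | z.2 ord0 i < b ord0 i] `\` [set z : BSp R d | z.2 ord0 i < a ord0 i])).
  apply: fin_bigcap_measurable => [|i _]; first exact: finite_finset.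
  by apply: measurableD; exact: measurable_coord_lt.
apply/seteqP; split=> z h i.
  by move=> _; have /andP[ai ib] := h i; split=> //=; apply/negP; rewrite -leNgt.
by have [//= ib /negP] := h i Logic.I; rewrite -leNgt => ->.
Qed.

Definition cyl (a b : R) (X : set V) : set (BSp R d) :=
  [set z | a < z.1 <= b /\ X z.2].

Lemma measurable_cyl a b X : measurable ([set z | X z.2] : set (BSp R d)) ->
  measurable (cyl a b X).
Proof.
move=> mX; rewrite (_ : cyl a b X = ([set z : BSp R d | a < z.1] `\`
   [set z : BSp R d | b < z.1]) `&` [set z : BSp R d | X z.2]).
  by apply: measurableI => //; apply: measurableD; exact: measurable_fst_gt.
apply/seteqP; split=> z /=.
  by move=> [/andP[az zb] Xz]; split=> //; split=> //; apply/negP; rewrite -leNgt.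
by move=> [[az /negP]]; rewrite -leNgt => zb Xz; split=> //; apply/andP.
Qed.

Lemma measurable_Sset (U : set V) : open U -> measurable (Sset U).
Proof. by move=> oU; apply: (@measurable_cyl 0 1); exact: measurable_snd_open. Qed.

Lemma measurable_cyl_cube a b (c : I) : measurable (cyl a b (cube c)).
Proof. by apply: measurable_cyl; rewrite cube_box; exact: measurable_snd_box. Qed.

Section Intensity.
Variables (nu : {measure set R -> \bar R}) (U : set V).
Local Open Scope ereal_scope.

Lemma intensity_ge0 (E : set (BSp R d)) : 0 <= intensity nu U E.
Proof.
apply: le_ereal_inf_tmp => _ [J [a [b [mJ [_ ->]]]]].
by apply: nneseries_ge0 => n _ _; rewrite mule_ge0 // lee_fin boxvol_ge0.
Qed.

Lemma intensity_le (s t : R) (a b : V) :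
  intensity nu U (cyl s t (box a b)) <= nu `]s, t]%classic * (boxvol a b)%:E.
Proof.
pose J n : set R := if n is 0%N then `]s, t]%classic else set0.
apply: ge_ereal_inf; exists (nu `]s, t]%classic * (boxvol a b)%:E) => //.
exists J, (fun=> a), (fun=> b); split; first by case=> /=.
split; first by move=> z [[z1 z2] _]; exists 0%N => //; split=> //=; rewrite in_itv.
rewrite nneseries_recl //; last first.
  by move=> n _; rewrite mule_ge0 // lee_fin boxvol_ge0.
rewrite eseries0 ?adde0 // => n n1 _; rewrite /J; case: n n1 => // n _.
by rewrite measure0 mul0e.
Qed.

(** Given a covering by rectangles and a radius [r] in the interval, the rectangles whose radial
    side contains [r] have boxes covering [box a b]. The inequality between volumes is then
    integrated against [nu]. *)
Lemma intensity_ge (s t : R) (a b : V) : (0 <= s)%R -> (t <= 1)%R -> box a b `<=` U ->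
  nu `]s, t]%classic * (boxvol a b)%:E <= intensity nu U (cyl s t (box a b)).
Proof.
move=> s0 t1 abU; apply: le_ereal_inf_tmp => _ [J [A [B [mJ [cov ->]]]]].
rewrite muleC (eq_eseriesr (g := fun n => (boxvol (A n) (B n))%:E * nu (J n))); last first.
  by move=> n _; rewrite muleC.
apply: measure_le_slices => //; first exact: boxvol_ge0.
  by move=> m; exact: boxvol_ge0.
move=> r /=; rewrite in_itv /= => /andP[sr rt].
apply: le_trans (boxvol_cover (P := [set m | J m r]) (A := A) (B := B) _) _.
  move=> x abx; have [|m _ [Jm xm]] := cov (r, x).
    split; first by split=> //; apply/andP.
    split=> /=; last exact: abU.
    by apply/andP; split; [exact: le_lt_trans sr|exact: le_trans t1].
  by exists m.
apply: lee_nneseries => m _; first by rewrite lee_fin mulr_ge0 // boxvol_ge0.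
by rewrite -EFinM lee_fin; apply: ler_wpM2l; rewrite ?boxvol_ge0 // !indicE; 
  rewrite (_ : (m \in _) = (r \in J m)) //; apply/idP/idP; rewrite !inE.
Qed.

End Intensity.
End ProductSpace.

Section PoissonTail.
Context {R : realType} {d : nat}.
Variables (dO : measure_display) (Omega : measurableType dO) (P : probability Omega R).
Variables (S : set (BSp R d)) (pi : set (BSp R d) -> \bar R).
Variable Pi : Omega -> {measure set (BSp R d) -> \bar R}.
Hypothesis poi : poisson_point_measure P S pi Pi.

Lemma poisson_ge_measurable (E : set (BSp R d)) (M : nat) : measurable E ->
  measurable [set w | ((M%:R)%:E <= Pi w E)%E].
Proof.
move=> mE; have [_ [_ [mPi _]]] := poi.
rewrite -[X in measurable X]setTI; apply: emeasurable_fun_c_infty.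
  exact: measurableT.
exact: mPi.
Qed.

(** The event avoids the atoms below [M], whose total probability is a partial sum of the
    exponential series; the factor [expR l] comes from [expR (- l) * expR (2 * l)]. *)
Lemma poisson_tail (E : set (BSp R d)) (l : R) (M : nat) : measurable E ->
  pi E = l%:E -> 0 <= l ->
  (P [set w | ((M%:R)%:E <= Pi w E)%E] <= (expR l * 2^-1 ^+ M)%:E)%E.
Proof.
move=> mE piE l0; have [vPi [_ [mPi [pP _]]]] := poi.
pose Ev k := [set w | Pi w E = (k%:R)%:E].
have mEv k : measurable (Ev k).
  rewrite -[X in measurable X]setTI.
  exact: (mPi E mE measurableT [set (k%:R)%:E] (emeasurable_set1 _)).
have PEv k : P (Ev k) = (expR (- l) * l ^+ k / k`!%:R)%:E by exact: (pP E mE).2.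
have UE : [set w | ((M%:R)%:E <= Pi w E)%E] `<=` ~` (\big[setU/set0]_(k < M) Ev k).
  move=> w /= Mw; rewrite -bigcup_mkord => -[k /= kM Evk].
  by move: Mw; rewrite Evk lee_fin ler_nat leqNgt kM.
apply: (@le_trans _ _ (P (~` (\big[setU/set0]_(k < M) Ev k)))).
  apply: le_measure => //; rewrite inE; first exact: poisson_ge_measurable.
  by apply: measurableC; apply: bigsetU_measurable => k _; exact: mEv.
rewrite probability_setC; last by apply: bigsetU_measurable => k _; exact: mEv.
rewrite (measure_bigsetU P (F := Ev)) //; last first.
  move=> i j _ _ [w [e1 e2]]; have := etrans (esym e1) e2 => -[] /eqP.
  by rewrite eqr_nat => /eqP.
rewrite (eq_bigr (fun k : 'I_M => (expR (- l) * l ^+ k / k`!%:R)%:E)) => [|k _]; last first.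
  exact: PEv.
rewrite sumEFin -EFinB lee_fin.
have := expR_tail M l0; rewrite -(ler_pM2l (expR_gt0 (- l))) mulrBr.
rewrite -expRD addNr expR0 mulr_sumr.
rewrite (eq_bigr (fun k : 'I_M => expR (- l) * l ^+ k / k`!%:R)); last first.
  by move=> k _; rewrite mulrA.
move=> /le_trans; apply; rewrite mulrCA -expRD mulrC le_eqVlt; apply/orP; left.
by apply/eqP; congr (expR _ * _); ring.
Qed.

End PoissonTail.

(** * Levels *)

Section Kids.
Context {R : realType} {d : nat}.
Local Notation I := (@cidx d).
Local Notation sub := (@sub R d).
Local Notation cube := (@cube R d).

Definition kid (c : I) (n : nat) (l : {ffun 'I_d -> 'I_(2 ^ n)}) : I :=
  (c.1 + n%:Z, [ffun i => c.2 i * (2 ^ n)%N%:Z + (l i)%:Z]).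

Lemma kid_inj c n : injective (@kid c n).
Proof.
move=> l l' [] /ffunP h; apply/ffunP => i; have := h i; rewrite !ffunE => /addrI [].
exact: val_inj.
Qed.

Lemma card_kid n : #|{: {ffun 'I_d -> 'I_(2 ^ n)}}| = (2 ^ (n * d))%N.
Proof. by rewrite card_ffun !card_ord expnM. Qed.

Lemma kidP (c c' : I) n : c'.1 = c.1 + n%:Z -> sub c' c -> exists l, c' = @kid c n l.
Proof.
move=> e s.
have cx := cube_corner c' : cube c' (corner c').
have px := s.2 _ cx; set x := corner c' in cx px.
have bnd i : c.2 i * (2 ^ n)%N%:Z <= c'.2 i < (c.2 i + 1) * (2 ^ n)%N%:Z.
  have := px i; have := cx i; rewrite e pow2D pow2_int.
  set X := 2 ^ c.1 * x ord0 i; have -> : 2 ^ c.1 * ((2 ^ n)%N%:Z)%:~R * x ord0 i =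
    ((2 ^ n)%N%:Z)%:~R * X by rewrite /X; ring.
  have n0 : 0 < ((2 ^ n)%N%:Z)%:~R :> R by rewrite ltr0z ltz_nat expn_gt0.
  rewrite -[(c'.2 i)%:~R + 1](intrD _ (c'.2 i) 1) -[(c.2 i)%:~R + 1](intrD _ (c.2 i) 1).
  move=> /andP[a b] /andP[]; rewrite -(ler_pM2l n0) -(ltr_pM2l n0) -!intrM => f h.
  have := le_lt_trans f b; have := le_lt_trans a h; rewrite !ltr_int.
  by move=> h1 h2; apply/andP; split; lia.
have lt i : (absz (c'.2 i - c.2 i * (2 ^ n)%N%:Z)%R < 2 ^ n)%N.
  by have := bnd i; lia.
exists [ffun i => Ordinal (lt i)].
apply: (eq_trans (surjective_pairing c')); rewrite /kid {1}e; congr (_, _).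
apply/ffunP => i; rewrite !ffunE /=; have /andP[b1 _] := bnd i.
by rewrite gez0_abs ?subr_ge0 // addrC subrK.
Qed.

Lemma kid_sub (c : I) n l : sub (@kid c n l) c.
Proof.
apply: (@cube_nest _ _ _ _ (corner (kid c l))); first by rewrite /= lerDl.
  exact: cube_corner.
move=> i; rewrite !mxE /= ffunE.
have -> : 2 ^ c.1 * ((c.2 i * (2 ^ n)%N%:Z + (l i)%:Z)%:~R * 2 ^ (- (c.1 + n%:Z))) =
    (c.2 i)%:~R + ((l i)%:Z)%:~R * 2 ^ (- n%:Z) :> R.
  have e1 := pow2V (R := R) n%:Z; have e2 := pow2V (R := R) c.1.
  rewrite intrD intrM -pow2_int opprD pow2D.
  transitivity ((2 ^ (- c.1) * 2 ^ c.1) * ((2 ^ (- n%:Z) * 2 ^ n%:Z) * (c.2 i)%:~R +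
    ((l i)%:Z)%:~R * 2 ^ (- n%:Z)) : R); first by ring.
  by rewrite e1 e2 !mul1r.
apply/andP; split.
  by rewrite lerDl; apply: mulr_ge0; [rewrite ler0z|exact: ltW (pow2_gt0 _)].
rewrite ltrD2l.
rewrite -invr_expz ltr_pdivrMr ?pow2_gt0 // mul1r pow2_int ltr_int.
by rewrite ltz_nat ltn_ord.
Qed.
End Kids.

Section Mass.
Context {R : realType}.
Variables (d : nat) (D : R) (nu : {measure set R -> \bar R}).
Hypotheses (d0 : (0 < d)%N) (D0 : 0 < D) (hnu : classR nu).

Definition delta (j : int) : R := 2 ^ (- j) * D.

Definition mass (s : nat) : R := fine (nu `]delta s, 1]%classic).

Lemma delta_gt0 j : 0 < delta j.
Proof. by rewrite mulr_gt0 ?pow2_gt0. Qed.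

Lemma ler_delta i j : (delta i <= delta j) = (j <= i).
Proof. by rewrite ler_pM2r // ler_pow2 lerN2. Qed.

Lemma delta_small (e : R) : 0 < e -> exists n : nat, forall j : int, n%:Z <= j -> delta j < e.
Proof.
move=> e0; have [|n nP] := @pow2_small R (e / D); first by rewrite divr_gt0.
by exists n => j /nP; rewrite ltr_pdivlMr.
Qed.

Lemma deltaS j : delta j = 2 * delta (j + 1).
Proof. by rewrite /delta opprD pow2D mulrA mulrCA (_ : 2 * _ = 1) ?mulr1 // exprN1 divff. Qed.

Lemma massE (s : nat) : nu `]delta s, 1]%classic = (mass s)%:E.
Proof.
rewrite fineK // ge0_fin_numE ?measure_ge0 //.
have [d1|d1] := leP (delta s) 1; last first.
  by rewrite set_itv_ge ?measure0 ?ltry //= bnd_simp -leNgt ltW.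
have [_ [_ /(_ (delta s))]] := hnu; rewrite delta_gt0 d1 => /(_ isT).
apply: le_lt_trans; apply: le_measure; rewrite ?inE //.
by move=> x /=; rewrite !in_itv /= => /andP[/ltW -> ->].
Qed.

Lemma mass_ge0 s : 0 <= mass s.
Proof. by rewrite -lee_fin -massE. Qed.

Lemma mass_homo s t : (s <= t)%N -> mass s <= mass t.
Proof.
move=> st; rewrite -lee_fin -!massE; apply: le_measure; rewrite ?inE //.
move=> x /=; rewrite !in_itv /= => /andP[a ->]; rewrite andbT.
by apply: le_lt_trans a; rewrite ler_delta lez_nat.
Qed.

Lemma mass_unbounded (M : R) : exists s, M <= mass s.
Proof.
have [_ [nuoo _]] := hnu.
pose F s : set R := `]delta s%:Z, 1]%classic.
have UF : \bigcup_s F s = `]0, 1]%classic.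
  apply/seteqP; split=> x /=.
    move=> [s _]; rewrite /F /= !in_itv /= => /andP[a ->]; rewrite andbT.
    exact: lt_trans (delta_gt0 _) a.
  rewrite in_itv /= => /andP[x0 x1]; have [n nP] := delta_small x0.
  by exists n => //; rewrite /F /= in_itv /= x1 nP.
have cv : (nu \o F) n @[n --> \oo] --> nu (\bigcup_s F s).
  apply: nondecreasing_cvg_mu; first by move=> s; exact: measurable_itv.
    by apply: bigcup_measurable => s _; exact: measurable_itv.
  move=> s t st; apply/subsetPset => x; rewrite /F /= !in_itv /= => /andP[a ->].
  by rewrite andbT (le_lt_trans _ a) // ler_delta lez_nat.
rewrite UF nuoo in cv; have [n _ /(_ n (leqnn n))] := (cvgeyPge _).1 cv M.
by rewrite /= /F massE lee_fin => h; exists n.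
Qed.

Lemma lev_ex (j : nat) : exists s, 4 * 2 ^+ (j * d) <= mass s /\
  forall t, (t < s)%N -> mass t < 4 * 2 ^+ (j * d).
Proof.
pose p s := 4 * 2 ^+ (j * d) <= mass s.
have exp : exists s, p s by exact: mass_unbounded.
case: (ex_minnP exp) => s ps smin; exists s; split=> // t ts.
by rewrite ltNge; apply/negP => /smin; rewrite leqNgt ts.
Qed.

(** The factor [4] in the threshold makes the expected number of points with radius above
    [delta (lev j)] at least [4] in each cube of generation [j] inside [U]. *)
Definition lev (j : nat) : nat := projT1 (cid (lev_ex j)).

Lemma lev_ge j : 4 * 2 ^+ (j * d) <= mass (lev j).
Proof. by rewrite /lev; case: cid => s []. Qed.

Lemma lev_lt j t : (t < lev j)%N -> mass t < 4 * 2 ^+ (j * d).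
Proof. by rewrite /lev; case: cid => s [_] h /h. Qed.

Lemma lev_homo i j : (i <= j)%N -> (lev i <= lev j)%N.
Proof.
move=> ij; rewrite leqNgt; apply/negP => /lev_lt; rewrite ltNge => /negP; apply.
apply: le_trans (lev_ge j); rewrite ler_pM2l // ler_weXn2l ?ler1n //.
by rewrite leq_mul2r ij orbT.
Qed.

Lemma lev_unbounded s : exists J, forall j, (J <= j)%N -> (s < lev j)%N.
Proof.
exists (Num.bound (mass s)) => j Jj; rewrite ltnNge; apply/negP => /mass_homo.
apply/negP; rewrite -ltNge; apply: lt_le_trans (lev_ge j).
apply: (lt_le_trans (archi_boundP (mass_ge0 s))).
have le1 : (Num.bound (mass s))%:R <= 2 ^+ (j * d) :> R.
  have -> : (2 : R) ^+ (j * d) = (2 ^ (j * d))%N%:R by exact/esym/natrX.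
  rewrite ler_nat; apply: leq_trans Jj _; apply: leq_trans (leq_pmulr j d0) _.
  exact/ltnW/ltn_expl.
by apply: (le_trans le1); rewrite ler_peMl ?exprn_ge0 // ler1n.
Qed.
End Mass.

(** * Almost sure events *)

Section Events.
Context {R : realType} {d : nat}.
Local Notation I := (@cidx d).
Local Notation V := 'rV[R]_d.
Variables (dO : measure_display) (Omega : measurableType dO) (P : probability Omega R).
Variables (nu : {measure set R -> \bar R}) (U : set V).
Variable Pi : Omega -> {measure set (BSp R d) -> \bar R}.
Variable D : R.
Hypotheses (d0 : (0 < d)%N) (D0 : 0 < D) (hnu : classR nu).
Hypothesis poi : poisson_point_measure P (Sset U) (intensity nu U) Pi.
Local Notation mass := (mass D nu).
Local Notation lev := (lev d D0 hnu).
Local Notation delta := (delta D).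

Definition slab (s : nat) (X : set V) : set (BSp R d) := cyl (delta s) 1 X.

Definition cbox (M : nat) : set V := box (const_mx (- M%:R)) (const_mx M%:R).

Lemma measurable_slab_box s (a b : V) : measurable (slab s (box a b)).
Proof. by apply: measurable_cyl; exact: measurable_snd_box. Qed.

Lemma measurable_slab_cube s (c : I) : measurable (slab s (cube c)).
Proof. by rewrite cube_box; exact: measurable_slab_box. Qed.

Lemma slab_mono s t (X : set V) : (s <= t)%N -> slab s X `<=` slab t X.
Proof.
move=> st z [/andP[a b] Xz]; split=> //; rewrite b andbT.
by apply: le_lt_trans a; rewrite ler_delta // lez_nat.
Qed.

Lemma pow2_unbounded (x : R) : exists n : nat, x <= 2 ^+ n.
Proof.
have [|n nP] := @pow2_small R (Num.max 1 x)^-1; first by rewrite invr_gt0 lt_max ltr01.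
exists n; have := nP n%:Z (lexx _); rewrite -invr_expz -exprnP.
rewrite ltf_pV2 ?posrE ?exprn_gt0 ?lt_max ?ltr01 // => /ltW; apply: le_trans.
by rewrite le_max lexx orbT.
Qed.

Lemma slab_intensity s (a b : V) :
  exists2 l, intensity nu U (slab s (box a b)) = l%:E &
    0 <= l <= mass s * boxvol a b.
Proof.
have h := @intensity_le R d nu U (delta s) 1 a b.
have h0 := @intensity_ge0 R d nu U (slab s (box a b)).
rewrite (massE D0 hnu) -EFinM in h.
have fin : intensity nu U (slab s (box a b)) \is a fin_num.
  by rewrite ge0_fin_numE // (le_lt_trans h) ?ltry.
exists (fine (intensity nu U (slab s (box a b)))); first by rewrite fineK.
by apply/andP; split; rewrite -lee_fin fineK.
Qed.

(** One event per level suffices. Just before the threshold, the slab of radii above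
    [delta (lev j).-1] has intensity at most [4 * 2 ^ (j d) * W]. Any scale [s] is then compared
    with the smallest level whose threshold exceeds [mass s], at the price of a factor [2 ^ d]. *)
Lemma upper_event (M : nat) : {ae P, forall w, exists2 K : R, 0 <= K &
  forall s : nat, (Pi w (slab s (cbox M)) <= (K * (1 + mass s))%:E)%E}.
Proof.
pose W := boxvol (const_mx (- M%:R) : V) (const_mx M%:R).
have W0 : 0 <= W by exact: boxvol_ge0.
(* With [q = 2 ^ (j d)] the Poisson tail is at most [2 ^ (K0 q)] over [2 ^ (K q)]; taking [K] one
   larger than [K0] leaves [2 ^ (- q)]. *)
have [K0 K0P] := pow2_unbounded (expR (4 * W)).
pose K := K0.+1.
pose E j := slab (lev j).-1 (cbox M).
pose B j := [set w | (((K * 2 ^ (j * d))%N%:R)%:E <= Pi w (E j))%E].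
have mE j : measurable (E j) by exact: measurable_slab_box.
have mB j : measurable (B j) by apply: poisson_ge_measurable poi _ _ _.
have [J0 J0P] := lev_unbounded d0 D0 hnu 0.
have PB j : (J0 <= j)%N -> (P (B j) <= (1 * 2^-1 ^+ j)%:E)%E.
  move=> /J0P lj.
  have [l lE /andP[l0 lW]] := slab_intensity (lev j).-1 (const_mx (- M%:R)) (const_mx M%:R).
  apply: (le_trans (poisson_tail poi _ (mE j) lE l0)); rewrite lee_fin mul1r.
  set q := (2 ^ (j * d))%N.
  have lq : l <= q%:R * (4 * W).
    apply: (le_trans lW); rewrite mulrA ler_wpM2r // ltW //.
    have := @lev_lt R d D nu D0 hnu j (lev j).-1; rewrite prednK // => /(_ (leqnn _)).
    by rewrite mulrC; rewrite /q natrX.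
  have e1 : expR l <= 2 ^+ (q * K0).
    apply: (@le_trans _ _ (expR (q%:R * (4 * W)))); first by rewrite ler_expR.
    rewrite expRM_natl mulnC exprM; apply: lerXn2r; rewrite ?nnegrE ?expR_ge0 //.
  apply: (@le_trans _ _ (2 ^+ (q * K0) * 2^-1 ^+ (K * q))).
    by apply: ler_wpM2r e1; rewrite exprn_ge0.
  rewrite /K mulSn exprD mulrCA [(K0 * q)%N]mulnC -exprMn divff // expr1n mulr1.
  apply: ler_wiXn2l; rewrite ?invr_ge0 // ?invf_le1 ?ler1n //.
  by apply: leq_trans (leq_pmulr j d0) _; apply/ltnW/ltn_expl.
have := borel_cantelli_ae mB PB; apply: filterS => w [J JP].
pose q (j : nat) : R := 2 ^+ (j * d).
have q0 j : 0 < q j by rewrite exprn_gt0.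
have JP' j : (J <= j)%N -> (Pi w (E j) <= (K%:R * q j)%:E)%E.
  move=> /JP /negP; rewrite -ltNge => /ltW; rewrite natrM.
  by rewrite /q (_ : 2 ^+ (j * d) = (2 ^ (j * d))%N%:R :> R) //; exact/esym/natrX.
have step s j : mass s < 4 * q j -> (J <= j)%N -> (Pi w (slab s (cbox M)) <= (K%:R * q j)%:E)%E.
  move=> sj Jj; apply: le_trans (JP' j Jj); apply: le_measure; rewrite ?inE //.
    exact: measurable_slab_box.
  apply: slab_mono; have : (s < lev j)%N.
    rewrite ltnNge; apply/negP => /(mass_homo D0 hnu); apply/negP; rewrite -ltNge.
    exact: lt_le_trans (lev_ge _ _ _ _).
  by case: (lev j).
have K0' : 0 <= K%:R :> R by [].
(* The first term serves the scales with [mass s < 4 * q J], the second all others. *)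
exists (K%:R * q J + K%:R * 2 ^+ d).
  by rewrite addr_ge0 // mulr_ge0 // ?ltW ?exprn_gt0.
move=> s; have m0 := mass_ge0 D0 hnu s.
have [sJ|Js] := ltP (mass s) (4 * q J).
  apply: (le_trans (step s J sJ (leqnn _))); rewrite lee_fin.
  have q1 := ltW (q0 J).
  have : 0 <= K%:R * 2 ^+ d :> R by rewrite mulr_ge0 // exprn_ge0.
  have : 0 <= K%:R * q J by rewrite mulr_ge0.
  move: (K%:R * q J) (K%:R * 2 ^+ d) => x y x0 y0.
  have : 0 <= (x + y) * mass s by rewrite mulr_ge0 ?addr_ge0.
  by rewrite mulrDr mulr1; lra.
pose p j := mass s < 4 * q j.
have exp : exists j, p j.
  have [n nP] := pow2_unbounded (mass s); exists n; rewrite /p.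
  apply: (le_lt_trans nP); apply: (@le_lt_trans _ _ (q n)).
    by rewrite ler_weXn2l ?ler1n // leq_pmulr.
  by rewrite ltr_pMl // ltr1n.
case: (ex_minnP exp) => j pj jmin.
have Jj : (J < j)%N.
  rewrite ltnNge; apply/negP => jJ; move: pj; rewrite /p ltNge => /negP; apply.
  apply: le_trans Js; rewrite ler_pM2l // /q ler_weXn2l ?ler1n //.
  by rewrite leq_mul2r jJ orbT.
case: j Jj jmin pj => // j Jj jmin pj.
apply: (le_trans (step s j.+1 pj (leqW Jj))); rewrite lee_fin.
have mj : 4 * q j <= mass s.
  by rewrite leNgt; apply/negP => /jmin; rewrite ltnn.
have qS : q j.+1 = 2 ^+ d * q j by rewrite /q mulSn exprD.
rewrite qS mulrA; have h0 : 0 <= K%:R * 2 ^+ d :> R by rewrite mulr_ge0 // exprn_ge0.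
apply: (@le_trans _ _ (K%:R * 2 ^+ d * (1 + mass s))).
  by apply: ler_wpM2l => //; have := q0 j; lra.
apply: ler_wpM2r; first by lra.
by rewrite lerDr mulr_ge0 // ltW.
Qed.

Definition hits (Q : {measure set (BSp R d) -> \bar R}) (c : I) (s n : nat) :
    {set {ffun 'I_d -> 'I_(2 ^ n)}} :=
  finset (fun l => Q (slab s (cube (kid c l))) != 0%E).

(* Each of the [q = 2 ^ (n d)] subcubes is free of points with probability at most
   [exp (-4)], so the union bound over the sets of at least [q / 2] free subcubes
   gives [2 ^ q exp (-2 q)], which is summable. *)
Lemma lower_event (g : nat) (c : I) : c.1 = g%:Z -> cube c `<=` U ->
  {ae P, forall w, exists J, forall j, (J <= j)%N -> (g <= j)%N ->
    (2 ^ ((j - g) * d) <= 2 * #|hits (Pi w) c (lev j) (j - g)|)%N}.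
Proof.
move=> cg cU.
have [vPi [_ [mPi [pP indep]]]] := poi.
pose n j := (j - g)%N.
pose E j (l : {ffun 'I_d -> 'I_(2 ^ n j)}) := slab (lev j) (cube (kid c l)).
have mE j l : measurable (@E j l) by exact: measurable_slab_cube.
pose Emp j l := [set w | Pi w (@E j l) = 0%E].
have mEmp j l : measurable (@Emp j l).
  rewrite -[X in measurable X]setTI.
  exact: (mPi _ (mE j l) measurableT [set 0%E] (emeasurable_set1 _)).
have PEmp j l : (g <= j)%N -> (P (@Emp j l) <= (expR (- 4))%:E)%E.
  move=> gj.
  have [r rE /andP[r0 _]] := slab_intensity (lev j) (corner (kid c l)) (ucorner (kid c l)).
  have r4 : 4 <= r.
    rewrite -lee_fin -rE; apply: le_trans (intensity_ge _ _ _ _) => //.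
    - rewrite massE // boxvol_cube -EFinM lee_fin /vol /= cg.
      have -> : g%:Z + (n j)%:Z = j%:Z by rewrite /n; lia.
      rewrite -invr_expz -exprnP exprVn -exprM.
      rewrite ler_pdivlMr ?exprn_gt0 //; exact: lev_ge.
    - by rewrite ltW // delta_gt0.
    - by rewrite -cube_box; apply: subset_trans cU; exact: (kid_sub _ _).2.
  rewrite -cube_box in rE.
  have := (pP _ (mE j l)).2 r rE 0%N; rewrite expr0 fact0 divr1 mulr1 => ->.
  by rewrite lee_fin ler_expR lerN2.
have PT j (T : {set {ffun 'I_d -> 'I_(2 ^ n j)}}) : (g <= j)%N ->
    (P (\bigcap_(l in [set` T]) @Emp j l) <= (expR (- 4) ^+ #|T|)%:E)%E.
  move=> gj.
  have := indep #|T| (fun i => @E j (enum_val i)) (fun=> [set 0%E]).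
  rewrite (_ : \bigcap_(i in _) _ = \bigcap_(l in [set` T]) @Emp j l); last first.
    apply/seteqP; split=> w h l /= lT; last by apply: h => /=; exact: enum_valP.
    by have := h (enum_rank_in lT l) Logic.I; rewrite /= enum_rankK_in.
  move=> ->.
  - pose r (i : 'I_#|T|) := fine (P (@Emp j (enum_val i))).
    have rE i : P (@Emp j (enum_val i)) = (r i)%:E by rewrite fineK ?fin_num_measure.
    rewrite (eq_bigr (fun i => (r i)%:E)) => [|i _]; last exact: rE.
    rewrite prodEFin lee_fin.
    have -> : expR (- 4) ^+ #|T| = \prod_(i < #|T|) expR (- 4) :> R.
      by rewrite prodr_const card_ord.
    apply: ler_prod => i _; rewrite -!lee_fin -rE measure_ge0 /=; exact: PEmp.
  - by move=> i; exact: mE.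
  - move=> i k ik; apply/seteqP; split=> // z [[_ z1] [_ z2]].
    have := cube_uniq _ z1 z2 => /(_ erefl) /kid_inj /enum_val_inj e.
    by rewrite e eqxx in ik.
  - by move=> i; exact: emeasurable_set1.
(* Sets of at least half of the subcubes; [B j] says that all the subcubes of one such set are free
   of points. *)
pose F j : {set {set {ffun 'I_d -> 'I_(2 ^ n j)}}} :=
  finset (fun T : {set {ffun 'I_d -> 'I_(2 ^ n j)}} => (2 ^ (n j * d) <= 2 * #|T|)%N).
pose B j := \big[setU/set0]_(T in F j) \bigcap_(l in [set` T]) @Emp j l.
have mBT j (T : {set {ffun 'I_d -> 'I_(2 ^ n j)}}) :
    measurable (\bigcap_(l in [set` T]) @Emp j l).
  by apply: fin_bigcap_measurable => [|l _]; [exact: finite_finset|exact: mEmp].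
have mB j : measurable (B j) by apply: bigsetU_measurable => T _; exact: mBT.
have PB j : (g <= j)%N -> (P (B j) <= (2 ^+ g * 2^-1 ^+ j)%:E)%E.
  move=> gj.
  apply: (@le_trans _ _ (\sum_(T in F j) P (\bigcap_(l in [set` T]) @Emp j l))%E).
    rewrite /B; suff [] : measurable (\big[setU/set0]_(T in F j) \bigcap_(l in [set` T]) @Emp j l) /\
      (P (\big[setU/set0]_(T in F j) \bigcap_(l in [set` T]) @Emp j l) <=
       \sum_(T in F j) P (\bigcap_(l in [set` T]) @Emp j l))%E by [].
    elim/big_rec2 : _ => [|T x y _ [my xy]]; first by rewrite measure0.
    split; first by apply: measurableU => //; exact: mBT.
    apply: (le_trans (measureU2 _ (mBT j T) my)).
    by rewrite leeD2l.
  apply: (@le_trans _ _ (\sum_(T in F j) (expR (- 2) ^+ (2 ^ (n j * d)))%:E)%E).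
    apply: lee_sum => T; rewrite inE => hT; apply: (le_trans (PT j T gj)).
    rewrite lee_fin.
    have -> : expR (- 4) = expR (- 2) ^+ 2 :> R by rewrite -expRM_natl; congr expR; ring.
    rewrite -exprM; apply: ler_wiXn2l; rewrite ?expR_ge0 ?expR_le1 ?oppr_le0 //.
  rewrite sumEFin lee_fin sumr_const.
  set q := (2 ^ (n j * d))%N.
  (* One factor [2^-1] absorbs the [2 ^ q] of the union bound, the other gives summability. *)
  have e2 : expR (- 2) <= 2^-1 * 2^-1 :> R.
    rewrite expRN -invfM lef_pV2 ?posrE ?expR_gt0 ?mulr_gt0 //.
    have -> : (2 : R) = 1 + 1 by ring.
    by rewrite expRD; apply: ler_pM; rewrite ?expR_ge1Dx //; lra.
  have cF : (#|F j| <= 2 ^ q)%N.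
    by apply: (leq_trans (max_card _)); rewrite -cardsT -powersetT card_powerset cardsT card_kid.
  rewrite -[leLHS]mulr_natr.
  apply: (@le_trans _ _ ((2^-1 * 2^-1) ^+ q * (2 ^ q)%N%:R)).
    apply: ler_pM; rewrite ?exprn_ge0 ?expR_ge0 ?ler_nat //.
    by apply: lerXn2r; rewrite ?nnegrE ?expR_ge0 ?mulr_ge0 ?invr_ge0.
  rewrite natrX -exprMn mulfVK //.
  have -> : 2 ^+ g * 2^-1 ^+ j = 2^-1 ^+ n j :> R.
    by rewrite /n -{1}(subnK gj) exprD mulrCA -exprMn divff // expr1n mulr1.
  apply: ler_wiXn2l; rewrite ?invr_ge0 // ?invf_le1 ?ler1n //.
  by apply: leq_trans (leq_pmulr (n j) d0) _; apply/ltnW/ltn_expl.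
have := borel_cantelli_ae mB PB; apply: filterS => w [J JP].
exists J => j Jj gj; rewrite leqNgt; apply/negP => lt.
have := JP j Jj; apply; rewrite /B.
(* If fewer than half of the subcubes were hit, the complement of [hits] would belong to [F j]. *)
rewrite (bigD1 (~: hits (Pi w) c (lev j) (j - g))) /=.
  by left => l /=; rewrite !inE negbK => /eqP.
rewrite inE /n; move: lt; have := cardsC (hits (Pi w) c (lev j) (j - g)); rewrite card_kid => <-.
set x := #|hits _ _ _ _|; set y := #|~: _|; move: x y => x y; lia.
Qed.
End Events.

(** * Volume of disjoint subcubes *)

Section Packing.
Context {R : realType} {d : nat}.
Local Notation I := (@cidx d).
Local Notation sub := (@sub R d).
Local Notation cube := (@cube R d).
Local Notation vol := (@vol R d).
Local Notation L n := {ffun 'I_d -> 'I_(2 ^ n)}.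

Definition kids_in (c a : I) (n : nat) : {set L n} :=
  finset (fun l : L n => `[< sub (kid c l) a >]).

Lemma kids_inP c a n (l : L n) : reflect (sub (kid c l) a) (l \in kids_in c a n).
Proof. by rewrite inE; exact: asboolP. Qed.

Lemma card_kids_in (c a : I) n m : sub a c -> c.1 + n%:Z = a.1 + m%:Z ->
  #|kids_in c a n| = (2 ^ (m * d))%N.
Proof.
move=> sac e.
have /choice[f fP] (l : L m) : exists l' : L n, kid a l = kid c l' :> I.
  apply: (@kidP R); first by rewrite /= e.
  by apply: sub_trans sac; exact: kid_sub.
have finj : injective f by move=> l l' h; apply: (@kid_inj d a m); rewrite !fP h.
rewrite -(card_kid (d := d) m) -(card_codom finj); apply: eq_card => l.
apply/kids_inP/codomP => [sl|[l' ->]]; last by rewrite -fP; exact: kid_sub.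
have [l' l'E] := @kidP R d a (kid c l) m e sl.
by exists l'; apply: (@kid_inj d c n); rewrite -fP.
Qed.

Lemma vol_refine (c : I) (n : nat) :
  vol c = (2 ^ (- (c.1 + n%:Z))) ^+ d * (2 ^ (n * d))%N%:R.
Proof.
rewrite natrX /vol opprD pow2D exprMn exprM -mulrA.
by rewrite -exprMn exprnP pow2V expr1n mulr1.
Qed.

(** All cubes are cut down to the finest generation among them, where disjointness becomes a count:
    subcubes inside members of [s] and remaining ones add up to [2 ^ (n d)]. *)
Lemma packing_rest (C : I) (s : seq I) : uniq s ->
  (forall a, a \in s -> sub a C) ->
  (forall a b, a \in s -> b \in s -> a != b -> cube a `&` cube b = set0) ->
  exists n, \sum_(a <- s) vol a +
    #|~: [set l in [set: L n] | has (fun a => l \in kids_in C a n) s]%SET|%:R *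
      (vol C * (2 ^ (n * d))%N%:R^-1) = vol C.
Proof.
move=> us sC disj.
pose g (a : I) := `|a.1 - C.1|%N.
pose n := (\max_(a <- s) g a)%N.
have gn a : a \in s -> a.1 + (n - g a)%N%:Z = C.1 + n%:Z.
  move=> sa; have : (g a <= n)%N by rewrite /n (big_rem a) //= leq_maxl.
  by have [+ _] := sC _ sa; rewrite /g; lia.
have volE a : a \in s -> vol a = vol C * (2 ^ (n * d))%N%:R^-1 * #|kids_in C a n|%:R.
  move=> sa; rewrite (@card_kids_in C a n (n - g a)) ?gn //; last exact: sC.
  rewrite (vol_refine a (n - g a)) gn // (vol_refine C n) mulfK //.
have card_has : forall r : seq I, uniq r -> {subset r <= s} ->
    (\sum_(a <- r) #|kids_in C a n| =
     #|[set l in [set: L n] | has (fun a => l \in kids_in C a n) r]%SET|)%N.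
  elim=> [|a r IHr] /=.
    by rewrite big_nil => _ _; apply/esym/eqP; rewrite cards_eq0; apply/eqP/setP => l; rewrite !inE.
  move=> /andP[ar ur] rs; rewrite big_cons IHr //; last first.
    by move=> b br; apply: rs; rewrite inE br orbT.
  rewrite -cardsUI; set X := (_ :&: _)%SET; have -> : X = finset.set0.
    apply/setP => l; rewrite !inE /=; apply/negP => /andP[/asboolP la /hasP[b br]].
    rewrite inE => /asboolP lb.
    have ab : a != b by apply: contra ar => /eqP ->.
    have := disj a b (rs a _) (rs b _) ab; rewrite !inE eqxx br orbT => /(_ isT isT).
    move=> h; have : (cube a `&` cube b) (corner (kid C l)).
      by split; [apply: la.2|apply: lb.2]; exact: cube_corner.
    by rewrite h.
  by rewrite cards0 addn0; apply: eq_card => l; rewrite !inE.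
exists n; rewrite (eq_big_seq _ volE) -mulr_sumr -natr_sum card_has //.
rewrite [X in _ + X]mulrC -mulrDr -natrD cardsC card_kid mulfVK //.
Qed.

Lemma vol_packing (C : I) (s : seq I) : uniq s ->
  (forall a, a \in s -> sub a C) ->
  (forall a b, a \in s -> b \in s -> a != b -> cube a `&` cube b = set0) ->
  \sum_(a <- s) vol a <= vol C.
Proof.
move=> us sC disj; have [n <-] := packing_rest us sC disj.
by rewrite lerDl mulr_ge0 // divr_ge0 // ltW // vol_gt0.
Qed.
End Packing.

(** * Greedy selection of disjoint cubes *)

Section Selection.
Context {R : realType} {d : nat}.
Local Notation I := (@cidx d).
Local Notation V := 'rV[R]_d.
Local Notation sub := (@sub R d).
Local Notation cube := (@cube R d).
Local Notation vol := (@vol R d).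
Local Notation L n := {ffun 'I_d -> 'I_(2 ^ n)}.
Hypothesis d0 : (0 < d)%N.
Variables (c : I) (g : nat) (X : set V) (lv i_ : nat -> nat).
Variable H : forall j : nat, {set L (j - g)}.
Hypothesis cg : c.1 = g%:Z.
Hypothesis H_large : exists J, forall j, (J <= j)%N -> (g <= j)%N ->
  (3 * 2 ^ ((j - g) * d) <= 8 * #|H j|)%N.
Hypothesis H_hit : forall j (l : L (j - g)) n, l \in H j -> exists q : I,
  [/\ q.1 = (kid c l).1 + n%:Z, sub q (kid c l) &
      (lv j)%:Z <= q.1 -> cube q `<=` X].
Hypothesis i_ge : forall j, (j <= i_ j)%N.

(** [a.2] is the stage at which the cube [a.1] is selected, and [i_] gives its generation. The
    witness [q] lies in [X]; it is [a.1] itself when [lv a.2 <= i_ a.2]. *)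
Definition selectable (J : nat) (a : I * nat) : Prop :=
  [/\ (J <= a.2)%N, a.1.1 = (i_ a.2)%:Z, sub a.1 c &
      exists q : I, [/\ q.1 = (maxn (i_ a.2) (lv a.2))%:Z, sub q a.1 & cube q `<=` X]].

Definition meets (a b : set V) : Prop := exists x, a x /\ b x.

Definition conflicts (n : nat) (sel : seq (I * nat)) : {set L n} :=
  finset (fun l : L n => has (fun a : I * nat => `[< meets (cube (kid c l)) (cube a.1) >]) sel).

Let vol_pow (a : I) (n e : nat) : a.1 + n%:Z = e%:Z ->
  vol a * ((2 ^ e) ^ d)%N%:R = (2 ^ (n * d))%N%:R.
Proof.
move=> ane; rewrite (vol_refine a n) ane mulrAC.
suff -> : (2 ^ (- e%:Z)) ^+ d * ((2 ^ e) ^ d)%N%:R = 1 :> R by rewrite mul1r.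
by rewrite !natrX -exprMn exprnP pow2V expr1n.
Qed.

(** A cube at least as fine as the subcubes meets at most one of them; a coarser one meets only
    those that it contains, whose number is the ratio of the volumes. *)
Let card_conflict1 (n : nat) (a : I) : sub a c ->
  #|finset (fun l : L n => `[< meets (cube (kid c l)) (cube a) >])|%:R <=
  1 + vol a * ((2 ^ (g + n)) ^ d)%N%:R :> R.
Proof.
move=> sac; set B := finset _.
have v0 : 0 <= vol a * ((2 ^ (g + n)) ^ d)%N%:R by rewrite mulr_ge0 // ltW // vol_gt0.
have kidg (l : L n) : (kid c l).1 = (g + n)%:Z by rewrite /= cg PoszD.
have memB l : l \in B -> meets (cube (kid c l)) (cube a) by rewrite inE => /asboolP.
have [ga|ag] := leP ((g + n)%:Z) a.1.
  have B1 : (#|B| <= 1)%N.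
    apply/card_le1_eqP => l' l /memB[x [lx ax]] /memB[y [ly ay]].
    have s2 : sub a (kid c l') by apply: (cube_nest _ ax lx); rewrite kidg.
    have s1 : sub a (kid c l) by apply: (cube_nest _ ay ly); rewrite kidg.
    suff e : kid c l = kid c l' by apply/(@kid_inj d c n); rewrite e.
    apply: (@cube_uniq R d _ _ (corner a)); rewrite ?kidg //.
      exact/s1.2/cube_corner.
    exact/s2.2/cube_corner.
  by apply: (@le_trans _ _ 1); [rewrite lern1|rewrite lerDl].
pose m := `|(g + n)%:Z - a.1|%N.
have em : c.1 + n%:Z = a.1 + m%:Z by rewrite /m cg; lia.
have : (#|B| <= #|kids_in (R := R) c a n|)%N.
  apply: subset_leq_card; apply/fintype.subsetP => l.
  move=> /memB[x [lx ax]].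
  by apply/kids_inP; apply: (cube_nest _ lx ax); rewrite kidg ltW.
rewrite (card_kids_in sac em) => Bm.
apply: (@le_trans _ _ (2 ^ (m * d))%N%:R); first by rewrite ler_nat.
by rewrite (vol_pow (n := m)) ?lerDr // -em cg PoszD.
Qed.

Let card_conflicts (n : nat) (sel : seq (I * nat)) :
  (forall a, a \in sel -> sub a.1 c) ->
  #|conflicts n sel|%:R <=
  (size sel)%:R + (\sum_(a <- sel) vol a.1) * ((2 ^ (g + n)) ^ d)%N%:R :> R.
Proof.
elim: sel => [|a r IHr] sc.
  rewrite big_nil mul0r addr0 lern0 cards_eq0; apply/eqP/setP => l.
  by rewrite !inE.
have h1 := card_conflict1 n (sc a (mem_head _ _)).
have {}IHr := IHr (fun b br => sc b (mem_behead (s := a :: r) br)).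
set B := finset _ in h1.
have : (#|conflicts n (a :: r)| <= #|B| + #|conflicts n r|)%N.
  apply: leq_trans (leq_card_setU _ _); apply: subset_leq_card.
  by apply/fintype.subsetP => l; rewrite !inE.
rewrite -(ler_nat R) natrD => /le_trans; apply.
rewrite big_cons /= -[(size r).+1%:R]natr1 mulrDl.
by apply: (le_trans (lerD h1 IHr)); rewrite addrACA [1 + _]addrC.
Qed.

(** At least [3/8] of the subcubes are available, and earlier choices conflict with at most [2/8]:
    one eighth through their number, one eighth through their volume. Exactly [1/8] of the subcubes
    are then used, each receiving one cube of generation [i_ n]. *)
Lemma selection_step (J n : nat) (sel : seq (I * nat)) :
  (g + 3 <= n)%N -> (J <= n)%N -> (3 * 2 ^ ((n - g) * d) <= 8 * #|H n|)%N ->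
  uniq sel -> (forall a, a \in sel -> selectable J a) ->
  (forall a b, a \in sel -> b \in sel -> meets (cube a.1) (cube b.1) -> a = b) ->
  (8 * size sel <= 2 ^ ((n - g) * d))%N ->
  \sum_(a <- sel) vol a.1 <= vol c / 8 ->
  exists sel' : seq (I * nat), [/\ uniq sel', (forall a, a \in sel' -> selectable J a),
    (forall a b, a \in sel' -> b \in sel' -> meets (cube a.1) (cube b.1) -> a = b),
    (8 * size sel' <= 2 ^ ((n.+1 - g) * d))%N &
    \sum_(a <- sel') vol a.1 =
    vol c / 8 * 2^-1 ^+ ((i_ n - n) * d) + \sum_(a <- sel) vol a.1].
Proof.
move=> gn Jn Hn us ss ds cs vs.
have gn' : (g <= n)%N by lia.
have volc : vol c * ((2 ^ (g + (n - g))) ^ d)%N%:R = (2 ^ ((n - g) * d))%N%:R.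
    by rewrite (vol_pow (n := n - g)) // cg PoszD.
pose C := H n :\: conflicts (n - g) sel.
(* One eighth of the number of subcubes; [g + 3 <= n] ensures that the exponent is not truncated. *)
pose m := (2 ^ ((n - g) * d - 3))%N.
have m8 : (8 * m = 2 ^ ((n - g) * d))%N.
  rewrite /m -[8%N]/(2 ^ 3)%N -expnD subnKC //.
  by apply: leq_trans (leq_pmulr (n - g) d0); lia.
have cC : (m <= #|C|)%N.
  have h1 : (8 * #|conflicts (n - g) sel| <= 2 * 2 ^ ((n - g) * d))%N.
    rewrite -(ler_nat R) natrM.
    have := @card_conflicts (n - g) sel (fun a h => let: And4 _ _ s _ := ss a h in s).
    have w0 : 0 <= ((2 ^ (g + (n - g))) ^ d)%N%:R :> R by [].
    have := ler_wpM2r w0 vs.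
    rewrite mulrAC volc natrM => h2 h3; move: cs; rewrite -(ler_nat R) natrM.
    move: h2 h3; move: (_ * _) => z; move: (2 ^ _)%N%:R (size sel)%:R #|_|%:R => a b e.
    lra.
  have h2 : (#|H n| <= #|C| + #|conflicts (n - g) sel|)%N.
    apply: leq_trans (leq_card_setU _ _); apply: subset_leq_card.
    apply/fintype.subsetP => l lH; rewrite !inE lH andbT orNb //.
  move: Hn m8 h1 h2; move: (2 ^ _)%N => x; lia.
pose r := take m (enum C).
have ur : uniq r by rewrite take_uniq // enum_uniq.
have rC l : l \in r -> l \in C by move=> /mem_take; rewrite mem_enum.
have sr : size r = m by rewrite size_take -cardE; case: ltngtP cC.
have /choice[f fP] (l : L (n - g)) : exists a : I, l \in H n ->
    sub a (kid c l) /\ selectable J (a, n).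
  have [lH|nH] := boolP (l \in H n); last by exists c.
  have kg : (kid c l).1 = n%:Z by rewrite /= cg -PoszD subnKC.
  have [q [qg qs qX]] := H_hit (maxn (i_ n) (lv n) - n) lH.
  have {}qg : q.1 = (maxn (i_ n) (lv n))%:Z.
    rewrite qg kg -PoszD subnKC //; apply: leq_trans (i_ge n) _; exact: leq_maxl.
  have qx : cube q (corner q) by exact: cube_corner.
  have iq : (i_ n)%:Z <= q.1 by rewrite qg lez_nat leq_maxl.
  (* The selected cube is the one of generation [i_ n] around [q]; it stays in the subcube because
     [n <= i_ n]. *)
  pose a := cof (i_ n)%:Z (corner q : V).
  have qa : sub q a by apply: (cube_nest _ qx (cube_cof _ _)).
  have ak : sub a (kid c l).
    by apply: (cube_nest _ (cube_cof _ _) (qs.2 _ qx)); rewrite kg lez_nat i_ge.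
  exists a => _; split=> //; split=> //=.
    by apply: sub_trans ak _; exact: kid_sub.
  exists q; split=> //; apply: qX; rewrite qg lez_nat; exact: leq_maxr.
have rH l : l \in r -> l \in H n by move=> /rC; rewrite inE => /andP[].
have fk l l' x : l \in r -> l' \in r -> cube (f l) x -> cube (f l') x -> l = l'.
  move=> lr l'r fx f'x; apply: (@kid_inj d c (n - g)).
  apply: (@cube_uniq R d _ _ x) => //.
    by apply: (fP _ (rH _ lr)).1.2.
  by apply: (fP _ (rH _ l'r)).1.2.
have fsel l a : l \in r -> a \in sel -> ~ meets (cube (f l)) (cube a.1).
  move=> lr asel [x [fx ax]]; have := rC _ lr; rewrite !inE => /andP[/negP + _]; apply.
  apply/hasP; exists a => //; apply/asboolP; exists x; split=> //.
  exact: (fP _ (rH _ lr)).1.2.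
pose new := [seq (f l, n) | l <- r].
exists (new ++ sel); split.
- rewrite cat_uniq us andbT; apply/andP; split.
    rewrite map_inj_in_uniq // => l l' lr l'r [e].
    by apply: (fk _ _ (corner (f l))) => //; rewrite ?e; exact: cube_corner.
  apply/hasPn => a asel; apply/negP => /mapP[l lr ea].
  apply: (fsel l a lr asel); exists (corner (f l)); rewrite ea /=.
  by split; exact: cube_corner.
- move=> a; rewrite mem_cat => /orP[/mapP[l lr ->]|]; last exact: ss.
  exact: (fP _ (rH _ lr)).2.
- move=> a b; rewrite !mem_cat => /orP[/mapP[l lr ->]|asel] /orP[/mapP[l' l'r ->]|bsel].
  + by move=> [x [fx f'x]]; rewrite (fk _ _ _ lr l'r fx f'x).
  + by move=> /(fsel _ _ lr bsel).
  + by move=> [x [ax fx]]; case: (fsel _ _ l'r asel); exists x.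
  + exact: ds.
- rewrite size_cat size_map sr mulnDr m8 subSn // [((n - g).+1 * d)%N]mulSn.
  apply: (@leq_trans (2 ^ ((n - g) * d) * 2)); first by rewrite muln2 -addnn leq_add2l.
  have d2 : (2 ^ 1 <= 2 ^ d)%N by rewrite leq_exp2l.
  by rewrite addnC expnD leq_mul2l d2 orbT.
rewrite big_cat big_map /=; congr (_ + _).
have -> : \sum_(l <- r) vol (f l) = \sum_(l <- r) (2 ^ (- (i_ n)%:Z)) ^+ d :> R.
  by apply: eq_big_seq => l lr; have [_ [_ /= e _ _]] := fP _ (rH _ lr); rewrite /vol e.
have -> : \sum_(l <- r) (2 ^ (- (i_ n)%:Z)) ^+ d = m%:R * (2 ^ (- (i_ n)%:Z)) ^+ d :> R.
  by rewrite big_const_seq count_predT sr iter_addr_0 mulr_natl.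
have -> : m%:R = (2 ^ ((n - g) * d))%N%:R / 8 :> R.
  by rewrite -m8 natrM mulrC mulKf // pnatr_eq0.
have iE : (i_ n - g = (i_ n - n) + (n - g))%N by have := i_ge n; lia.
have -> : vol c = (2 ^ (- (i_ n)%:Z)) ^+ d *
    (2 ^+ ((i_ n - n) * d) * (2 ^ ((n - g) * d))%N%:R).
  rewrite (vol_refine c (i_ n - g)) cg -PoszD subnKC; last exact: leq_trans (i_ge n).
  by rewrite iE mulnDl expnD natrM natrX.
have h : 2 ^+ ((i_ n - n) * d) * 2^-1 ^+ ((i_ n - n) * d) = 1 :> R.
  by rewrite -exprMn divff // expr1n.
move: (2 ^+ _) (2^-1 ^+ _) h ((2 ^ _) ^+ d) (_%:R : R) => x y xy z t.
by transitivity (z * t / 8 * (x * y)); [rewrite xy; ring|ring].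
Qed.

(** Stages are added until the chosen volume reaches [vol c / 8]. Before that, each stage adds
    [vol c / 8] times a term of a series whose partial sums reach [1] from any starting index. *)
Lemma selection (J0 : nat) :
  (forall J, exists n, 1 <= \sum_(J <= j < n) 2^-1 ^+ ((i_ j - j) * d) :> R) ->
  exists sel : seq (I * nat), [/\ uniq sel, (forall a, a \in sel -> selectable J0 a),
    (forall a b, a \in sel -> b \in sel -> meets (cube a.1) (cube b.1) -> a = b) &
    vol c / 8 <= \sum_(a <- sel) vol a.1].
Proof.
move=> divg; have [J JP] := H_large.
pose J1 := (J0 + J + g + 3)%N.
have vc0 : 0 <= vol c / 8 by rewrite divr_ge0 // ltW // vol_gt0.
have inv n : (J1 <= n)%N -> exists sel : seq (I * nat), [/\ uniq sel,
    (forall a, a \in sel -> selectable J0 a),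
    (forall a b, a \in sel -> b \in sel -> meets (cube a.1) (cube b.1) -> a = b),
    (8 * size sel <= 2 ^ ((n - g) * d))%N &
    vol c / 8 <= \sum_(a <- sel) vol a.1 \/
    vol c / 8 * \sum_(J1 <= j < n) 2^-1 ^+ ((i_ j - j) * d) <= \sum_(a <- sel) vol a.1].
  elim: n => [|n IHn]; first by rewrite /J1; lia.
  rewrite leq_eqVlt => /orP[/eqP <-|].
    by exists [::]; split=> //; right; rewrite big_geq // mulr0 big_nil.
  rewrite ltnS => J1n; have [sel [us ss ds cs vs]] := IHn J1n.
  case: vs => [big|vs].
    exists sel; split=> //; last by left.
    by apply: (leq_trans cs); rewrite leq_exp2l // leq_mul2r leq_sub2r ?orbT.
  have [big|/ltW small] := leP (vol c / 8) (\sum_(a <- sel) vol a.1).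
    exists sel; split=> //; last by left.
    by apply: (leq_trans cs); rewrite leq_exp2l // leq_mul2r leq_sub2r ?orbT.
  have [gn [Jn Jn']] : (g + 3 <= n /\ J0 <= n /\ J <= n)%N by rewrite /J1 in J1n; lia.
  have gn' : (g <= n)%N by lia.
  have [sel' [us' ss' ds' cs' vs']] :=
    selection_step gn Jn (JP _ Jn' gn') us ss ds cs small.
  exists sel'; split=> //; right; rewrite vs' big_nat_recr //= mulrDr addrC lerD2l //.
have [n nP] := divg J1.
have J1n : (J1 <= n)%N.
  by rewrite leqNgt; apply/negP => h; move: nP; rewrite big_geq ?ler10 // ltnW.
have [sel [us ss ds _ vs]] := inv n J1n.
exists sel; split=> //; case: vs => // /(le_trans _); apply.
by rewrite ler_peMr.
Qed.
End Selection.

(** * Elementary facts on real series *)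

Section RealSums.
Context {R : realType}.

Lemma esum_seq (T : choiceType) (s : seq T) (f : T -> R) : uniq s ->
  (forall a, a \in s -> 0 <= f a) ->
  (\esum_(a in [set` s]) (f a)%:E = (\sum_(a <- s) f a)%:E)%E.
Proof.
move=> us f0; rewrite esum_fset; [|exact: finite_seq|by move=> a; rewrite inE /= => /f0].
by rewrite -fsbig_seq // sumEFin.
Qed.

(** Either some late term reaches [1] and suffices alone, or truncation at [1] has no effect on late
    terms and divergence is inherited. *)
Lemma divergent_min (a b : nat -> R) (J0 : nat) :
  (forall J B, exists n, B <= \sum_(J <= j < n) a j) ->
  (forall j, 0 <= b j) -> (forall j, (J0 <= j)%N -> 0 <= a j) ->
  (forall j, (J0 <= j)%N -> Num.min 1 (a j) <= b j) ->
  forall J, exists n, 1 <= \sum_(J <= j < n) b j.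
Proof.
move=> diva b0 a0 ab J; pose J1 := maxn J J0.
have J0J1 : (J0 <= J1)%N by exact: leq_maxr.
have JJ1 : (J <= J1)%N by exact: leq_maxl.
have [[j [Jj aj]]|nex] := pselect (exists j, (J1 <= j)%N /\ 1 <= a j).
  exists j.+1; rewrite big_nat_recr /=; last exact: leq_trans Jj.
  apply: (@le_trans _ _ (b j)); last by rewrite lerDr sumr_ge0.
  by apply: le_trans (ab _ (leq_trans J0J1 Jj)); rewrite le_min lexx.
have [n nP] := diva J1 1; exists n; apply: (le_trans nP).
have [J1n|nJ1] := leqP J1 n; last by rewrite big_geq ?sumr_ge0 // ltnW.
rewrite (big_cat_nat JJ1 J1n) /= ler_wpDl ?sumr_ge0 //.
apply: ler_sum_nat => j /andP[J1j _].
apply: le_trans (ab _ (leq_trans J0J1 J1j)); rewrite le_min lexx andbT.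
by rewrite leNgt; apply/negP => aj; apply: nex; exists j; split=> //; exact: ltW.
Qed.

Lemma tail_small (a : nat -> R) (s0 t0 : nat) (B e : R) :
  (forall s, (s0 <= s)%N -> 0 <= a s) ->
  (forall n, \sum_(s0 <= s < n) a s <= B) -> 0 < e ->
  exists s1, [/\ (s0 <= s1)%N, (t0 <= s1)%N & forall n, \sum_(s1 <= s < n) a s <= e].
Proof.
move=> a0 aB e0.
pose S := range (fun n => \sum_(s0 <= s < n) a s).
have hS : has_sup S.
  by split; [exists (\sum_(s0 <= s < 0) a s); exists 0%N|exists B => _ [n _ <-]].
have [_ [n1 _ <-] n1P] := sup_adherent e0 hS.
pose s1 := maxn (maxn s0 t0) n1.
have s01 : (s0 <= s1)%N by rewrite /s1 !leq_max leqnn.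
have ge0 m n : (s0 <= m)%N -> 0 <= \sum_(m <= s < n) a s.
  move=> sm; rewrite big_nat_cond; apply: sumr_ge0 => s /andP[/andP[ms _] _].
  exact/a0/(leq_trans sm).
exists s1; split=> //; first by rewrite /s1 !leq_max leqnn !orbT.
move=> n; have [ns|sn] := leqP n s1; first by rewrite big_geq // ltW.
have le1 : \sum_(s0 <= s < n1) a s <= \sum_(s0 <= s < s1) a s.
  have [sn1|n1s] := leqP s0 n1; last by rewrite big_geq ?ge0 // ltnW.
  have n1s1 : (n1 <= s1)%N by rewrite /s1 leq_maxr.
  by rewrite (big_cat_nat sn1 n1s1) /= lerDl ge0.
have le2 : \sum_(s0 <= s < n) a s <= sup S by apply: (ub_le_sup hS.2); exists n.
move: le2; rewrite (big_cat_nat s01 (ltnW sn)) /= => le2.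
move: n1P le1 le2; move: (\sum_(_ <= _ < _) _) (\sum_(_ <= _ < _) _) (\sum_(_ <= _ < _) _).
by move=> x y z; lra.
Qed.

Lemma esum_cst_le (T : choiceType) (H : set T) (k b : R) : 0 <= k ->
  (forall r : seq T, uniq r -> (forall c, c \in r -> H c) -> (size r)%:R <= b) ->
  (\esum_(c in H) k%:E <= (k * b)%:E)%E.
Proof.
move=> k0 hb; apply: ge_ereal_sup => _ [X [finX XH] <-].
rewrite fsbig_finite //= sumEFin lee_fin big_const_seq count_predT iter_addr_0.
rewrite -[leLHS]mulr_natr ler_wpM2l // hb // => c.
by rewrite in_fset_set // inE; exact: XH.
Qed.

End RealSums.

(** * Cheap coverings *)

Section TinyCovers.
Context {R : realType} {d : nat}.
Local Notation I := (@cidx d).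
Local Notation V := 'rV[R]_d.
Local Notation cube := (@cube R d).

(** Nullity for the net content with weight [w] and cubes of generation at least [s0]. Lebesgue,
    Hausdorff and net nullity are all derived from it. *)
Definition tiny (w : int -> \bar R) (s0 : int) (E : set V) : Prop :=
  forall e : R, 0 < e -> exists A : set I,
    [/\ forall C, A C -> s0 <= C.1, covers A E & (\esum_(C in A) w C.1 <= e%:E)%E].

Lemma tiny_subset w s0 (E F : set V) : E `<=` F -> tiny w s0 F -> tiny w s0 E.
Proof.
move=> EF tF e e0; have [A [As cA sA]] := tF e e0; exists A; split=> //.
by apply: subset_trans cA.
Qed.

Lemma tiny_bigcup w s0 (E : nat -> set V) : (forall j, s0 <= j -> (0 <= w j)%E) ->
  (forall n, tiny w s0 (E n)) -> tiny w s0 (\bigcup_n E n).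
Proof.
move=> w0 tE e e0.
have en0 (n : nat) : 0 < e / (2 ^ n.+1)%N%:R by rewrite divr_gt0 // ltr0n expn_gt0.
have /choice[A AP] (n : nat) : exists A : set I, [/\ forall C, A C -> s0 <= C.1,
    covers A (E n) & (\esum_(C in A) w C.1 <= (e / (2 ^ n.+1)%N%:R)%:E)%E].
  exact: tE.
exists (\bigcup_n A n); split.
- by move=> C [n _ AC]; have [+ _ _] := AP n; apply.
- move=> x [n _ En]; have [_ + _] := AP n => /(_ x En)[C AC Cx].
  by exists C => //; exists n.
apply: (@le_trans _ _ (\esum_(n in [set: nat]) \esum_(C in A n) w C.1)%E).
  apply: le_esum_cover => // n C _ AC; apply: w0.
  by have [+ _ _] := AP n; apply.
apply: (@le_trans _ _ (\esum_(n in [set: nat]) (e / (2 ^ n.+1)%N%:R)%:E)%E).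
  by apply: le_esum => n _; have [_ _] := AP n.
rewrite -nneseries_esumT; last by move=> n; rewrite lee_fin ltW.
have := @epsilon_trick0 R e xpredT (ltW e0).
by [].
Qed.

Definition famseq (A : set I) (T : Type) (f : I -> T) (t0 : T) (n : nat) : T :=
  if pickle_inv n is Some C then if C \in A then f C else t0 else t0.

Lemma famseq_pickle (A : set I) (T : Type) (f : I -> T) (t0 : T) C : A C ->
  famseq A f t0 (pickle C) = f C.
Proof. by move=> AC; rewrite /famseq pickleK_inv mem_set. Qed.

Lemma famseqP (A : set I) (T : Type) (f : I -> T) (t0 : T) n :
  famseq A f t0 n = t0 \/ exists2 C, A C & famseq A f t0 n = f C.
Proof.
rewrite /famseq; case: pickle_inv => [C|]; last by left.
by case: ifPn => [/[!inE] AC|_]; [right; exists C|left].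
Qed.

Lemma famseq_sum (A : set I) (T : Type) (f : I -> T) (t0 : T) (w : T -> \bar R) :
  (forall C, A C -> (0 <= w (f C))%E) -> w t0 = 0%E ->
  (\sum_(n <oo) w (famseq A f t0 n) <= \esum_(C in A) w (f C))%E.
Proof.
move=> w0 wt0.
apply: (@le_trans _ _ (\sum_(n <oo) (if pickle_inv n is Some t
  then if t \in A then w (f t) else 0%E else 0%E))%E); last exact: esum_pickle.
rewrite le_eqVlt; apply/orP; left; apply/eqP; apply: eq_eseriesr => n _.
by rewrite /famseq; case: pickle_inv => // C; case: ifP.
Qed.

Lemma lebesgue_d_ge0 (E : set V) : (0 <= lebesgue_d E)%E.
Proof.
apply: le_ereal_inf_tmp => _ [a [b [_ ->]]].
by apply: nneseries_ge0 => n _ _; rewrite lee_fin boxvol_ge0.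
Qed.

Lemma lebesgue_d_null (s0 : int) (E : set V) : (0 < d)%N ->
  tiny (fun j => ((2 ^ (- j)) ^+ d)%:E) s0 E -> lebesgue_d E = 0%E.
Proof.
move=> d0 tE; apply/eqP; rewrite eq_le lebesgue_d_ge0 andbT.
apply/lee_addgt0Pr => e e0; rewrite add0e.
have [A [_ cA sA]] := tE e e0; apply: le_trans sA.
apply: ge_ereal_inf.
pose F := famseq A (fun C : I => (corner C : V, ucorner C : V)) (0 : V, 0 : V).
exists (\sum_(n <oo) (boxvol (F n).1 (F n).2)%:E)%E.
  exists (fun n => (F n).1), (fun n => (F n).2); split=> // x /cA[C AC Cx].
  exists (pickle C); first by [].
  by rewrite /F famseq_pickle //= -cube_box.
have w0 : (boxvol (0 : V) 0)%:E = 0%E.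
  by rewrite /boxvol (bigD1 (Ordinal d0)) //= !mxE subrr maxxx mul0r.
apply: (@le_trans _ _ (\esum_(C in A) (boxvol (corner C : V) (ucorner C))%:E)%E).
  apply: (@famseq_sum A _ (fun C : I => (corner C : V, ucorner C : V)) (0, 0)
    (fun ab : V * V => (boxvol ab.1 ab.2)%:E)); last by exact: w0.
  by move=> C _; rewrite lee_fin boxvol_ge0.
by apply: le_esum => C _; rewrite boxvol_cube.
Qed.

Section Metric.
Variables (N : V -> R) (D : R).
Hypotheses (d0 : (0 < d)%N) (nN : is_norm N) (D0 : 0 < D).
Hypothesis hD : forall c : I, diamN N (cube c) = (delta D c.1)%:E.
Local Notation delta := (delta D).

Lemma hausdorff_null (h : \bar R -> \bar R) (E : set V) : gauge h ->
  (forall s0 : nat, tiny (fun j => h (delta j)%:E) s0 E) -> hausdorff N h E = 0%E.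
Proof.
move=> [h0 [_ [h00 _]]] tE.
have diam0 : diamN N set0 = 0%E by rewrite /diamN eqxx.
have diam_ge0 C : (0 <= diamN N C)%E.
  rewrite /diamN; case: ifPn => // /set0P[x Cx].
  apply: ereal_sup_ubound; exists x, x.
  by rewrite subrr (norm_zero nN).
apply/eqP; rewrite eq_le; apply/andP; split; last first.
  apply: (@le_trans _ _ (hausdorff_delta N h 1 E)); last first.
    by apply: ereal_sup_ubound; exists 1 => //=; exact: ltr01.
  apply: le_ereal_inf_tmp => _ [C [_ [_ ->]]].
  by apply: nneseries_ge0 => n _ _; exact: h0.
apply: ge_ereal_sup => _ [del /= del0 <-].
apply/lee_addgt0Pr => e e0; rewrite add0e.
have [s0 s0P] := delta_small D0 del0.
have [A [As cA sA]] := tE s0 e e0; apply: le_trans sA.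
apply: ge_ereal_inf.
pose F : nat -> set V := famseq A cube set0.
exists (\sum_(n <oo) h (diamN N (F n)))%E.
  exists F; split; last split=> //.
    move=> x /cA[C AC Cx]; exists (pickle C); first by [].
    by rewrite /F famseq_pickle.
  move=> n; rewrite /F; have [->|[C AC ->]] := famseqP A cube (set0 : set V) n.
    by rewrite diam0 lee_fin ltW.
  by rewrite hD lee_fin ltW // s0P // As.
have hd0 C : (0 <= h (delta C)%:E)%E by apply: h0; rewrite lee_fin ltW ?delta_gt0.
have w0 : h (diamN N set0) = 0%E by rewrite diam0.
apply: (@le_trans _ _ (\esum_(C in A) h (diamN N (cube C)))%E).
  apply: (@famseq_sum A _ cube set0 (fun X => h (diamN N X))); last by exact: w0.
  by move=> C _; rewrite hD.
by apply: le_esum => C _; rewrite hD.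
Qed.

Lemma Minf_le (h : \bar R -> \bar R) (E : set V) (A : set I) : gauge h ->
  (forall C, A C -> ((delta C.1)%:E < eps_h d h)%E) -> covers A E ->
  (Minf N h E <= \esum_(C in A) h (delta C.1)%:E)%E.
Proof.
move=> [h0 [_ [h00 _]]] Ae cA; apply: ge_ereal_inf.
pose F : nat -> set V := famseq A cube set0.
have diam0 : diamN N set0 = 0%E by rewrite /diamN eqxx.
exists (\sum_(n <oo) h (diamN N (F n)))%E.
  exists F; split; last split=> //.
    move=> n; rewrite /F; have [->|[C AC ->]] := famseqP A cube (set0 : set V) n; first by left.
    by right; split; [exists C.1, C.2|rewrite hD; exact: Ae].
  move=> x /cA[C AC Cx]; exists (pickle C); first by [].
  by rewrite /F famseq_pickle.
have hd0 C : (0 <= h (delta C)%:E)%E by apply: h0; rewrite lee_fin ltW ?delta_gt0.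
have w0 : h (diamN N set0) = 0%E by rewrite diam0.
apply: (@le_trans _ _ (\esum_(C in A) h (diamN N (cube C)))%E).
  apply: (@famseq_sum A _ cube set0 (fun X => h (diamN N X))); last by exact: w0.
  by move=> C _; rewrite hD.
by apply: le_esum => C _; rewrite hD.
Qed.

(** A sequence may repeat cubes and contain empty sets; only the set of its admissible cubes is
    kept, which cannot raise the sum. *)
Lemma Minf_ge (h : \bar R -> \bar R) (E : set V) (x : \bar R) : gauge h ->
  (forall A : set I, (forall C, A C -> ((delta C.1)%:E < eps_h d h)%E) -> covers A E ->
    (x <= \esum_(C in A) h (delta C.1)%:E)%E) ->
  (x <= Minf N h E)%E.
Proof.
move=> [h0 [_ [h00 _]]] xA; apply: le_ereal_inf_tmp => _ [lam [lamP [cov ->]]].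
have hd0 (j : int) : (0 <= h (delta j)%:E)%E by apply: h0; rewrite lee_fin ltW ?delta_gt0.
pose A : set I := [set C | exists n, lam n = cube C /\ ((delta C.1)%:E < eps_h d h)%E].
apply: (@le_trans _ _ (\esum_(C in A) h (delta C.1)%:E)%E).
  apply: xA => [C [n []//]|y /cov[n _ ly]].
  case: (lamP n) => [l0|[[j [k lE]] ln]]; first by rewrite l0 in ly.
  have dE : dcube j k = cube (j, finfun k).
    apply/seteqP; split=> z hz i; have := hz i; rewrite /= ffunE //.
  exists (j, finfun k); last by rewrite -dE -lE.
  by exists n; rewrite lE dE; split=> //; rewrite -hD -dE -lE.
rewrite nneseries_esumT => [|n]; last first.
  case: (lamP n) => [->|[[j [k lE]] _]]; first by rewrite /diamN eqxx h00.
  have dE : dcube j k = cube (j, finfun k).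
    apply/seteqP; split=> z hz i; have := hz i; rewrite /= ffunE //.
  by rewrite lE dE hD.
have /choice[f fP] (C : I) : exists n, A C -> lam n = cube C.
  have [[n [e _]]|nA] := pselect (A C); first by exists n.
  by exists 0%N => /nA.
apply: (@le_esum_inj _ _ _ _ _ f) => //=.
- move=> C C'; rewrite !inE => hC hC' fC.
  have cE : cube C = cube C' by rewrite -(fP _ hC) -(fP _ hC') fC.
  (* Two indices with the same cube agree: the diameter determines the generation, and a common
     point then determines the position. *)
  have : delta C.1 = delta C'.1 by apply: EFin_inj; rewrite -!hD cE.
  move=> /(mulIf (lt0r_neq0 D0)) e.
  apply: (@cube_uniq R d _ _ (corner C)); last 2 first.
  - exact: cube_corner.
  - by rewrite -cE; exact: cube_corner.
  by apply/oppr_inj/eqP; rewrite eq_le -!(ler_pow2 (R := R)) e lexx.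
- by move=> C hC; rewrite (fP _ hC) hD.
- move=> n _; case: (lamP n) => [->|[[j [k lE]] _]]; first by rewrite /diamN eqxx h00.
  have dE : dcube j k = cube (j, finfun k).
    apply/seteqP; split=> z hz i; have := hz i; rewrite /= ffunE //.
  by rewrite lE dE hD.
Qed.
End Metric.
End TinyCovers.

(** * Filling cubes up to a null set *)

Section FullMeasure.
Context {R : realType} {d : nat}.
Local Notation I := (@cidx d).
Local Notation V := 'rV[R]_d.
Local Notation sub := (@sub R d).
Local Notation cube := (@cube R d).
Local Notation vol := (@vol R d).
Local Notation L n := {ffun 'I_d -> 'I_(2 ^ n)}.

(** The chosen cubes remove at least [1/8] of the volume of [c], and the rest is a union of subcubes
    of one generation, to which the argument applies again. After [n] rounds at most [(7 / 8) ^ n]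
    of the volume is left to cover. *)
Lemma cube_remainder (X U : set V) :
  (forall (c : I), 0 <= c.1 -> cube c `<=` U -> exists s : seq I, [/\ uniq s,
    forall a, a \in s -> sub a c /\ cube a `<=` X,
    forall a b, a \in s -> b \in s -> a != b -> cube a `&` cube b = set0 &
    vol c / 8 <= \sum_(a <- s) vol a]) ->
  forall (n : nat) (c : I), 0 <= c.1 -> cube c `<=` U -> exists A : set I,
    [/\ forall C, A C -> c.1 <= C.1, covers A (cube c `\` X) &
    (\esum_(C in A) (vol C)%:E <= ((7 / 8) ^+ n * vol c)%:E)%E].
Proof.
move=> hX; elim=> [|n IHn] c c0 cU.
  exists [set c]; split=> [C ->//|x [cx _]|]; first by exists c.
  by rewrite expr0 mul1r esum_set1 // lee_fin ltW ?vol_gt0.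
have [s [us ss ds vs]] := hX c c0 cU.
have [m mE] := packing_rest us (fun a h => (ss a h).1) ds.
set rest := (~: _)%SET in mE.
have kg (l : L m) : (kid c l).1 = c.1 + m%:Z by [].
have /choice[A AP] (l : L m) : exists A : set I, [/\ forall C, A C -> c.1 <= C.1,
    covers A (cube (kid c l) `\` X) &
    (\esum_(C in A) (vol C)%:E <= ((7 / 8) ^+ n * vol (kid c l))%:E)%E].
  have [||A [A1 A2 A3]] := IHn (kid c l).
  - by rewrite kg addr_ge0.
  - by apply: subset_trans cU; exact: (kid_sub c l).2.
  exists A; split=> // C /A1; rewrite kg; apply: le_trans.
  by rewrite lerDl.
have volk (l : L m) : vol (kid c l) = vol c * (2 ^ (m * d))%N%:R^-1.
  by rewrite (vol_refine c m) mulfK // pnatr_eq0 expn_eq0.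
exists (\bigcup_(l in [set` enum rest]) A l); split.
- by move=> C [l _ AC]; have [+ _ _] := AP l; apply.
- move=> x [cx nX].
  have cj : c.1 <= c.1 + m%:Z by rewrite lerDl.
  have [l lE] := @kidP R d c (cof (c.1 + m%:Z) x) m erefl (cof_sub cx cj).
  have lx : cube (kid c l) x by rewrite -lE; exact: cube_cof.
  have [_ + _] := AP l => /(_ x (conj lx nX))[C AC Cx].
  exists C => //; exists l => //=; rewrite mem_enum !inE.
  apply/negP => /hasP[a asq /kids_inP la]; apply: nX.
  by have [_] := ss a asq; apply; exact: la.2.
apply: (@le_trans _ _ (\esum_(l in [set` enum rest]) \esum_(C in A l) (vol C)%:E)%E).
  by apply: le_esum_cover => // l C _ _; rewrite lee_fin ltW ?vol_gt0.
apply: (@le_trans _ _ (\esum_(l in [set` enum rest])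
    ((7 / 8) ^+ n * (vol c * (2 ^ (m * d))%N%:R^-1))%:E)%E).
  by apply: le_esum => l _; have [_ _] := AP l; rewrite volk.
have v0 := ltW (vol_gt0 (R := R) c).
have q0 : 0 <= (7 / 8) ^+ n * (vol c * (2 ^ (m * d))%N%:R^-1) :> R.
  by rewrite mulr_ge0 ?exprn_ge0 ?divr_ge0.
rewrite esum_seq ?enum_uniq // lee_fin big_const_seq count_predT iter_addr_0 -cardE.
rewrite -[leLHS]mulr_natr exprS.
move: (#|_|%:R) (vol c * _) mE => k x mE.
have p0 : 0 <= (7 / 8) ^+ n :> R by rewrite exprn_ge0 ?divr_ge0.
have h : k * x <= 7 / 8 * vol c by lra.
have := ler_wpM2l p0 h; move: (_ ^+ n) => p h'.
by apply: le_trans (le_trans h' _); rewrite le_eqVlt; apply/orP; left; apply/eqP; ring.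
Qed.
End FullMeasure.

(** * Cubes close to a given cube *)

Section Neighbours.
Context {R : realType} {d : nat}.
Local Notation I := (@cidx d).
Local Notation V := 'rV[R]_d.
Local Notation cube := (@cube R d).
Variables (N : V -> R) (D : R).
Hypotheses (d0 : (0 < d)%N) (nN : is_norm N) (D0 : 0 < D).
Local Notation delta := (delta D).

Definition shift (K : nat) (c : I) (l : {ffun 'I_d -> 'I_(K + K).+1}) : I :=
  (c.1, [ffun i => c.2 i + (l i)%:Z - K%:Z]).

(** In units of the side, the coordinates of [x] and [y] differ by at most [C * D], where [C] bounds
    coordinates by [N]; rounding to cube positions adds one. *)
Lemma shift_near : exists K : nat, forall (s : nat) (x y : V) c,
  N (y - x) < delta s -> c.1 = s%:Z -> cube c x -> exists l, cof s%:Z y = @shift K c l.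
Proof.
have [C C0 CP] := norm_lower nN d0.
pose K := (Num.bound (C * D)).+1; exists K => s x y c yx cs cx.
have cD : C * D < (Num.bound (C * D))%:R by rewrite archi_boundP // mulr_ge0 // ltW.
have near i : `|Num.floor (2 ^ s%:Z * y ord0 i) - c.2 i| <= K%:Z.
  have := floor_itv (2 ^ s%:Z * y ord0 i); set f := Num.floor _ => /andP[f1 f2].
  have := cx i; rewrite /= cs => /andP[k1 k2].
  have h : `|2 ^ s%:Z * y ord0 i - 2 ^ s%:Z * x ord0 i| <= C * D.
    rewrite -mulrBr normrM gtr0_norm ?pow2_gt0 //.
    have := CP (y - x) i; rewrite !mxE => h1.
    have h2 : C * N (y - x) <= C * (2 ^ (- s%:Z) * D) by rewrite ler_pM2l // ltW.
    rewrite -ler_pdivlMl ?pow2_gt0 // invr_expz mulrCA.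
    exact: le_trans h1 h2.
  rewrite intrD in f2.
  rewrite -(ler_int R) intr_norm intrB.
  have -> : (K%:Z)%:~R = (Num.bound (C * D))%:R + 1 :> R.
    by rewrite /K -pmulrn -addn1 natrD.
  move: h; rewrite !ler_norml => /andP[h1 h2]; apply/andP; split; lra.
have lt i : (absz (Num.floor (2 ^ s%:Z * y ord0 i) - c.2 i + K%:Z)%R < (K + K).+1)%N.
  by have := near i; rewrite ler_norml; move: (Num.floor _) (c.2 i) => p q; lia.
exists [ffun i => Ordinal (lt i)]; rewrite /cof /shift cs; congr (_, _).
apply/ffunP => i; rewrite !ffunE /= gez0_abs; last first.
  by have := near i; rewrite ler_norml; move: (Num.floor _) (c.2 i) => p q; lia.
by rewrite addrA addrK addrC subrK.
Qed.

End Neighbours.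

(** * Integrals against the radius measure *)

Section MassSums.
Context {R : realType}.
Variables (d : nat) (D : R) (nu : {measure set R -> \bar R}).
Hypotheses (d0 : (0 < d)%N) (D0 : 0 < D) (hnu : classR nu).
Local Notation mass := (mass D nu).
Local Notation lev := (lev d D0 hnu).
Local Notation delta := (delta D).

(** Scales are grouped between consecutive levels: on such a block the increments of [mass]
    telescope to less than the next threshold, and [v] is at most its value at the start of the
    block. *)
Lemma lev_sum (v : nat -> R) (J : nat) :
  (forall s, (lev J <= s)%N -> 0 <= v s) ->
  (forall s t, (lev J <= s)%N -> (s <= t)%N -> v t <= v s) ->
  forall n, (J <= n)%N ->
  \sum_(lev J <= t < lev n) (mass t - mass t.-1) * v t <=
  \sum_(J <= j < n) 4 * 2 ^+ (j.+1 * d) * v (lev j).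
Proof.
move=> v0 vm; elim=> [|n IHn]; first by rewrite leqn0 => /eqP ->; rewrite !big_geq.
rewrite leq_eqVlt => /orP[/eqP <-|]; first by rewrite !big_geq.
rewrite ltnS => Jn; rewrite big_nat_recr //=.
have l1 : (lev J <= lev n)%N by exact: lev_homo.
have l2 : (lev n <= lev n.+1)%N by exact: lev_homo.
rewrite (big_cat_nat l1 l2) /=; apply: lerD; first exact: IHn.
have vn := v0 _ l1.
have [e|ne] := eqVneq (lev n) (lev n.+1).
  by rewrite e big_geq // -e mulr_ge0 // mulr_ge0 ?exprn_ge0.
have lt : (lev n < lev n.+1)%N by rewrite ltn_neqAle ne.
apply: (@le_trans _ _ (\sum_(lev n <= t < lev n.+1) (mass t - mass t.-1) * v (lev n))).
  apply: ler_sum_nat => t /andP[nt _]; apply: ler_wpM2l.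
    by rewrite subr_ge0; apply: mass_homo => //; exact: leq_pred.
  exact: vm.
rewrite -mulr_suml; apply: ler_wpM2r => //.
have tel b : (lev n <= b)%N -> \sum_(lev n <= t < b) (mass t - mass t.-1) = mass b.-1 - mass (lev n).-1.
  elim: b => [|b IHb]; first by rewrite leqn0 => /eqP ->; rewrite big_geq // subrr.
  rewrite leq_eqVlt => /orP[/eqP ->|]; first by rewrite big_geq // subrr.
  by rewrite ltnS => nb; rewrite big_nat_recr //= IHb //; ring.
rewrite tel //.
have : mass (lev n.+1).-1 < 4 * 2 ^+ (n.+1 * d).
  by apply: (@lev_lt R d D nu D0 hnu); rewrite prednK //; exact: leq_ltn_trans lt.
have := mass_ge0 D0 hnu (lev n).-1; lra.
Qed.

(** The previous bound transfers divergence to the levels. The increments of [mass] are shifted by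
    one scale there, which the doubling hypothesis [v s <= k * v s.+1] compensates. *)
Lemma lev_divergent (v : nat -> R) (k : R) (s0 : nat) : 0 <= k ->
  (forall s, 0 <= v s) ->
  (forall s t, (s0 <= s)%N -> (s <= t)%N -> v t <= v s) ->
  (forall s, (s0 <= s)%N -> v s <= k * v s.+1) ->
  (forall B, exists n, B <= \sum_(s0 <= s < n) (mass s.+1 - mass s) * v s) ->
  forall J B, exists n, B <= \sum_(J <= j < n) 2 ^+ (j * d) * v (lev j).
Proof.
move=> k0 v0 vm vk vdiv J B.
have [J0 J0P] := lev_unbounded d0 D0 hnu s0.
pose J1 := maxn J J0.
have s0l j : (J1 <= j)%N -> (s0 <= lev j)%N.
  by move=> Jj; apply/ltnW/J0P; apply: leq_trans Jj; exact: leq_maxr.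
have s0J : (s0 <= lev J1)%N by exact: s0l.
have dm0 s : 0 <= mass s.+1 - mass s by rewrite subr_ge0 mass_homo.
pose C := 4 * 2 ^+ d : R.
have C0 : 0 < C by rewrite mulr_gt0 // exprn_gt0.
pose B0 := \sum_(s0 <= s < lev J1) (mass s.+1 - mass s) * v s.
have B0' m n : (s0 <= m)%N -> 0 <= \sum_(m <= s < n) (mass s.+1 - mass s) * v s.
  move=> sm; rewrite big_nat_cond; apply: sumr_ge0 => s /andP[/andP[ms _] _].
  by rewrite mulr_ge0.
(* [B0] accounts for the scales before [lev J1], [k] for the doubling and [C] for the thresholds. *)
have [n nP] := vdiv (B0 + k * (C * Num.max 0 B)).
have [J2 J2P] := lev_unbounded d0 D0 hnu (maxn n (lev J1)).
pose n2 := maxn J2 J1.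
have nl : (maxn n (lev J1) < lev n2)%N by apply: J2P; exact: leq_maxl.
have J1n2 : (J1 <= n2)%N by exact: leq_maxr.
have J1l : (lev J1 <= (lev n2).-1)%N.
  by rewrite -ltnS prednK; [exact: leq_ltn_trans (leq_maxr _ _) nl|exact: leq_ltn_trans nl].
have s0n : (s0 <= (lev n2).-1)%N by exact: leq_trans s0J J1l.
have nl1 : (n <= (lev n2).-1)%N.
  by rewrite -ltnS prednK; [exact: leq_ltn_trans (leq_maxl _ _) nl|exact: leq_ltn_trans nl].
have h1 : k * (C * Num.max 0 B) <= \sum_(lev J1 <= s < (lev n2).-1) (mass s.+1 - mass s) * v s.
  have : B0 + k * (C * Num.max 0 B) <= \sum_(s0 <= s < (lev n2).-1) (mass s.+1 - mass s) * v s.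
    apply: (le_trans nP).
    have [sn|ns] := leqP s0 n; last by rewrite big_geq ?B0' // ltnW.
    by rewrite [leRHS](big_cat_nat sn nl1) /= lerDl B0'.
  by rewrite (big_cat_nat s0J J1l) /= lerD2l.
have h2 : \sum_(lev J1 <= s < (lev n2).-1) (mass s.+1 - mass s) * v s <=
    k * \sum_(lev J1 <= t < lev n2) (mass t - mass t.-1) * v t.
  have l1 : (0 < lev n2)%N by exact: leq_ltn_trans nl.
  apply: (@le_trans _ _ (k * \sum_(lev J1 <= s < (lev n2).-1) (mass s.+1 - mass s) * v s.+1)).
    rewrite mulr_sumr; apply: ler_sum_nat => s /andP[Js _].
    rewrite mulrCA; apply: ler_wpM2l => //; apply: vk; exact: leq_trans s0J Js.
  apply: ler_wpM2l => //.
  rewrite -[in leRHS](prednK l1) big_nat_recl //= ler_wpDl // mulr_ge0 //.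
  by rewrite subr_ge0 mass_homo // leq_pred.
have v0' s : (lev J1 <= s)%N -> 0 <= v s by move=> _; exact: v0.
have vm' s t : (lev J1 <= s)%N -> (s <= t)%N -> v t <= v s.
  by move=> Js; apply: vm; exact: leq_trans Js.
have := @lev_sum v J1 v0' vm' n2 J1n2.
have -> : \sum_(J1 <= j < n2) 4 * 2 ^+ (j.+1 * d) * v (lev j) =
    C * \sum_(J1 <= j < n2) 2 ^+ (j * d) * v (lev j).
  rewrite mulr_sumr; apply: eq_bigr => j _; rewrite /C !mulrA; congr (_ * _).
  by rewrite -mulrA -exprD -mulSn.
move=> h3; exists n2.
have JJ1 : (J <= J1)%N by exact: leq_maxl.
have h4 : \sum_(J1 <= j < n2) 2 ^+ (j * d) * v (lev j) <= \sum_(J <= j < n2) 2 ^+ (j * d) * v (lev j).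
  rewrite [leRHS](big_cat_nat JJ1 J1n2) /= lerDr big_nat_cond.
  by apply: sumr_ge0 => j _; rewrite mulr_ge0 ?exprn_ge0.
apply: le_trans h4.
apply: (@le_trans _ _ (Num.max 0 B)); first by rewrite le_max lexx orbT.
(* For [k = 0] the doubling hypothesis makes [v] vanish from [s0] on, against divergence; otherwise
   [k] can be cancelled. *)
have [k_eq0|k_neq0] := eqVneq k 0.
  have v00 s : (s0 <= s)%N -> v s = 0.
    by move=> /vk; rewrite k_eq0 mul0r => h; apply/eqP; rewrite eq_le h v0.
  have [n' n'P] := vdiv 1; exfalso; move: n'P; rewrite big_nat_cond big1 ?ler10 //.
  by move=> s /andP[/andP[ss _] _]; rewrite v00 // mulr0.
have k1 : 0 < k by rewrite lt_def k_neq0.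
have := le_trans h1 (le_trans h2 (ler_wpM2l k0 h3)).
by rewrite !ler_pM2l.
Qed.

Section Integral.
Variables (f : R -> \bar R) (v : nat -> R) (s0 : nat).
Local Notation unit := (`]0%R, 1%R]%classic : set R).
Hypothesis mf : measurable_fun unit f.
Hypothesis f0 : forall r, 0 < r <= 1 -> (0 <= f r)%E.
Hypothesis v0 : forall s, (s0 <= s)%N -> 0 <= v s.

Definition annulus (s : nat) : set R := (`]delta s.+1, 1%R]%classic : set R) `\` (`]delta s, 1%R]%classic : set R).

Lemma measurable_annulus s : measurable (annulus s).
Proof. by apply: measurableD; exact: measurable_itv. Qed.

Lemma annulus_mass s : nu (annulus s) = (mass s.+1 - mass s)%:E.
Proof.
have sub : (`]delta s, 1%R]%classic : set R) `<=` (`]delta s.+1, 1%R]%classic : set R).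
  move=> r /=; rewrite !in_itv /= => /andP[a ->]; rewrite andbT.
  by apply: le_lt_trans a; rewrite ler_delta // lez_nat.
have lt : (nu (`]delta s.+1, 1%R]%classic : set R) < +oo)%E by rewrite massE // ltry.
have e : (nu (annulus s) = nu (`]delta s.+1, 1%R]%classic : set R) - nu (`]delta s, 1%R]%classic : set R))%E.
  have := measureD (measurable_itv (Interval (BRight (delta s.+1)) (BRight 1)))
     (measurable_itv (Interval (BRight (delta s)) (BRight 1))) lt.
  by move=> ->; rewrite setIidr.
by rewrite e !massE // EFinB.
Qed.

Lemma annulusP s r : annulus s r <-> delta s.+1 < r <= 1 /\ r <= delta s.
Proof.
rewrite /annulus /setD /=; split; rewrite ?in_itv /=.
  move=> [/andP[a b] h]; split; first by rewrite a.
  by rewrite leNgt; apply/negP => h'; apply: h; rewrite h'.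
by move=> [-> h]; split=> //; rewrite ltNge h.
Qed.

Lemma annulus_ex r : 0 < r <= 1 -> r <= delta s0 -> exists2 s, (s0 <= s)%N & annulus s r.
Proof.
move=> /andP[r0 r1] rs; have [n nP] := delta_small D0 r0.
have exn : exists n : nat, delta n < r by exists n; exact: nP.
case: (ex_minnP exn) => m mz mmin.
have s1m : (s0 < m)%N.
  rewrite ltnNge; apply/negP => ms1; have := lt_le_trans mz rs.
  by rewrite ltNge ler_delta // lez_nat ms1.
case: m mz mmin s1m => // m mz mmin s1m; exists m; first by rewrite -ltnS.
apply/annulusP; rewrite mz r1; split=> //; rewrite leNgt; apply/negP => h.
by have := mmin _ h; rewrite ltnn.
Qed.

Lemma integral_finite (C B : R) : 0 <= C ->
  (forall r, delta s0 < r <= 1 -> (f r <= C%:E)%E) ->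
  (forall s r, (s0 <= s)%N -> annulus s r -> (f r <= (v s)%:E)%E) ->
  (forall n, \sum_(s0 <= s < n) (mass s.+1 - mass s) * v s <= B) ->
  (\int[nu]_(r in unit) f r < +oo)%E.
Proof.
move=> C0 fC fv vB.
(* Index [0] carries the radii above [delta s0], where [f] is at most [C]; the other indices carry
   the annuli. *)
pose A n : set R := if n is k.+1 then annulus (s0 + k) else (`]delta s0, 1%R]%classic : set R).
pose e n : R := if n is k.+1 then v (s0 + k)%N else C.
have mA n : measurable (A n).
  by case: n => [|k]; [exact: measurable_itv|exact: measurable_annulus].
have e0 n : 0 <= e n by case: n => [|k] //=; apply: v0; exact: leq_addr.
have mI n : measurable_fun unit (fun r : R => ((e n)%:E * (\1_(A n) r)%:E)%E).
  apply: measurable_funTS; apply: measurable_funeM; apply/measurable_EFinP.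
  exact: measurable_indic.
apply: (@le_lt_trans _ _
  (\int[nu]_(r in unit) \sum_(n <oo) ((e n)%:E * (\1_(A n) r)%:E))%E).
  apply: ge0_le_integral.
  - exact: measurable_itv.
  - by move=> r /=; rewrite in_itv /=; exact: f0.
  - exact: mf.
  - by apply: ge0_emeasurable_sum => // n r _ _; rewrite mule_ge0 ?lee_fin.
  move=> r /=; rewrite in_itv /= => r01.
  suff [n [An fe]] : exists n, A n r /\ (f r <= (e n)%:E)%E.
    apply: (le_trans fe); rewrite nneseries_esumT; last first.
      by move=> k; rewrite mule_ge0 ?lee_fin.
    rewrite -[leLHS](_ : \esum_(k in [set n]) ((e k)%:E * (\1_(A k) r)%:E) = _)%E.
      by apply: subset_le_esum => // k _; rewrite mule_ge0 ?lee_fin.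
    by rewrite esum_set1 ?mule_ge0 ?lee_fin // indicE mem_set // mule1.
  have /andP[r0 r1] := r01.
  have [rs|sr] := leP r (delta s0).
    have [s ss As] := annulus_ex r01 rs; exists (s - s0).+1.
    by rewrite /A /e subnKC //; split=> //; exact: fv.
  exists 0%N; split; first by rewrite /A /= in_itv /= sr.
  by apply: fC; rewrite sr.
rewrite integral_nneseries //; last by move=> n r _; rewrite mule_ge0 ?lee_fin.
have iE n : (\int[nu]_(r in unit) ((e n)%:E * (\1_(A n) r)%:E) <= (e n)%:E * nu (A n))%E.
  rewrite ge0_integralZl_EFin //; last first.
    by apply/measurable_EFinP; exact: measurable_indic.
  apply: lee_wpmul2l; first by rewrite lee_fin.
  rewrite integral_indic //; apply: le_measure; rewrite ?inE //.
  by apply: measurableI.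
apply: (@le_lt_trans _ _ (C * mass s0 + B)%:E); last by rewrite ltry.
apply: lime_le.
  apply: is_cvg_nneseries => n _ _; apply: integral_ge0 => r _.
  by rewrite mule_ge0 ?lee_fin.
have B0 : 0 <= B by have := vB s0; rewrite big_geq.
apply: nearW => -[|n] /=.
  by rewrite big_geq // lee_fin addr_ge0 // mulr_ge0 // mass_ge0.
rewrite big_nat_recl //= EFinD; apply: leeD.
  by apply: (le_trans (iE 0%N)); rewrite /= massE.
apply: (@le_trans _ _ (\sum_(0 <= k < n) ((mass (s0 + k).+1 - mass (s0 + k)) * v (s0 + k)%N)%:E)%E).
  apply: lee_sum => k _; apply: (le_trans (iE k.+1)).
  by rewrite /= annulus_mass -EFinM mulrC.
rewrite sumEFin lee_fin; apply: le_trans (vB (s0 + n)%N).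
rewrite -[in leRHS](add0n s0) big_addn add0n addKn.
by under [leRHS]eq_bigr => k _ do rewrite addnC.
Qed.

Lemma integral_bound :
  (forall s r, (s0 <= s)%N -> annulus s r -> ((v s.+1)%:E <= f r)%E) ->
  (\int[nu]_(r in unit) f r < +oo)%E ->
  exists B, forall n, \sum_(s0 <= s < n) (mass s.+1 - mass s) * v s.+1 <= B.
Proof.
move=> fv foo; exists (fine (\int[nu]_(r in unit) f r)) => n.
have i0 : (0 <= \int[nu]_(r in unit) f r)%E.
  by apply: integral_ge0 => r /=; rewrite in_itv /=; exact: f0.
rewrite -lee_fin fineK ?ge0_fin_numE //.
have mI s : measurable_fun unit (fun r : R => ((v s.+1)%:E * (\1_(annulus s) r)%:E)%E).
  apply: measurable_funTS; apply: measurable_funeM; apply/measurable_EFinP.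
  apply: measurable_indic; exact: measurable_annulus.
have t0 s r : (s0 <= s)%N -> (0 <= (v s.+1)%:E * (\1_(annulus s) r)%:E)%E.
  by move=> ss; rewrite mule_ge0 ?lee_fin // v0 // leqW.
have aI s : annulus s `<=` unit.
  move=> r /annulusP[/andP[a b] _]; rewrite /= in_itv /= b andbT.
  exact: lt_trans (delta_gt0 D0 _) a.
have iE s : (s0 <= s)%N -> (\int[nu]_(r in unit) ((v s.+1)%:E * (\1_(annulus s) r)%:E) =
   ((mass s.+1 - mass s) * v s.+1)%:E)%E.
  move=> ss; rewrite ge0_integralZl_EFin //.
  - rewrite integral_indic //; last exact: measurable_annulus.
    by rewrite setIidl // annulus_mass -EFinM mulrC.
  - by apply/measurable_EFinP; apply: measurable_indic; exact: measurable_annulus.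
  - by rewrite v0 // leqW.
pose g (s : nat) (r : R) := if (s0 <= s)%N then ((v s.+1)%:E * (\1_(annulus s) r)%:E)%E else 0%E.
have mg s : measurable_fun unit (g s).
  by rewrite /g; case: (s0 <= s)%N; [exact: mI|exact: measurable_cst].
have g0 s r : (0 <= g s r)%E by rewrite /g; case: ifP => // ss; exact: t0.
have -> : (\sum_(s0 <= s < n) (mass s.+1 - mass s) * v s.+1)%:E =
    (\int[nu]_(r in unit) (\sum_(s0 <= s < n) g s r))%E.
  rewrite ge0_integral_sum // -sumEFin; apply: eq_big_nat => s /andP[ss _].
  by rewrite -iE //; apply: eq_integral => r _; rewrite /g ss.
apply: ge0_le_integral.
- exact: measurable_itv.
- by move=> r _; apply: sume_ge0.
- by apply: emeasurable_sum => s.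
- exact: mf.
move=> r /=; rewrite in_itv /= => r01.
have gE s : g s r = if (s0 <= s)%N && (r \in annulus s) then (v s.+1)%:E else 0%E.
  rewrite /g indicE; case: (s0 <= s)%N => //=; case: (r \in _); first by rewrite mule1.
  by rewrite mule0.
suff [h1 h2] : (delta n < r -> (\sum_(s0 <= s < n) g s r <= f r)%E) /\
    (r <= delta n -> (\sum_(s0 <= s < n) g s r = 0)%E).
  by have [/h2 ->|/h1//] := leP r (delta n); exact: f0.
elim: n => [|n [IH1 IH2]].
  by rewrite big_geq //; split=> // _; exact: f0.
have [sn|ns] := leqP s0 n; last by rewrite big_geq //; split=> // _; exact: f0.
rewrite big_nat_recr //= gE sn /=.
have nin : ~ annulus n r -> (r \in annulus n) = false.
  by move=> h; apply/negbTE/negP; rewrite inE.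
split=> rn.
  have [rn'|rn'] := leP r (delta n).
    have an : annulus n r by apply/annulusP; split=> //; rewrite rn; case/andP: r01.
    by rewrite IH2 // add0e mem_set //; exact: fv.
  rewrite nin ?adde0; first exact: IH1.
  by move=> /annulusP[_]; rewrite leNgt rn'.
rewrite nin ?adde0; last by move=> /annulusP[/andP[h _] _]; have := le_lt_trans rn h; rewrite ltxx.
apply: IH2; apply: (le_trans rn); rewrite ler_delta // lez_nat; exact: leqnSn.
Qed.
End Integral.
End MassSums.

(** * Gauge functions *)

Section Gauges.
Context {R : realType} {d : nat}.
Implicit Types (g h : \bar R -> \bar R).

Lemma cvg0_right (f : R -> \bar R) : (forall r, 0 < r -> (0 <= f r)%E) ->
  (f @ 0^'+ --> 0%E) <->
  (forall eta : R, 0 < eta -> exists2 rho : R, 0 < rho &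
     forall r, 0 < r < rho -> (f r < eta%:E)%E).
Proof.
move=> f0; split=> [h eta eta0|h].
  have nb : nbhs (0%E : \bar R) [set x | (x < eta%:E)%E].
    by apply: open_nbhs_nbhs; split; [exact: open_ereal_lt_ereal|rewrite /= lte_fin].
  have := h _ nb; rewrite /nbhs /= /at_right /within /= -nbhs_nearE => /nbhs_ballP[rho rho0 hr].
  exists rho => // r /andP[r0 rr]; apply: hr => //=.
  by rewrite /ball /= sub0r normrN gtr0_norm.
have near_of (P : R -> Prop) (rho : R) : 0 < rho ->
    (forall r, 0 < r < rho -> P r) -> \forall r \near 0^'+, P r.
  move=> rho0 hP; apply/nbhs_ballP; exists rho => //= r.
  rewrite /ball /= sub0r normrN => rr r0; apply: hP; rewrite r0 /=.
  by rewrite gtr0_norm in rr.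
have fin (eta : R) r : 0 < r -> (f r < eta%:E)%E -> f r \is a fin_num.
  by move=> r0 fe; rewrite ge0_fin_numE ?f0 // (lt_trans fe) // ltry.
apply/fine_cvgP; split.
  have [rho rho0 hr] := h 1 ltr01.
  by apply: (near_of _ rho) => // r /[dup] /hr hr1 /andP[r0 _]; exact: fin hr1.
apply/cvgrPdist_lt => eta eta0; have [rho rho0 hr] := h _ eta0.
apply: (near_of _ rho) => // r /[dup] /hr hr1 /andP[r0 _].
have fr := fin _ _ r0 hr1; rewrite sub0r normrN ger0_norm ?fine_ge0 ?f0 //.
by rewrite -lte_fin fineK.
Qed.

(** The nonincreasing factor in [gd d g r = r ^ d * density g r]. *)
Definition density g (r : R) : \bar R :=
  ereal_inf [set (g rho%:E * (rho ^- d)%:E)%E | rho in [set rho : R | (0 < rho <= r)%R]].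

Lemma gdE g r : 0 < r -> gd d g r%:E = ((r ^+ d)%:E * density g r)%E.
Proof. by move=> r0; rewrite /gd leNgt r0. Qed.

Lemma gd_zero g : gd d g 0%E = 0%E.
Proof. by rewrite /gd /= lexx. Qed.

Lemma gdK g r : 0 < r -> (gd d g r%:E * (r ^- d)%:E)%E = density g r.
Proof.
move=> r0; rewrite gdE // muleC muleA -EFinM mulVf ?mul1e //.
by rewrite expf_neq0 // gt_eqF.
Qed.

Lemma density_noninc g r s : r <= s -> (density g s <= density g r)%E.
Proof.
move=> rs; apply: le_ereal_inf_tmp => _ [rho /andP[a b] <-].
by apply: ereal_inf_lbound; exists rho => //=; rewrite a (le_trans b).
Qed.

Lemma density_ge0 g r : (forall x : \bar R, (0 <= x)%E -> (0 <= g x)%E) ->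
  (0 <= density g r)%E.
Proof.
move=> g0; apply: le_ereal_inf_tmp => _ [rho /andP[a b] <-].
by apply: mule_ge0; [apply: g0; rewrite lee_fin ltW|rewrite lee_fin invr_ge0 exprn_ge0 // ltW].
Qed.

Lemma gd_ge0 g x : (forall x : \bar R, (0 <= x)%E -> (0 <= g x)%E) -> (0 <= gd d g x)%E.
Proof.
move=> g0; case: x => [r| |] //=; case: ifPn => // /negbTE r0.
by rewrite mule_ge0 ?density_ge0 // lee_fin exprn_ge0 // ltW // ltNge r0.
Qed.

Lemma gd_le_at g (rho r : R) : 0 < rho <= r ->
  (gd d g r%:E <= g rho%:E * ((r / rho) ^+ d)%:E)%E.
Proof.
move=> /andP[a b]; have r0 := lt_le_trans a b.
rewrite gdE // expr_div_n EFinM muleCA; apply: lee_wpmul2l.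
  by rewrite lee_fin exprn_ge0 // ltW.
by apply: ereal_inf_lbound; exists rho => //=; rewrite a.
Qed.

Lemma gd_le g (r : R) : 0 < r -> (gd d g r%:E <= g r%:E)%E.
Proof.
move=> r0; have := @gd_le_at g r r; rewrite r0 lexx => /(_ isT).
by rewrite divff ?gt_eqF // expr1n mule1.
Qed.

(** When [h r / r ^ d] is nonincreasing, the infimum defining [gd] is attained at [r] itself. *)
Lemma ratio_normalized h (e : R) : h 0%E = 0%E ->
  (forall r s : R, 0 < r -> r <= s -> s <= e ->
     (h s%:E * (s ^- d)%:E <= h r%:E * (r ^- d)%:E)%E) ->
  forall r : R, 0 <= r -> r <= e -> h r%:E = gd d h r%:E.
Proof.
move=> h0 hm r; rewrite le_eqVlt => /orP[/eqP <-|r0] re; first by rewrite /gd lexx h0.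
apply/eqP; rewrite eq_le gd_le // andbT gdE //.
have -> : h r%:E = ((r ^+ d)%:E * (h r%:E * (r ^- d)%:E))%E.
  by rewrite muleCA -EFinM mulfV ?mule1 // expf_neq0 // gt_eqF.
apply: lee_wpmul2l; first by rewrite lee_fin exprn_ge0 // ltW.
by apply: le_ereal_inf_tmp => _ [rho /andP[a b] <-]; exact: hm.
Qed.

Lemma gauge_small g (eta : R) : gauge g -> 0 < eta ->
  exists2 rho : R, 0 < rho & forall r, 0 < r < rho -> (g r%:E < eta%:E)%E.
Proof.
move=> [g0 [_ [_ [gl _]]]]; apply/(cvg0_right _).1 => // r r0.
by apply: g0; rewrite lee_fin ltW.
Qed.

(** Monotonicity compares [g_d r] with each competitor [rho] for [g_d s]: if [rho <= r] it also
    competes for [r]; otherwise [g_d r <= g r <= g rho] by monotonicity of [g], and the factor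
    [(s / rho) ^ d] is at least [1]. *)
Lemma gauge_gd g : gauge g -> gauge (gd d g).
Proof.
move=> gg; have [g0 [[e e0 ge] [_ _]]] := gg.
split; first by move=> x _; exact: gd_ge0.
split.
  exists e => // r s r0 rs se; move: r0; rewrite le_eqVlt => /orP[/eqP <-|r0].
    by rewrite gd_zero; exact: gd_ge0.
  have s0 := lt_le_trans r0 rs.
  rewrite [leRHS]gdE //; rewrite -lee_pdivrMl ?exprn_gt0 //.
  apply: le_ereal_inf_tmp => _ [rho /andP[a b] <-].
  rewrite lee_pdivrMl ?exprn_gt0 // muleCA -EFinM -expr_div_n.
  have [rr|rr] := leP rho r.
    apply: (@le_trans _ _ (g rho%:E * ((r / rho) ^+ d)%:E)%E).
      by apply: gd_le_at; rewrite a.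
    apply: lee_wpmul2l; first by rewrite g0 // lee_fin ltW.
    by rewrite lee_fin lerXn2r ?nnegrE ?divr_ge0 ?ler_pM2r ?invr_gt0 // ltW.
  apply: (le_trans (gd_le _ r0)); apply: (@le_trans _ _ (g rho%:E)).
    by apply: ge; [exact: ltW|exact: ltW|exact: le_trans b se].
  rewrite -[leLHS]mule1; apply: lee_wpmul2l; first by rewrite g0 // lee_fin ltW.
  by rewrite lee_fin exprn_ege1 // ler_pdivlMr // mul1r.
split; first exact: gd_zero.
split=> //; apply/cvg0_right => [r r0|eta eta0]; first exact: gd_ge0.
have [rho rho0 h] := gauge_small gg eta0.
exists rho => // r rr; apply: le_lt_trans (h _ rr).
by apply: gd_le; case/andP: rr.
Qed.

Lemma gd_normalized g : d_normalized d (gd d g).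
Proof.
exists 1 => // r r0 r1; apply: (@ratio_normalized _ 1) => // [|a b a0 ab _].
  exact: gd_zero.
by rewrite !gdK //; [exact: density_noninc|exact: lt_le_trans ab].
Qed.

Definition regular (e : R) (G : R -> R) : Prop :=
  [/\ 0 < e,
      forall r s, 0 < r -> r <= s -> s <= e -> G r <= G s,
      forall r s, 0 < r -> r <= s -> s <= e -> G s * r ^+ d <= G r * s ^+ d &
      forall eta, 0 < eta -> exists2 rho : R, 0 < rho & forall r, 0 < r < rho -> G r < eta].

(** Near [0] the gauge is finite and can be handled as a real function. The last conclusion makes
    all cubes of diameter below [e] admissible in [Minf]. *)
Lemma gauge_regular h : gauge h -> d_normalized d h ->
  exists e : R, [/\ regular e (fun r => fine (h r%:E)),
    forall r, 0 < r <= e -> h r%:E = (fine (h r%:E))%:E,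
    forall r, 0 < r <= e -> 0 <= fine (h r%:E) & (e%:E <= eps_h d h)%E].
Proof.
move=> gh [e1 e10 nh]; have [h0 [[e2 e20 hm] [h00 _]]] := gh.
have [e3 e30 hs] := gauge_small gh ltr01.
pose e := Num.min (Num.min e1 e2) (e3 / 2).
have e0 : 0 < e by rewrite !lt_min e10 e20 divr_gt0.
have ee1 : e <= e1 by rewrite !ge_min lexx.
have ee2 : e <= e2 by rewrite !ge_min lexx orbT.
have ee3 : e < e3.
  by apply: (@le_lt_trans _ _ (e3 / 2)); [rewrite ge_min lexx orbT|lra].
have hfin r : 0 < r <= e -> h r%:E \is a fin_num.
  move=> /andP[r0 re]; rewrite ge0_fin_numE ?h0 ?lee_fin 1?ltW //.
  by apply: lt_trans (ltry 1); apply: hs; rewrite r0 (le_lt_trans re).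
have hK r : 0 < r <= e -> h r%:E = (fine (h r%:E))%:E by move=> re; rewrite fineK ?hfin.
have hr r s : 0 < r -> r <= s -> s <= e ->
    (h s%:E * (s ^- d)%:E <= h r%:E * (r ^- d)%:E)%E.
  move=> r0 rs se; have s0 := lt_le_trans r0 rs.
  have se1 := le_trans se ee1; have re1 := le_trans rs se1.
  rewrite (nh r (ltW r0) re1) (nh s (ltW s0) se1).
  by rewrite !gdK //; exact: density_noninc.
exists e; split=> //.
- split=> // [r s r0 rs se|r s r0 rs se|eta eta0].
  + have s0 := lt_le_trans r0 rs.
    rewrite -lee_fin -!hK ?r0 ?s0 //; last exact: le_trans se.
    by apply: hm => //; [exact: ltW|exact: le_trans se ee2].
  + have s0 := lt_le_trans r0 rs; have := hr _ _ r0 rs se.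
    have re := le_trans rs se.
    rewrite [h s%:E]hK ?s0 // [h r%:E]hK ?r0 // -!EFinM lee_fin.
    by rewrite ler_pdivrMr ?exprn_gt0 // mulrAC ler_pdivlMr ?exprn_gt0.
  + have [rho rho0 hrho] := gauge_small gh eta0; exists rho => // r rr.
    have := hrho _ rr; have := h0 r%:E; rewrite lee_fin.
    case/andP: rr => r0 _; rewrite ltW // => /(_ isT).
    by case: (h r%:E) => // y _; rewrite lte_fin.
- by move=> r /andP[r0 _]; rewrite fine_ge0 // h0 // lee_fin ltW.
- apply: ereal_sup_ubound; exists e => //=; split=> //; split=> // r s r0 rs se.
  by apply: hm => //; exact: le_trans se ee2.
Qed.

End Gauges.

(** * Concave profiles preserving convergence or divergence *)

Section Profiles.
Context {R : realType}.

(** An infimum of affine functions is concave. For nonnegative coefficients it is nondecreasing and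
    its ratio to [t] is nonincreasing, so that composition with it respects the two monotonicity
    conditions of normalised gauges. *)
Definition envelope (b c : nat -> R) (t : R) : R := inf [set b k + c k * t | k in setT].

Section Envelope.
Variables b c : nat -> R.
Hypotheses (b0 : forall k, 0 <= b k) (c0 : forall k, 0 <= c k).
Local Notation env := (envelope b c).

Lemma envelope_le k t : 0 <= t -> env t <= b k + c k * t.
Proof.
move=> t0; apply: ge_inf; last by exists k.
by exists 0 => _ [i _ <-]; rewrite addr_ge0 // mulr_ge0.
Qed.

Lemma envelope_ge t x : (forall k, x <= b k + c k * t) -> x <= env t.
Proof.
move=> h; apply: lb_le_inf; first by exists (b 0%N + c 0%N * t), 0%N.
by move=> _ [k _ <-].
Qed.

Lemma envelope_mono s t : 0 <= s -> s <= t -> env s <= env t.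
Proof.
move=> s0 st; apply: envelope_ge => k; apply: (le_trans (envelope_le k s0)).
by rewrite lerD2l ler_wpM2l.
Qed.

Lemma envelope_ratio s t : 0 < s -> s <= t -> s * env t <= t * env s.
Proof.
move=> s0 st; have t0 := lt_le_trans s0 st.
rewrite -ler_pdivrMl // mulrA; apply: envelope_ge => k.
apply: (@le_trans _ _ (t^-1 * s * (b k + c k * t))).
  by rewrite ler_wpM2l ?envelope_le ?mulr_ge0 ?invr_ge0 // ltW.
rewrite mulrDr; apply: lerD.
  by rewrite ler_piMl // mulrC ler_pdivrMr // mul1r.
by rewrite -mulrA (mulrC (c k)) mulrA mulrA -[_ * _ * t]mulrA (mulrC s) mulrA mulVf ?gt_eqF // mul1r mulrC.
Qed.
End Envelope.

(** Slopes [k + 1] tend to infinity and intercepts to [0], so [psi t / t] tends to infinity while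
    [psi t] tends to [0]. Block [k] starts where the tail of the sum is at most [4 ^ (-k)]; on it
    the line of index [k] bounds the new sum by [2 * 2 ^ (-k)]. *)
Lemma convergent_profile (a v : nat -> R) (s0 : nat) (B : R) :
  (forall s, 0 <= a s) -> (forall s, 0 <= v s) ->
  (forall n, \sum_(s0 <= s < n) a s * v s <= B) ->
  exists psi : R -> R,
  [/\ forall t, 0 <= t -> t <= psi t,
      forall s t, 0 <= s -> s <= t -> psi s <= psi t,
      forall s t, 0 < s -> s <= t -> s * psi t <= t * psi s,
      (forall M, exists2 eta, 0 < eta & forall t, 0 < t < eta -> M * t < psi t) /\
      (forall eta, 0 < eta -> exists2 rho, 0 < rho & forall t, 0 < t < rho -> psi t < eta) &
      exists B', forall n, \sum_(s0 <= s < n) a s * psi (v s) <= B'].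
Proof.
move=> a0 v0 hB.
have av0 s : (s0 <= s)%N -> 0 <= a s * v s by move=> _; exact: mulr_ge0.
have q0 k : 0 < (4^-1) ^+ k :> R by rewrite exprn_gt0 // invr_gt0.
have ex (p : nat * nat) : exists s1, [/\ (s0 <= s1)%N, (p.2 <= s1)%N &
    forall n, \sum_(s1 <= s < n) a s * v s <= 4^-1 ^+ p.1].
  exact: tail_small av0 hB (q0 _).
have [f fP] := choice ex.
pose t := fix t k := if k is k'.+1 then f (k, (t k').+1) else f (0%N, 0%N).
have tail k n : \sum_(t k <= s < n) a s * v s <= 4^-1 ^+ k.
  by case: k => [|k]; [case: (fP (0%N, 0%N))|case: (fP (k.+1, (t k).+1))].
have tS k : (t k < t k.+1)%N by case: (fP (k.+1, (t k).+1)).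
have st0 : (s0 <= t 0%N)%N by case: (fP (0%N, 0%N)).
have tk k : (k <= t k)%N by elim: k => // k IH; exact: leq_ltn_trans IH (tS k).
have t0k k : (t 0%N <= t k)%N by elim: k => // k IH; apply: leq_trans IH (ltnW (tS k)).
(* The denominator controls the sum of [a] over block [k], for which no bound is given. *)
pose b k := 2^-1 ^+ k / (1 + \sum_(0 <= s < t k.+1) a s) : R.
have A0 k : 0 < 1 + \sum_(0 <= s < t k.+1) a s :> R by rewrite ltr_pwDl // sumr_ge0.
have h0 k : 0 < (2^-1) ^+ k :> R by rewrite exprn_gt0 // invr_gt0.
have b0 k : 0 < b k by rewrite divr_gt0.
have b0' k : 0 <= b k by exact: ltW.
have bl k : b k <= 2^-1 ^+ k.
  by rewrite ler_pdivrMr // ler_peMr ?lerDl ?sumr_ge0 // ltW.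
pose c k : R := k.+1%:R; have c0 k : 0 <= c k by [].
pose psi := envelope b c; exists psi; split.
- move=> x x0; apply: envelope_ge => k.
  by rewrite ler_wpDl // ler_peMl // ler1n.
- exact: envelope_mono.
- exact: envelope_ratio.
- split=> [M|eta eta0].
    have bS k : b k.+1 <= b k.
      rewrite /b; apply: ler_pM; [exact: ltW|by rewrite invr_ge0 ltW| |].
        by rewrite exprS; have := h0 k; lra.
      rewrite lef_pV2 ?posrE // lerD2l.
      by rewrite [leRHS](big_cat_nat (leq0n _) (ltnW (tS k.+1))) /= lerDl sumr_ge0.
    have bm i j : (i <= j)%N -> b j <= b i.
      by elim: j => [|j IH]; [rewrite leqn0 => /eqP ->|
        rewrite leq_eqVlt => /orP[/eqP ->//|]; rewrite ltnS => /IH; exact: le_trans].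
    have [n nM] := pow2_unbounded (M + 1); pose m := (2 ^ n)%N.
    have K0 : 0 < `|M| + 2 by have := normr_ge0 M; lra.
    (* Below this threshold the lines with [k <= m] exceed [M * x] by their intercept, the others by
       their slope. *)
    exists (b m / (`|M| + 2)); first by rewrite divr_gt0.
    move=> x /andP[x0]; rewrite ltr_pdivlMr // => xb.
    apply: (@lt_le_trans _ _ ((M + 1) * x)); first by rewrite ltr_pM2r // ltrDl.
    apply: envelope_ge => k; have [km|mk] := leqP k m.
      apply: ler_wpDr; first by rewrite mulr_ge0 // ltW.
      apply: le_trans (bm _ _ km); apply: le_trans (ltW xb).
      by rewrite mulrC ler_pM2l //; have := ler_norm M; lra.
    apply: ler_wpDl => //; rewrite ler_pM2r //; apply: (le_trans nM).
    rewrite -[leLHS](natrX R 2 n) ler_nat; exact: leq_trans (ltnW mk) (leqnSn _).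
  have [k kP] : exists k, (2^-1 : R) ^+ k < eta / 2.
    by apply: expr_small; [lra|rewrite divr_gt0].
  exists (eta / 2 / k.+1%:R); first by rewrite !divr_gt0.
  move=> x /andP[x0]; rewrite ltr_pdivlMr // => xb.
  apply: (le_lt_trans (envelope_le b0' c0 k (ltW x0))).
  have := bl k; rewrite (mulrC (c k)); rewrite -/(c k) in xb; lra.
- have p0 s : 0 <= a s * psi (v s).
    by rewrite mulr_ge0 //; apply: envelope_ge => k; rewrite addr_ge0 // mulr_ge0.
  have pm m n : 0 <= \sum_(m <= s < n) a s * psi (v s) by exact: sumr_ge0.
  exists (\sum_(s0 <= s < t 0%N) a s * psi (v s) + 4) => n.
  have block k : \sum_(t k <= s < t k.+1) a s * psi (v s) <= 2 * 2^-1 ^+ k.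
    apply: (@le_trans _ _ (\sum_(t k <= s < t k.+1) (b k * a s + c k * (a s * v s)))).
      apply: ler_sum => s _; rewrite (mulrC (b k)) (mulrCA (c k)) -(mulrDr (a s)) ler_wpM2l //.
      exact: envelope_le.
    rewrite big_split /= -!mulr_sumr mulrDl mul1r; apply: lerD.
      rewrite /b -mulrA ler_piMr ?(ltW (h0 k)) // ler_pdivrMl // mulr1 ler_wpDl //.
      by rewrite [leRHS](big_cat_nat (leq0n _) (ltnW (tS k))) /= lerDr sumr_ge0.
    apply: (@le_trans _ _ (2 ^+ k * 4^-1 ^+ k)).
      apply: ler_pM => //; first by rewrite sumr_ge0 // => s _; rewrite mulr_ge0.
      by rewrite -(natrX R 2 k) ler_nat ltn_expl.
    by rewrite -exprMn; have -> : 2 * 4^-1 = 2^-1 :> R by lra.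
  have blocks k : \sum_(t 0%N <= s < t k) a s * psi (v s) <= 4 - 4 * 2^-1 ^+ k.
    elim: k => [|k IH]; first by rewrite big_geq // expr0; lra.
    rewrite (big_cat_nat (t0k k) (ltnW (tS k))) /=.
    have := block k; rewrite exprS; move: IH; set x := 2^-1 ^+ k; lra.
  apply: (@le_trans _ _ (\sum_(s0 <= s < t n) a s * psi (v s))).
    have [sn|ns] := leqP s0 n; last by rewrite big_geq ?pm // ltnW.
    by rewrite [leRHS](big_cat_nat sn (tk n)) /= lerDl.
  rewrite (big_cat_nat st0 (t0k n)) /= lerD2l; apply: (le_trans (blocks n)).
  by have := h0 n; lra.
Qed.

(** Slopes [1 / (k + 1)] tend to [0], so [chi t] is negligible against [t] at infinity. On block [k]
    the sum of [a] is at least [k + 1], and intercepts of larger index exceed every [x j] of the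
    block: lines up to [k] have slope at least [1 / (k + 1)], later ones lie above [x j]. Hence each
    block still contributes at least [1]. *)
Lemma divergent_profile (a x : nat -> R) :
  (forall j, 0 <= a j) -> (forall j, 0 <= x j) ->
  (forall J B, exists n, B <= \sum_(J <= j < n) a j) ->
  exists chi : R -> R,
  [/\ forall t, 0 < t -> 0 < chi t,
      forall s t, 0 <= s -> s <= t -> chi s <= chi t,
      forall s t, 0 < s -> s <= t -> s * chi t <= t * chi s,
      forall M, 0 <= M -> exists2 X, 0 < X & forall t, X <= t -> M * chi t <= t &
      forall (y : nat -> R), (forall j, 0 <= y j) ->
        (forall j, x j * y j = a j) ->
        forall J B, exists n, B <= \sum_(J <= j < n) chi (x j) * y j].
Proof.
move=> a0 x0 adiv.
have ex (p : nat * nat) : exists n, p.2.+1%:R <= \sum_(p.1 <= j < n) a j by exact: adiv.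
have [f fP] := choice ex.
pose t := fix t k := if k is k'.+1 then f (t k', k') else 0%N.
have tP k : k.+1%:R <= \sum_(t k <= j < t k.+1) a j by exact: (fP (t k, k)).
have tS k : (t k < t k.+1)%N.
  by rewrite ltnNge; apply/negP => h; have := tP k; rewrite big_geq // lern0.
have tm i j : (i <= j)%N -> (t i <= t j)%N.
  by elim: j => [|j IH]; [rewrite leqn0 => /eqP ->|
    rewrite leq_eqVlt => /orP[/eqP ->//|]; rewrite ltnS => /IH h; apply: leq_trans h (ltnW (tS _))].
have tk k : (k <= t k)%N by elim: k => // k IH; exact: leq_ltn_trans IH (tS k).
pose b k : R := if k is 0 then 0 else 1 + \sum_(0 <= j < t k) x j.
pose c k : R := k.+1%:R^-1.
have b0 k : 0 <= b k by case: k => //= k; rewrite addr_ge0 ?sumr_ge0.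
have c0 k : 0 < c k by rewrite invr_gt0.
have c0' k : 0 <= c k by exact: ltW.
pose chi := envelope b c; exists chi; split.
- move=> s s0; apply: (@lt_le_trans _ _ (Num.min s 1)); first by rewrite lt_min s0 ltr01.
  apply: envelope_ge => -[|k] /=; first by rewrite add0r /c invr1 mul1r ge_min lexx.
  by rewrite ge_min; apply/orP; right; rewrite -addrA lerDl addr_ge0 ?sumr_ge0 // mulr_ge0 // ltW.
- exact: envelope_mono.
- exact: envelope_ratio.
- move=> M M0; have [n nM] := pow2_unbounded (2 * M); pose m := (2 ^ n)%N.
  exists (2 * M * b m + 1); first by rewrite ltr_wpDl // !mulr_ge0.
  move=> s sX; have s0 : 0 <= s by apply: le_trans sX; rewrite addr_ge0 // !mulr_ge0.
  apply: (@le_trans _ _ (M * (b m + c m * s))); first by rewrite ler_wpM2l // envelope_le.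
  have Mc : M * c m <= 2^-1.
    rewrite /c ler_pdivrMr //; have : 2 * M <= m.+1%:R.
      by apply: (le_trans nM); rewrite -[leLHS](natrX R 2 n) ler_nat leqnSn.
    lra.
  have := ler_wpM2r s0 Mc; rewrite mulrDr mulrA; lra.
- move=> y y0 xy J B.
  have block k : 1 <= \sum_(t k <= j < t k.+1) chi (x j) * y j.
    apply: (@le_trans _ _ (\sum_(t k <= j < t k.+1) c k * a j)).
      by rewrite -mulr_sumr /c ler_pdivlMl // mulr1.
    apply: ler_sum_nat => j /andP[kj jk]; rewrite -xy mulrA ler_wpM2r //.
    apply: envelope_ge => i; have [ik|ki] := leqP i k.
      apply: ler_wpDl => //; rewrite ler_wpM2r // /c lef_pV2 ?posrE // ler_nat ltnS //.
    apply: ler_wpDr; first by rewrite mulr_ge0.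
    apply: (@le_trans _ _ (x j)).
      by rewrite ler_piMl // /c invf_le1 ?ltr0Sn // ler1n.
    case: i ki => // i ki; rewrite /b ler_wpDl //.
    have ji : (j < t i.+1)%N by apply: leq_trans jk (tm _ _ ki).
    rewrite (bigD1_seq j) ?iota_uniq ?mem_index_iota //= lerDl sumr_ge0 //.
  have nn j : 0 <= chi (x j) * y j.
    by rewrite mulr_ge0 //; apply: envelope_ge => k; rewrite addr_ge0 // mulr_ge0.
  have blocks n : n%:R <= \sum_(t J <= j < t (J + n)%N) chi (x j) * y j.
    elim: n => [|n IH]; first by rewrite sumr_ge0.
    rewrite addnS (big_cat_nat (tm _ _ (leq_addr n J)) (ltnW (tS _))) /= -natr1.
    exact: lerD.
  have [n nB] := pow2_unbounded B; exists (t (J + 2 ^ n)%N).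
  apply: (le_trans nB); rewrite -[leLHS](natrX R 2 n); apply: (le_trans (blocks _)).
  by rewrite [leRHS](big_cat_nat (tk J) (tm _ _ (leq_addr _ _))) /= lerDr sumr_ge0.
Qed.
End Profiles.

(** * Cheap coverings for a gauge and for its normalization *)

Section GaugeCovers.
Context {R : realType} {d : nat}.
Local Notation I := (@cidx d).
Local Notation V := 'rV[R]_d.
Local Notation cube := (@cube R d).
Implicit Types (g h : \bar R -> \bar R).

Lemma int_above (n : nat) (j : int) : exists k : nat, n%:Z <= j + k%:Z.
Proof. by exists `|n%:Z - j|%N; lia. Qed.

Lemma esum_range_le (T : choiceType) (L : finType) (F : L -> T) (w : T -> \bar R) (k : R) :
  0 <= k -> (forall l, (w (F l) <= k%:E)%E) ->
  (\esum_(t in range F) w t <= (k * #|L|%:R)%:E)%E.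
Proof.
move=> k0 wk; apply: (@le_trans _ _ (\esum_(t in range F) k%:E)).
  by apply: le_esum => _ [l _ <-].
apply: esum_cst_le => // r ur rF; rewrite ler_nat -(size_codom F).
by apply: uniq_leq_size => // c /rF[l _ <-]; exact: codom_f.
Qed.

Lemma ginf_large g (M : R) : G_infty d g ->
  exists2 eta : R, 0 < eta & forall r, 0 < r < eta -> (M%:E <= density (d := d) g r)%E.
Proof.
move=> [_ gl]; have : (M%:E < ell d g)%E by rewrite gl ltry.
move=> /ereal_sup_gt[_ [e /= e0 <-]] Me; exists e => // r /andP[r0 re].
apply: (le_trans (ltW Me)); apply: le_ereal_inf_tmp => _ [rho /andP[a b] <-].
by apply: ereal_inf_lbound; exists rho => //=; rewrite a (le_lt_trans b).
Qed.

Lemma ginf_regular g : G_infty d g -> exists e : R,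
  [/\ regular (d := d) e (fun r => fine (gd d g r%:E)), e <= 1,
    forall r, 0 < r <= e -> gd d g r%:E = (fine (gd d g r%:E))%:E &
    forall r, 0 < r <= e -> 0 < fine (gd d g r%:E)].
Proof.
move=> gi; have [gg _] := gi.
have [e1 [reg fin _ _]] := gauge_regular (gauge_gd (d := d) gg) (@gd_normalized R d g).
have [eta eta0 h] := ginf_large 1 gi.
have [e10 m r s] := reg.
pose e := Num.min e1 (Num.min 1 (eta / 2)).
have e0 : 0 < e by rewrite !lt_min e10 ltr01 divr_gt0.
have ee1 : e <= e1 by rewrite ge_min lexx.
exists e; split.
- split=> // a b a0 ab be; [apply: m => //|apply: r => //]; exact: le_trans be ee1.
- by rewrite !ge_min lexx !orbT.
- by move=> a /andP[a0 ae]; apply: fin; rewrite a0 (le_trans ae).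
move=> a /andP[a0 ae]; rewrite -lte_fin -fin ?a0 ?(le_trans ae) //.
rewrite gdE //; apply: (@lt_le_trans _ _ ((a ^+ d)%:E * 1%:E)%E).
  by rewrite mule1 lte_fin exprn_gt0.
apply: lee_wpmul2l; first by rewrite lee_fin exprn_ge0 // ltW.
apply: h; rewrite a0 (le_lt_trans ae) // (@le_lt_trans _ _ (eta / 2)) //; last by lra.
by rewrite !ge_min lexx !orbT.
Qed.

Section Metric.
Variables (N : V -> R) (D : R).
Hypotheses (d0 : (0 < d)%N) (nN : is_norm N) (D0 : 0 < D).
Local Notation delta := (delta D).

(* A cube of diameter [r] may be subdivided down to a scale [rho] almost
   achieving the infimum which defines [g_d r]. *)
Lemma tiny_gd_gauge g (E : set V) : G_infty d g ->
  (forall t0 : int, tiny (fun j => gd d g (delta j)%:E) t0 E) ->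
  forall t0 : int, tiny (fun j => g (delta j)%:E) t0 E.
Proof.
move=> gi hE t0 e e0.
have [[g0 [[e2 e20 gm] _]] _] := gi.
have [e1 [[e10 _ _ _] _ fin pos]] := ginf_regular gi.
have e120 : 0 < Num.min e1 e2 by rewrite lt_min e10.
have [n0 n0P] := delta_small D0 e120.
set G := fun r => fine (gd d g r%:E) in fin pos *.
have key (j : int) : exists p : nat * R, n0%:Z <= j ->
    [/\ g (delta (j + p.1%:Z))%:E = p.2%:E, 0 <= p.2 &
      p.2 * (2 ^ (p.1 * d))%N%:R <= 2 ^+ d.+1 * G (delta j)].
  have [n0j|_] := boolP (n0%:Z <= j); last by exists (0%N, 0).
  have r0 := @delta_gt0 R D D0 j; set r := delta j in r0 *.
  have := n0P _ n0j; rewrite lt_min => /andP[/ltW re1 /ltW re2].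
  have G0 : 0 < G r by rewrite pos // r0.
  have dens : density (d := d) g r = (r ^- d * G r)%:E.
    by rewrite -gdK // fin ?r0 // -EFinM mulrC.
  have rd0 : 0 < r ^+ d by rewrite exprn_gt0.
  have k0 : 0 < r ^- d * G r by rewrite mulr_gt0 // invr_gt0.
  have dfin : density (d := d) g r \is a fin_num by rewrite dens.
  (* The infimum is positive and serves as its own margin: [rho] achieves it up to a factor [2]. *)
  have [_ [rho /andP[rho0 rhor] <-]] := lb_ereal_inf_adherent k0 dfin.
  rewrite -/(density g r) dens -EFinD => hrho.
  have rhod : 0 < rho ^+ d by rewrite exprn_gt0.
  have gfin : g rho%:E \is a fin_num.
    have : (0 <= g rho%:E)%E by rewrite g0 // lee_fin ltW.
    case: (g rho%:E) hrho => // ; rewrite mulyr gtr0_sg ?invr_gt0 // mul1e.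
    by rewrite ltNge leey.
  have hr : fine (g rho%:E) * r ^+ d <= 2 * G r * rho ^+ d.
    rewrite -(fineK gfin) -EFinM lte_fin -[X in _ < X + X]mul1r -mulrDl in hrho.
    have := ltW hrho; rewrite ler_pdivrMr //.
    have -> : (1 + 1) * (r ^- d * G r) * rho ^+ d = (2 * G r * rho ^+ d) / r ^+ d by ring.
    by rewrite ler_pdivlMr.
  (* The first scale not above [rho] is at least [rho / 2]; this costs [2 ^ d], and with the factor
     [2] lost on the infimum gives [2 ^ d.+1]. *)
  have exm : exists m : nat, delta (j + m%:Z) <= rho.
    have [n nP] := delta_small D0 rho0; have [k nk] := int_above n j.
    by exists k; apply: ltW; exact: nP.
  case: (ex_minnP exm) => m mrho mmin.
  have dm : delta (j + m%:Z) * 2 ^+ m = r.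
    rewrite /r /delta opprD pow2D [2 ^+ m]exprnP; have := pow2V (R := R) m%:Z.
    move: (2 ^ (- m%:Z)) (2 ^ m%:Z) (2 ^ (- j)) => a b c ab.
    by rewrite -[c * D]mulr1 -ab; ring.
  have dm0 := @delta_gt0 R D D0 (j + m%:Z).
  have rho2 : rho <= 2 * delta (j + m%:Z).
    case: m mrho mmin dm dm0 => [|m] mrho mmin dm dm0.
      by move: rhor; rewrite -dm expr0 mulr1; lra.
    have -> : j + m.+1%:Z = j + m%:Z + 1 by rewrite intS [1 + _]addrC addrA.
    rewrite -deltaS // leNgt; apply/negP => /ltW /mmin.
    by rewrite ltnn.
  have gfin' : (g (delta (j + m%:Z))%:E <= g rho%:E)%E.
    by apply: gm => //; [exact: ltW|exact: le_trans rhor re2].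
  have gd0 : (0 <= g (delta (j + m%:Z))%:E)%E by rewrite g0 // lee_fin ltW.
  have gf : g (delta (j + m%:Z))%:E \is a fin_num.
    by rewrite ge0_fin_numE // (le_lt_trans gfin') // -ge0_fin_numE // (le_trans gd0).
  have gle : fine (g (delta (j + m%:Z))%:E) <= fine (g rho%:E) by rewrite fine_le.
  exists (m, fine (g (delta (j + m%:Z))%:E)) => _ /=; split.
  - by rewrite fineK.
  - exact: fine_ge0.
  rewrite natrX exprM; move: dm0 dm rho2 gle; set q := delta (j + m%:Z) => q0 dm rho2 gle; clearbody q.
  have qd : 0 < q ^+ d by rewrite exprn_gt0.
  rewrite -(ler_pM2r qd) -mulrA -exprMn [2 ^+ m * _]mulrC dm.
  apply: (@le_trans _ _ (fine (g rho%:E) * r ^+ d)).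
    by rewrite ler_wpM2r ?(ltW rd0).
  apply: (le_trans hr).
  have -> : 2 ^+ d.+1 * G r * q ^+ d = 2 * G r * (2 * q) ^+ d.
    by rewrite exprMn [2 ^+ d.+1]exprS; move: (G r) (q ^+ d) (2 ^+ d) => x y z; ring.
  rewrite ler_wpM2l ?mulr_ge0 ?(ltW G0) // lerXn2r ?nnegrE ?(ltW rho0) //.
  by rewrite mulr_ge0 // ltW.
have [f fP] := choice key.
have C0 : 0 < 2 ^+ d.+1 :> R by rewrite exprn_gt0.
have [A [At cA sA]] := hE (Num.max t0 n0%:Z) (e / 2 ^+ d.+1) (divr_gt0 e0 C0).
pose L (C : I) := {ffun 'I_d -> 'I_(2 ^ (f C.1).1)}.
pose F (C : I) : set I := range (fun l : L C => kid C l).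
exists (\bigcup_(C in A) F C); split.
- move=> _ [C AC [l _ <-]] /=; have := At _ AC; rewrite ge_max => /andP[h _].
  by rewrite (le_trans h) // lerDl.
- move=> x /cA[C AC Cx].
  pose c' := cof (C.1 + (f C.1).1%:Z) x.
  have sC : @sub R d c' C by apply: cof_sub => //; rewrite lerDl.
  have [l lE] := kidP (erefl : c'.1 = C.1 + (f C.1).1%:Z) sC.
  exists c'; last exact: cube_cof.
  by exists C => //; exists l.
apply: (@le_trans _ _ (\esum_(C in A) \esum_(c in F C) g (delta c.1)%:E)%E).
  apply: le_esum_cover => // C c _ _; apply: g0; rewrite lee_fin ltW //.
  exact: delta_gt0.
apply: (@le_trans _ _ (\esum_(C in A) ((2 ^+ d.+1)%:E * gd d g (delta C.1)%:E))%E).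
  apply: le_esum => C AC; have := At _ AC; rewrite ge_max => /andP[_ nC].
  have [h1 h2 h3] := fP _ nC.
  have := n0P _ nC; rewrite lt_min => /andP[/ltW re1 _].
  rewrite fin ?delta_gt0 // -EFinM.
  apply: (@le_trans _ _ ((f C.1).2 * #|L C|%:R)%:E).
    by apply: esum_range_le => // l; rewrite /= h1.
  by rewrite lee_fin card_kid.
rewrite esumZ // => [|C _]; last exact: gd_ge0.
rewrite -lee_pdivlMl //; apply: (le_trans sA).
by rewrite -EFinM mulrC.
Qed.

Lemma diam_ge0 (C : set V) : (0 <= diamN N C)%E.
Proof.
rewrite /diamN; case: ifPn => // /set0P[x Cx].
apply: ereal_sup_ubound; exists x, x.
by rewrite subrr (norm_zero nN).
Qed.

Lemma diam_dist (C : set V) x y : C x -> C y -> ((N (x - y))%:E <= diamN N C)%E.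
Proof.
move=> Cx Cy; rewrite /diamN; case: ifPn => [/eqP C0|_]; first by rewrite C0 in Cx.
by apply: ereal_sup_ubound; exists x, y.
Qed.

(** A covering set of diameter [r > 0] lies in boundedly many cubes of the finest generation whose
    diameter exceeds [r]; that diameter is at most [2 r], so each cube has [g_d]-value at most
    [2 ^ d * g_d r], hence at most [2 ^ d * g r]. *)
Lemma hausdorff_tiny g (E : set V) : G_infty d g -> hausdorff N g E = 0%E ->
  forall t0 : nat, tiny (fun j => gd d g (delta j)%:E) t0 E.
Proof.
move=> gi hE t0 e e0.
have [[g0 _] _] := gi.
have [e1 [[e10 Gm Gr Gs] _ fin pos]] := ginf_regular gi.
have [n0 n0P] := delta_small D0 e10.
pose G r := fine (gd d g r%:E).
pose t1 := maxn t0 n0.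
have [K KP] := shift_near d0 nN D0.
pose L := {ffun 'I_d -> 'I_(K + K).+1}.
have [z0 Lpos] : L * (0 < #|L|)%N.
  by split; [exact: [ffun=> ord0]|apply/card_gt0P; exists [ffun=> ord0]].
have L0 : 0 < #|L|%:R :> R by rewrite ltr0n.
have C0 : 0 < 2 ^+ d + 1 :> R by rewrite addr_gt0 // exprn_gt0.
(* [#|L|] counts the neighbouring cubes, [2 ^+ d] pays for the rounding of diameters, and [1] for
   the error terms, which add up to [e']. *)
pose e' := e / #|L|%:R / (2 ^+ d + 1).
have e'0 : 0 < e' by rewrite !divr_gt0.
have : (hausdorff_delta N g (delta t1.+1%:Z) E < e'%:E)%E.
  apply: (@le_lt_trans _ _ 0%E) => //; rewrite -hE.
  by apply: ereal_sup_ubound; exists (delta t1.+1%:Z) => //=; exact: delta_gt0.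
move=> /ereal_inf_lt[_ [C [EC [Cd ->]]] sC].
have key (n : nat) : exists s : nat, [/\ (t1 <= s)%N,
    (diamN N (C n) < (delta s)%:E)%E &
    (gd d g (delta s)%:E <=
       (2 ^+ d)%:E * g (diamN N (C n)) + (e' / (2 ^ n.+1)%N%:R)%:E)%E].
  have dn := Cd n; have d_ge0 := diam_ge0 (C n).
  have dfin : diamN N (C n) \is a fin_num.
    by rewrite ge0_fin_numE // (le_lt_trans dn) // ltry.
  move: dn d_ge0; rewrite -(fineK dfin); set r := fine _; clearbody r.
  (* A set of diameter zero has no scale of its own; it receives one whose gauge value is below its
     share of the error. *)
  rewrite !lee_fin le_eqVlt => rt; rewrite le_eqVlt => /orP[/eqP r0|r0].
    have en0 : 0 < e' / (2 ^ n.+1)%N%:R by rewrite divr_gt0 // ltr0n expn_gt0.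
    have [rho rho0 hrho] := Gs _ en0.
    have [s sP] := delta_small D0 rho0.
    exists (maxn t1 s); split; first exact: leq_maxl.
      by rewrite -r0 lte_fin delta_gt0.
    have n0s : n0%:Z <= (maxn t1 s)%:Z.
      by rewrite lez_nat (leq_trans _ (leq_maxl _ _)) // leq_maxr.
    rewrite fin ?delta_gt0 ?(ltW (n0P _ _)) //.
    apply: (@le_trans _ _ (e' / (2 ^ n.+1)%N%:R)%:E); last first.
      by rewrite leeDr // mule_ge0 ?lee_fin ?exprn_ge0 // g0 // lee_fin -r0.
    by rewrite lee_fin ltW // hrho // delta_gt0 //= sP // lez_nat leq_maxr.
  have exm : exists m : nat, delta m%:Z <= r.
    by have [m mP] := delta_small D0 r0; exists m; rewrite ltW // mP.
  case: (ex_minnP exm) => m mr mmin.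
  have t1m : (t1 < m)%N.
    case/orP: rt => [/eqP rt|rt].
      by move: mr; rewrite rt ler_delta // lez_nat.
    by have := le_trans mr (ltW rt); rewrite ler_delta // lez_nat.
  case: m mr mmin t1m => // m mr mmin t1m; exists m.
  have rm : r < delta m%:Z.
    by rewrite ltNge; apply/negP => /mmin; rewrite ltnn.
  split=> //.
  have n0m : n0%:Z <= m%:Z by rewrite lez_nat; apply: leq_trans (t1m : (t1 <= m)%N); exact: leq_maxr.
  have de := ltW (n0P _ n0m); have dm0 := @delta_gt0 R D D0 m%:Z.
  have re : 0 < r <= e1 by rewrite r0 (le_trans (ltW rm)).
  apply: (@le_trans _ _ ((2 ^+ d)%:E * gd d g r%:E)%E); last first.
    apply: (@le_trans _ _ ((2 ^+ d)%:E * g r%:E)%E); last first.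
      by rewrite leeDl // lee_fin ltW // divr_gt0 // ltr0n expn_gt0.
    by apply: lee_wpmul2l; [rewrite lee_fin exprn_ge0|exact: gd_le].
  have dme : 0 < delta m%:Z <= e1 by rewrite dm0.
  rewrite (fin _ re) (fin _ dme) -EFinM lee_fin.
  have d2 : delta m%:Z <= 2 * r.
    by rewrite deltaS ler_pM2l //; rewrite -[m%:Z + 1]/(m%:Z + 1%:Z) -PoszD addn1.
  rewrite -(ler_pM2r (exprn_gt0 d r0)).
  apply: (le_trans (Gr r _ r0 (ltW rm) de)).
  rewrite -mulrA mulrCA -exprMn ler_wpM2l ?(ltW (pos _ re)) //.
  by rewrite lerXn2r ?nnegrE ?mulr_ge0 // ltW.
have [s_ sP] := choice key.
have xP (n : nat) : exists x, C n !=set0 -> C n x.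
  by have [[x Cx]|h] := pselect (C n !=set0); [exists x|exists 0 => /h].
have [x_ x_P] := choice xP.
pose F n : set I := range (fun l : L => @shift d K (cof (s_ n)%:Z (x_ n)) l).
exists (\bigcup_n F n); split.
- move=> _ [n _ [l _ <-]] /=; rewrite lez_nat.
  by have [h _ _] := sP n; apply: leq_trans h; exact: leq_maxl.
- move=> y /EC[n _ Cy]; have Cx : C n (x_ n) by apply: x_P; exists y.
  have [_ lt _] := sP n.
  have lt' : N (y - x_ n) < delta (s_ n)%:Z.
    by rewrite -lte_fin; apply: le_lt_trans lt; exact: diam_dist.
  have [l lE] := KP _ _ _ _ lt' (erefl : (cof (s_ n)%:Z (x_ n)).1 = (s_ n)%:Z) (cube_cof _ _).
  exists (cof (s_ n)%:Z y); last exact: cube_cof.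
  by exists n => //; exists l.
have g0' x : (0 <= gd d g x)%E by exact: gd_ge0.
apply: (@le_trans _ _ (\esum_(n in setT) \esum_(c in F n) gd d g (delta c.1)%:E)%E).
  exact: le_esum_cover.
pose a n := ((2 ^+ d)%:E * g (diamN N (C n)))%E.
have a0 n : (0 <= a n)%E by rewrite mule_ge0 ?lee_fin ?exprn_ge0 // g0 // diam_ge0.
apply: (@le_trans _ _ (\esum_(n in [set: nat])
    (#|L|%:R%:E * (a n + (e' / (2 ^ n.+1)%N%:R)%:E)))%E).
  apply: le_esum => n _; have [st lt le] := sP n.
  have nz : n0%:Z <= (s_ n)%:Z by rewrite lez_nat (leq_trans _ st) // leq_maxr.
  have se : 0 < delta (s_ n)%:Z <= e1 by rewrite delta_gt0 // ltW // n0P.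
  apply: (@le_trans _ _ (G (delta (s_ n)%:Z) * #|L|%:R)%:E).
    apply: esum_range_le => [|l]; first exact/ltW/pos.
    by rewrite (_ : (@shift d K (cof (s_ n)%:Z (x_ n)) l).1 = (s_ n)%:Z) // (fin _ se).
  by rewrite mulrC EFinM; apply: lee_wpmul2l => //; rewrite -(fin _ se).
have an0 n : (0 <= a n + (e' / (2 ^ n.+1)%N%:R)%:E)%E.
  by rewrite adde_ge0 // lee_fin divr_ge0 // ltW.
rewrite esumZ // -lee_pdivlMl // -nneseries_esumT //.
apply: (le_trans (epsilon_trick _ a0 (ltW e'0))).
rewrite nneseriesZl => [|n _]; last by rewrite g0 // diam_ge0.
apply: (@le_trans _ _ ((2 ^+ d)%:E * e'%:E + e'%:E)%E).
  by apply: leeD => //; apply: lee_wpmul2l; rewrite ?lee_fin ?exprn_ge0 // ltW.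
rewrite -EFinM -EFinD -[X in _ + X]mul1r -mulrDl lee_fin /e' mulrC divfK ?gt_eqF //.
by rewrite mulrC.
Qed.
End Metric.
End GaugeCovers.

(** * Gauge integrals as sums over dyadic scales *)

Section GaugeIntegrals.
Context {R : realType} {d : nat}.
Local Notation unit := (`]0%R, 1%R]%classic : set R).
Implicit Types (g h : \bar R -> \bar R).

Lemma density_fin g r : G_infty d g -> 0 < r -> density (d := d) g r \is a fin_num.
Proof.
move=> gi r0; have [[g0 _] _] := gi; have [e [[e0 _ _ _] _ fin _]] := ginf_regular gi.
rewrite ge0_fin_numE ?density_ge0 //.
pose t := Num.min r e; have t0 : 0 < t by rewrite lt_min r0.
apply: (@le_lt_trans _ _ (density (d := d) g t)).
  by apply: density_noninc; rewrite ge_min lexx.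
by rewrite -gdK // fin ?ltry // t0 ge_min lexx orbT.
Qed.

Lemma gd_bounded g (e : R) : G_infty d g -> 0 < e ->
  exists2 C : R, 0 <= C & forall r, e < r <= 1 -> (gd d g r%:E <= C%:E)%E.
Proof.
move=> gi e0; have [[g0 _] _] := gi; have fe := density_fin gi e0.
exists (fine (density (d := d) g e)); first by rewrite fine_ge0 // density_ge0.
move=> r /andP[er r1]; have r0 := lt_trans e0 er.
rewrite gdE // fineK // -[leRHS]mul1e; apply: lee_pmul.
- by rewrite lee_fin exprn_ge0 // ltW.
- exact: density_ge0.
- by rewrite lee_fin exprn_ile1 // ltW.
- by apply: density_noninc; exact: ltW.
Qed.

(** Away from [0] it is [r ^ d] times a finite nonincreasing function; truncating the argument at
    [a] makes that function finite on the whole line. *)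
Lemma measurable_gd g : G_infty d g -> measurable_fun unit (fun r : R => gd d g r%:E).
Proof.
move=> gi; pose E n : set R := `[n.+1%:R^-1, 1]%classic.
have -> : unit = \bigcup_n E n.
  apply/seteqP; split=> r /=; last first.
    move=> [n _]; rewrite /E /= !in_itv /= => /andP[a ->]; rewrite andbT.
    by apply: lt_le_trans a; rewrite invr_gt0.
  rewrite in_itv /= => /andP[r0 r1]; have [n nr] := pow2_unbounded r^-1.
  exists (2 ^ n)%N => //; rewrite /E /= in_itv /= r1 andbT.
  rewrite -[leRHS]invrK lef_pV2 ?posrE ?invr_gt0 ?ltr0Sn //.
  by apply: (le_trans nr); rewrite -(natrX R 2 n) ler_nat leqnSn.
apply/measurable_fun_bigcup => [n|n]; first exact: measurable_itv.
pose a : R := n.+1%:R^-1; have a0 : 0 < a by rewrite invr_gt0.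
pose q r : R := fine (density (d := d) g (Num.max r a)).
apply: (eq_measurable_fun (fun r : R => (r ^+ d * q r)%:E)).
  move=> r; rewrite inE /E /= in_itv /= => /andP[ar r1].
  have r0 : 0 < r by apply: lt_le_trans ar.
  by rewrite -[RHS]/(gd d g r%:E) gdE // /q max_l // EFinM fineK // density_fin.
apply/measurable_EFinP; apply: measurable_funM.
  by apply: measurable_funTS; apply: exprn_measurable.
apply: nonincreasing_measurable => [|r s rs]; first exact: measurable_itv.
have m0 t : 0 < Num.max t a by rewrite lt_max a0 orbT.
apply: fine_le; rewrite ?density_fin //; apply: density_noninc.
by rewrite ge_max le_max rs /= le_max lexx orbT.
Qed.

Variables (D : R) (nu : {measure set R -> \bar R}).
Hypotheses (D0 : 0 < D) (hnu : classR nu).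
Local Notation mass := (mass D nu).
Local Notation delta := (delta D).

Section Sums.
Variables (f : R -> \bar R) (e : R) (G : R -> R).
Hypothesis mf : measurable_fun unit f.
Hypothesis f0 : forall r, 0 < r <= 1 -> (0 <= f r)%E.
Hypothesis fC : forall e, 0 < e -> exists2 C : R, 0 <= C &
  forall r, e < r <= 1 -> (f r <= C%:E)%E.
Hypothesis rG : regular (d := d) e G.
Hypothesis fG : forall r, 0 < r <= e -> f r = (G r)%:E.
Hypothesis G0 : forall r, 0 < r <= e -> 0 <= G r.

Lemma delta_range (s0 : int) j : delta s0 <= e -> s0 <= j -> 0 < delta j <= e.
Proof.
by move=> se sj; rewrite delta_gt0 //= (le_trans _ se) // ler_delta.
Qed.

Lemma regular_halve (s0 : nat) : delta s0 <= e -> forall s : nat, (s0 <= s)%N ->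
  G (delta s) <= 2 ^+ d * G (delta s.+1).
Proof.
move=> se s ss; have [_ _ ratio _] := rG.
have [h1 h2] := (@delta_range s0 s se ss, @delta_range s0 s.+1 se (leqW ss)).
have /andP[p1 q1] := h1; have /andP[p2 q2] := h2.
have dd : delta s = 2 * delta s.+1 by rewrite deltaS -[s%:Z + 1]/(s%:Z + 1%:Z) -PoszD addn1.
rewrite -(ler_pM2r (exprn_gt0 d p2)).
have -> : 2 ^+ d * G (delta s.+1) * delta s.+1 ^+ d = G (delta s.+1) * delta s ^+ d.
  by rewrite dd [(2 * _) ^+ d]exprMn -mulrA mulrCA.
by apply: ratio => //; rewrite ler_delta // lez_nat.
Qed.

Lemma finite_mass_sums (s0 : nat) : delta s0 <= e ->
  (\int[nu]_(r in unit) f r < +oo)%E ->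
  exists B, forall n, \sum_(s0 <= s < n) (mass s.+1 - mass s) * G (delta s) <= B.
Proof.
move=> se foo; have [_ mono _ _] := rG.
have v0 s : (s0 <= s)%N -> 0 <= G (delta s%:Z).
  by move=> ss; apply/G0/(delta_range se).
have low s r : (s0 <= s)%N -> annulus D s r -> ((G (delta s.+1))%:E <= f r)%E.
  move=> ss /annulusP[/andP[a b] c].
  have /andP[p q] := @delta_range s0 s se ss.
  have p2 := @delta_gt0 R D D0 s.+1%:Z.
  have rr : 0 < r <= e by rewrite (lt_trans p2) // (le_trans c).
  by rewrite fG // lee_fin; apply: mono => //; [exact: ltW|exact: le_trans q].
have [B hB] := integral_bound D0 hnu mf f0 v0 low foo.
exists (2 ^+ d * B) => n.
apply: (@le_trans _ _ (2 ^+ d * \sum_(s0 <= s < n) (mass s.+1 - mass s) * G (delta s.+1))).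
  rewrite mulr_sumr; apply: ler_sum_nat => s /andP[ss _]; rewrite [leRHS]mulrCA.
  by rewrite ler_wpM2l ?subr_ge0 ?mass_homo // (regular_halve se).
by rewrite ler_wpM2l // exprn_ge0.
Qed.

Lemma infinite_mass_sums (s0 : nat) : delta s0 <= e ->
  (\int[nu]_(r in unit) f r = +oo)%E ->
  forall B, exists n, B <= \sum_(s0 <= s < n) (mass s.+1 - mass s) * G (delta s).
Proof.
move=> se foo B; have [_ mono _ _] := rG.
apply: contrapT => hB.
have bnd n : \sum_(s0 <= s < n) (mass s.+1 - mass s) * G (delta s) <= B.
  by rewrite leNgt; apply/negP => h; apply: hB; exists n; exact: ltW.
have v0 s : (s0 <= s)%N -> 0 <= G (delta s%:Z).
  by move=> ss; apply/G0/(delta_range se).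
have [C C0 hC] := fC (@delta_gt0 R D D0 s0).
have up s r : (s0 <= s)%N -> annulus D s r -> (f r <= (G (delta s))%:E)%E.
  move=> ss /annulusP[/andP[a b] c].
  have /andP[p q] := @delta_range s0 s se ss.
  have p2 := @delta_gt0 R D D0 s.+1%:Z.
  have r0 := lt_trans p2 a.
  have rr : 0 < r <= e by rewrite r0 (le_trans c).
  by rewrite fG // lee_fin mono.
have := integral_finite D0 hnu mf f0 v0 C0 hC up bnd.
by rewrite foo.
Qed.

Lemma regular_weight (s0 : int) : delta s0 <= e ->
  (forall r, 0 < r <= e -> 0 < G r) -> @weight R d s0 (fun j => G (delta j)).
Proof.
move=> se pos; have [_ mono ratio _] := rG; split.
- by move=> j sj; apply/pos/(delta_range se).
- move=> i j si ij; have /andP[p q] := delta_range se si.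
  have pj := @delta_gt0 R D D0 j.
  by apply: mono => //; rewrite ler_delta.
move=> i j si ij; have /andP[p q] := delta_range se si.
have pj := @delta_gt0 R D D0 j.
have Dd : 0 < D ^+ d by rewrite exprn_gt0.
rewrite -(ler_pM2r Dd) -!mulrA -!exprMn.
by apply: ratio => //; rewrite ler_delta.
Qed.
End Sums.

Lemma regular_pow : (0 < d)%N -> regular (d := d) 1 (fun r : R => r ^+ d).
Proof.
move=> d0; split=> //.
- by move=> r s r0 rs _; rewrite lerXn2r // ?nnegrE ltW // (lt_le_trans r0).
- by move=> r s _ _ _; rewrite mulrC.
move=> eta eta0; exists (Num.min 1 eta); first by rewrite lt_min ltr01.
move=> r /andP[r0]; rewrite lt_min => /andP[r1 re]; apply: le_lt_trans re.
by rewrite ler_iXnr // ltW.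
Qed.
End GaugeIntegrals.

(** * The set of points covered infinitely often *)

Section LimsupSet.
Context {R : realType} {d : nat}.
Local Notation I := (@cidx d).
Local Notation V := 'rV[R]_d.
Local Notation sub := (@sub R d).
Local Notation cube := (@cube R d).
Local Notation vol := (@vol R d).
Local Notation L n := {ffun 'I_d -> 'I_(2 ^ n)}.
Implicit Types (g h : \bar R -> \bar R).

(** Arbitrarily cheap coverings contradict a positive content bound. As their cubes are at least as
    fine as [lam], those that meet [lam] lie inside it. *)
Lemma tiny_content (w : int -> \bar R) (t0 : int) (E X : set V) (lam : I) (x : \bar R) :
  (forall j, (0 <= w j)%E) -> lam.1 <= t0 -> X `&` cube lam `<=` E -> tiny w t0 E ->
  (forall A : set I, (forall C, A C -> sub C lam) -> covers A (X `&` cube lam) ->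
    (x <= \esum_(C in A) w C.1)%E) -> (x <= 0)%E.
Proof.
move=> w0 lt XE tE hA; apply/lee_addgt0Pr => e e0; rewrite add0e.
have [A [At cA sA]] := tE e e0; apply: le_trans sA.
apply: (@le_trans _ _ (\esum_(C in A `&` [set C | sub C lam]) w C.1)%E).
  apply: hA => [C [] //|y [Xy ly]].
  have [C AC Cy] := cA _ (XE _ (conj Xy ly)).
  exists C => //; split=> //=; apply: cube_nest Cy ly; exact: le_trans lt (At _ AC).
by apply: subset_le_esum => // C [].
Qed.

Lemma borel_gdelta (F : set V) : G_delta F -> borel_d F.
Proof.
move=> [G_ [oG ->]].
have mG n : measurable (G_ n : set (g_sigma_algebraType [set A : set V | open A])).
  by apply: sub_sigma_algebra; exact: oG.
by apply: (@bigcap_measurable _ (g_sigma_algebraType [set A : set V | open A])) => //; exists 0%N.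
Qed.

Variables (N : V -> R) (D : R) (nu : {measure set R -> \bar R}) (U : set V).
Variable Q : {measure set (BSp R d) -> \bar R}.
Hypotheses (d0 : (0 < d)%N) (nN : is_norm N) (D0 : 0 < D) (hnu : classR nu).
Hypothesis oU : open U.
Hypothesis hD : forall c : I, diamN N (cube c) = (delta D c.1)%:E.
Local Notation mass := (mass D nu).
Local Notation lev := (lev d D0 hnu).
Local Notation delta := (delta D).
Local Notation slab := (slab D).
Local Notation hits := (hits D).
Local Notation unit := (`]0%R, 1%R]%classic : set R).

Hypothesis Qint : forall E, measurable E -> Q E = +oo%E \/ exists k : nat, Q E = k%:R%:E.
Hypothesis QS : Q (~` Sset U) = 0%E.
Hypothesis QU : forall M : nat, exists2 K : R, 0 <= K &
  forall s : nat, (Q (slab s (cbox M)) <= (K * (1 + mass s))%:E)%E.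
Hypothesis QL : forall (g : nat) (c : I), c.1 = g%:Z -> cube c `<=` U ->
  exists J, forall j, (J <= j)%N -> (g <= j)%N ->
    (2 ^ ((j - g) * d) <= 2 * #|hits Q c (lev j) (j - g)|)%N.

Hypothesis U0 : U !=set0.

(** * Open sets of points covered by small balls *)

Definition reach (e : R) (y : V) : set (BSp R d) := [set z | e < z.1 - N (y - z.2)].

Lemma measurable_reach e y : measurable (reach e y).
Proof.
apply: open_measurable_BSp.
rewrite (_ : reach e y = (fun z : Sp R d => z.1 - N (y - z.2)) @^-1` [set x | e < x]) //.
apply: open_comp => [z _|]; last exact: open_gt.
apply: cvgB; first exact: cvg_fst.
apply: continuous_cvg; first exact: norm_cont.
by apply: cvgB; [exact: cvg_cst|exact: cvg_snd].
Qed.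

Lemma measurable_le_radius (e : R) : measurable ([set z | z.1 <= e] : set (BSp R d)).
Proof.
rewrite (_ : [set z | _] = ~` [set z : BSp R d | e < z.1]).
  by apply: measurableC; exact: measurable_fst_gt.
by apply/seteqP; split=> z /=; rewrite leNgt => /negP.
Qed.

Definition shoot (e : R) (s : nat) (y : V) : set (BSp R d) :=
  reach e y `&` [set z | z.1 <= delta s] `&` Sset U.

Lemma measurable_shoot e s y : measurable (shoot e s y).
Proof.
apply: measurableI; last exact: measurable_Sset.
by apply: measurableI; [exact: measurable_reach|exact: measurable_le_radius].
Qed.

Definition Gopen (s : nat) : set V := [set y | Q (shoot 0 s y) != 0%E].

Lemma null_bigcup (E : nat -> set (BSp R d)) : (forall n, measurable (E n)) ->
  (forall n, Q (E n) = 0%E) -> Q (\bigcup_n E n) = 0%E.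
Proof.
move=> mE E0; apply/eqP; rewrite eq_le measure_ge0 andbT.
apply: (le_trans (measure_sigma_subadditive Q mE _ (@subset_refl _ _))).
  exact: bigcup_measurable.
by rewrite eseries0 // => n _ _; rewrite E0.
Qed.

(** Some margin [1 / (n + 1)] already carries mass, by countable subadditivity, and balls covering
    [y] with this margin cover all points closer to [y] than the margin. *)
Lemma open_Gopen s : open (Gopen s).
Proof.
rewrite openE => y Gy.
pose e n : R := n.+1%:R^-1.
have [n en] : exists n, Q (shoot (e n) s y) != 0%E.
  apply: contrapT => nex; move/eqP: Gy; apply.
  apply/eqP; rewrite eq_le measure_ge0 andbT.
  have UE : shoot 0 s y `<=` \bigcup_n shoot (e n) s y.
    move=> z [[z1 z2] z3]; rewrite /reach /= in z1.
    exists (Num.bound (z.1 - N (y - z.2))^-1) => //; split=> //; split=> //.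
    rewrite /reach /= /e invf_plt ?posrE //.
    apply: lt_le_trans (archi_boundP _) _; first by rewrite invr_ge0 ltW.
    by rewrite ler_nat.
  apply: (@le_trans _ _ (Q (\bigcup_n shoot (e n) s y))).
    apply: le_measure => //; rewrite inE; first exact: measurable_shoot.
    by apply: bigcup_measurable => n _; exact: measurable_shoot.
  rewrite null_bigcup // => [n|n]; first exact: measurable_shoot.
  by apply: contrapT => /eqP h; apply: nex; exists n.
have e0 : 0 < e n by rewrite invr_gt0.
pose B := [set y' : V | N (y' - y) < e n].
have oB : open B.
  rewrite (_ : B = (fun y' => N (y' - y)) @^-1` [set x | x < e n]) //.
  apply: open_comp => [y' _|]; last exact: open_lt.
  have cB : continuous (fun y' : V => y' - y).
    move=> z; have Fz : Filter (nbhs z) by exact: nbhs_filter.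
    exact: (@cvgB R V V (nbhs z) Fz id (fun=> y) z y (@cvg_id _ _) (cvg_cst _)).
  by apply: (@continuous_comp _ _ _ (fun y' : V => y' - y) N); [exact: cB|exact: norm_cont].
have By : B y by rewrite /B /= subrr norm_zero.
apply: (@filterS _ _ _ B); last exact: open_nbhs_nbhs.
move=> y' By'; apply/negP => /eqP h; move/negP: en; apply.
apply/eqP/eqP; rewrite eq_le measure_ge0 andbT -h; apply: le_measure; rewrite ?inE.
- exact: measurable_shoot.
- exact: measurable_shoot.
move=> z [[z1 z2] z3]; split=> //; split=> //; rewrite /reach /= in z1 *.
have := norm_D nN (y' - y) (y - z.2); rewrite addrA subrK.
by move: By'; rewrite /B /=; move: z1; lra.
Qed.

Lemma QSE (E : set (BSp R d)) : measurable E -> Q E = Q (E `&` Sset U).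
Proof.
move=> mE; have mS := measurable_Sset oU.
apply/eqP; rewrite eq_le; apply/andP; split; last first.
  by apply: le_measure => //; rewrite inE //; exact: measurableI.
rewrite -[leRHS]adde0 -QS.
apply: (@le_trans _ _ (Q ((E `&` Sset U) `|` ~` Sset U))).
  apply: le_measure; rewrite ?inE //.
    by apply: measurableU; [exact: measurableI|exact: measurableC].
  by move=> z Ez; have [Sz|nSz] := pselect (Sset U z); [left|right].
by apply: measureU2; [exact: measurableI|exact: measurableC].
Qed.

Lemma norm_cube (q : I) x y : cube q x -> cube q y -> N (x - y) <= delta q.1.
Proof.
move=> qx qy; rewrite -lee_fin -hD /diamN.
case: ifPn => [/eqP q0|_]; first by move: qx; rewrite q0.
by apply: ereal_sup_ubound; exists x, y.
Qed.

(** A ball centred in [q] with radius above the diameter of [q] contains [q]. *)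
Lemma cube_Gopen (q : I) (a s : nat) : a%:Z <= q.1 ->
  Q (cyl (delta a) (delta s) (cube q)) != 0%E -> cube q `<=` Gopen s.
Proof.
move=> aq Qq y qy; apply/negP => /eqP h; move/negP: Qq; apply.
have mc := @measurable_cyl_cube R d (delta a) (delta s) q.
apply/eqP/eqP; rewrite QSE // eq_le measure_ge0 andbT -h; apply: le_measure; rewrite ?inE.
- by apply: measurableI => //; exact: measurable_Sset.
- exact: measurable_shoot.
move=> z [[/andP[z1 z2] z3] z4]; split=> //; split=> //; rewrite /reach /=.
rewrite subr_gt0; apply: le_lt_trans z1; apply: (le_trans (norm_cube qy z3)).
by rewrite ler_delta.
Qed.

Lemma null_setU (X Y : set (BSp R d)) : measurable X -> measurable Y ->
  Q X = 0%E -> Q Y = 0%E -> Q (X `|` Y) = 0%E.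
Proof.
move=> mX mY X0 Y0; apply/eqP; rewrite eq_le measure_ge0 andbT.
have h : (Q (X `|` Y) <= Q X + Q Y)%E by exact: measureU2.
by apply: (le_trans h); rewrite X0 Y0 adde0.
Qed.

Lemma null_finite (T : finType) (E : T -> set (BSp R d)) (W : set (BSp R d)) :
  measurable W -> (forall l, measurable (E l)) -> (forall l, Q (E l) = 0%E) ->
  (forall z, W z -> exists l, E l z) -> Q W = 0%E.
Proof.
move=> mW mE E0 cov.
suff [mX X0] : measurable (\big[setU/set0]_l E l) /\ Q (\big[setU/set0]_l E l) = 0%E.
  apply/eqP; rewrite eq_le measure_ge0 andbT -X0; apply: le_measure; rewrite ?inE //.
  by move=> z /cov[l El]; rewrite (bigD1 l) //=; left.
elim/big_ind : _ => [|X Y [mX X0] [mY Y0]|l _]; first by rewrite measure0.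
  by split; [exact: measurableU|exact: null_setU].
by [].
Qed.

Lemma subhit (P : I) (n : nat) (a b : R) : Q (cyl a b (cube P)) != 0%E ->
  exists q : I, [/\ q.1 = P.1 + n%:Z, sub q P & Q (cyl a b (cube q)) != 0%E].
Proof.
move=> QP; apply: contrapT => nex; move/negP: QP; apply; apply/eqP.
apply: (@null_finite _ (fun l : L n => cyl a b (cube (kid P l)))).
- exact: measurable_cyl_cube.
- by move=> l; exact: measurable_cyl_cube.
- move=> l; apply: contrapT => /eqP h; apply: nex; exists (kid P l); split=> //.
  exact: kid_sub.
move=> z [z1 z2].
have Pj : P.1 <= P.1 + n%:Z by rewrite lerDl.
have [l lE] := @kidP R d P (cof (P.1 + n%:Z) z.2) n erefl (cof_sub z2 Pj).
by exists l; split=> //; rewrite -lE; exact: cube_cof.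
Qed.

Lemma size_le_measure (T : choiceType) (r : seq T) (E : T -> set (BSp R d))
    (W : set (BSp R d)) : uniq r -> measurable W ->
  (forall l, measurable (E l)) -> (forall l, l \in r -> (1 <= Q (E l))%E) ->
  (forall l, E l `<=` W) -> (forall l l' z, E l z -> E l' z -> l = l') ->
  ((size r)%:R%:E <= Q W)%E.
Proof.
move=> ur mW mE E1 EW disj.
suff [mr] : measurable (\big[setU/set0]_(l <- r) E l) /\
   ((size r)%:R%:E <= Q (\big[setU/set0]_(l <- r) E l))%E.
  move=> /le_trans; apply; apply: le_measure; rewrite ?inE //.
  by rewrite -bigcup_seq => z [l _ El]; exact: EW El.
elim: r ur E1 => [|l r IHr] /=.
  by rewrite big_nil measure0 => _ _; split; [exact: measurable0|exact: lexx].
move=> /andP[lr ur] rH; rewrite big_cons.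
have [|mr lr'] := IHr ur; first by move=> l' l'r; apply: rH; rewrite inE l'r orbT.
split; first exact: measurableU.
rewrite measureU //.
  rewrite -add1n natrD EFinD; apply: leeD => //.
  by apply: rH; rewrite inE eqxx.
apply/seteqP; split=> // z [El]; rewrite -bigcup_seq => -[l' /= l'r El'].
by move: lr; rewrite (disj _ _ _ El El') l'r.
Qed.

Lemma card_le_measure (T : finType) (H : {set T}) (E : T -> set (BSp R d))
    (W : set (BSp R d)) : measurable W ->
  (forall l, measurable (E l)) -> (forall l, l \in H -> (1 <= Q (E l))%E) ->
  (forall l, E l `<=` W) -> (forall l l' z, E l z -> E l' z -> l = l') ->
  (#|H|%:R%:E <= Q W)%E.
Proof.
move=> mW mE E1 EW disj; rewrite cardE.
apply: size_le_measure EW disj => //; first exact: enum_uniq.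
by move=> l; rewrite mem_enum; exact: E1.
Qed.

Lemma Q_ge1 E : measurable E -> Q E != 0%E -> (1 <= Q E)%E.
Proof.
move=> /Qint[->|[k ->]]; first by rewrite leey.
by rewrite eqe pnatr_eq0 -lt0n lee_fin ler1n.
Qed.

Lemma cube_cbox (c : I) : 0 <= c.1 -> exists M, cube c `<=` cbox M.
Proof.
move=> c0; pose M := (\max_i `|c.2 i|).+2.
exists M => x; rewrite cube_box => cx i; have := cx i; rewrite !mxE.
have p1 : 2 ^ (- c.1) <= 1 :> R by rewrite -(expr0z (2 : R)) ler_pow2 oppr_le0.
have p0 := @pow2_gt0 R (- c.1).
have kM : (`|c.2 i| <= \max_i `|c.2 i|)%N by exact: (leq_bigmax i).
have k1 : - (M.-2%:R) <= (c.2 i)%:~R :> R.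
  by rewrite -[M.-2%:R]/((M.-2)%:Z%:~R) -mulrNz ler_int /M; lia.
have k2 : (c.2 i)%:~R <= M.-2%:R :> R.
  by rewrite -[M.-2%:R]/((M.-2)%:Z%:~R) ler_int /M; lia.
have M2 : M%:R = M.-2%:R + 2 :> R by rewrite /M /= -addn2 natrD.
have m0 : 0 <= M.-2%:R :> R by [].
rewrite M2; move: (2 ^ _) p0 p1 (_%:~R) (M.-2%:R) k1 k2 m0 => p p0 p1 k m k1 k2 m0.
move=> /andP[h1 h2]; apply/andP; split.
  by apply: le_trans h1; nra.
by apply: lt_le_trans h2 _; nra.
Qed.

Lemma slab_cube_fin (s : nat) (c : I) : 0 <= c.1 -> exists k : nat,
  (Q (slab s (cube c)) <= k%:R%:E)%E.
Proof.
move=> /cube_cbox[M cM]; have [K K0 KP] := QU M.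
have b0 : 0 <= K * (1 + mass s) by rewrite mulr_ge0 // addr_ge0 // mass_ge0.
exists (Num.bound (K * (1 + mass s))).
apply: (@le_trans _ _ (K * (1 + mass s))%:E).
  apply: le_trans (KP s); apply: le_measure; rewrite ?inE.
  - exact: measurable_slab_cube.
  - exact: measurable_slab_box.
  - by move=> z [z1 z2]; split=> //; exact: cM.
by rewrite lee_fin ltW // archi_boundP.
Qed.

(** * Lower bounds for contents *)

Definition ghits (c : I) (s j n : nat) : {set L n} :=
  finset (fun l => Q (cyl (delta (lev j)) (delta s) (cube (kid c l))) != 0%E).

(** At least half of the subcubes are hit. Discarding radii above [delta s] loses at most [k] of
    them, with [k] a bound for the number of such points in [c], so [3/8] remain once [8 * k] is
    below the number of subcubes. *)
Lemma ghits_large (g : nat) (c : I) (s : nat) : c.1 = g%:Z -> cube c `<=` U ->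
  exists J, forall j, (J <= j)%N -> (g <= j)%N ->
    (3 * 2 ^ ((j - g) * d) <= 8 * #|ghits c s j (j - g)|)%N.
Proof.
move=> cg cU; have [J JP] := QL cg cU.
have [|k kP] := slab_cube_fin s (c := c); first by rewrite cg.
exists (J + g + 8 * k)%N => j Jj gj.
have {}JP : (2 ^ ((j - g) * d) <= 2 * #|hits Q c (lev j) (j - g)|)%N.
  by apply: JP => //; lia.
have hk : (#|hits Q c s (j - g)| <= k)%N.
  rewrite -(ler_nat R) -lee_fin; apply: le_trans kP.
  apply: (@card_le_measure _ _ (fun l => slab s (cube (kid c l)))).
  - exact: measurable_slab_cube.
  - by move=> l; exact: measurable_slab_cube.
  - by move=> l; rewrite inE => h; apply: Q_ge1 => //; exact: measurable_slab_cube.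
  - by move=> l z [z1 z2]; split=> //; exact: (kid_sub (R := R) c l).2.
  - by move=> l l' z [_ z1] [_ z2]; apply/(@kid_inj _ c)/(cube_uniq _ z1 z2).
have hU : (#|hits Q c (lev j) (j - g)| <= #|ghits c s j (j - g)| + #|hits Q c s (j - g)|)%N.
  apply: leq_trans (leq_card_setU _ _); apply: subset_leq_card; apply/fintype.subsetP => l.
  rewrite !inE => h; apply/norP => -[/negPn/eqP h1 /negPn/eqP h2].
  move/negP: h; apply; rewrite eq_le measure_ge0 andbT.
  apply: (@le_trans _ _ (Q (cyl (delta (lev j)) (delta s) (cube (kid c l)) `|`
                            slab s (cube (kid c l))))).
    apply: le_measure; rewrite ?inE.
    - exact: measurable_slab_cube.
    - by apply: measurableU; [exact: measurable_cyl_cube|exact: measurable_slab_cube].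
    move=> z [/andP[z1 z2] z3]; have [zs|sz] := leP z.1 (delta s).
      by left; split=> //; rewrite z1.
    by right; split=> //; rewrite sz.
  rewrite null_setU //; first exact: measurable_cyl_cube.
  exact: measurable_slab_cube.
have jk : (8 * k <= 2 ^ ((j - g) * d))%N.
  have h1 : (8 * k <= j - g)%N by lia.
  apply: (leq_trans h1); apply: leq_trans (leq_pmulr (j - g) d0) _.
  exact/ltnW/ltn_expl.
move: JP hk hU jk; move: (2 ^ _)%N => x; lia.
Qed.

Lemma select_Gopen (g : nat) (c : I) (s : nat) (i_ : nat -> nat) (J0 : nat) :
  c.1 = g%:Z -> cube c `<=` U -> (forall j, (j <= i_ j)%N) ->
  (forall J, exists n, 1 <= \sum_(J <= j < n) 2^-1 ^+ ((i_ j - j) * d) :> R) ->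
  exists sel : seq (I * nat), [/\ uniq sel,
    (forall a, a \in sel -> selectable c (Gopen s) lev i_ J0 a),
    (forall a b, a \in sel -> b \in sel -> meets (cube a.1) (cube b.1) -> a = b) &
    vol c / 8 <= \sum_(a <- sel) vol a.1].
Proof.
move=> cg cU ige divg.
apply: (@selection R d d0 c g (Gopen s) lev i_ (fun j => ghits c s j (j - g))) => //.
  exact: (ghits_large s cg cU).
move=> j l n; rewrite inE => /(subhit n)[q [qg qs qh]].
exists q; split=> // lq; exact: (cube_Gopen lq qh).
Qed.

(** The selected cubes have total volume at least [vol c / 8]. Those inside a covering cube [C] have
    total volume at most [vol C], hence at most [k * v C.1]. Any other [a] contains a cube [q] of
    the open set, whose covering inside [a] costs at least [v q.1], while [vol a <= k * v q.1]. So
    [vol c / 8] is at most [2 * k] times the cost, and [k = vol c / v c.1] gives [1/16]. *)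
Lemma content_lower (s0 : int) (v : int -> R) (g : nat) (c : I) (A : set I) (s : nat) :
  @weight R d s0 v ->
  (forall J B, exists n, B <= \sum_(J <= j < n) 2 ^+ (j * d) * v (lev j)) ->
  c.1 = g%:Z -> s0 <= g%:Z -> cube c `<=` U ->
  (forall C, A C -> sub C c) -> covers A (Gopen s `&` cube c) ->
  ((1 / 16 * v c.1)%:E <= \esum_(C in A) (v C.1)%:E)%E.
Proof.
move=> wv divv cg s0g cU Ac cov.
have [v0 vmono vrat] := wv.
have vg : 0 < v c.1 by rewrite cg; exact: v0.
have vc := @vol_gt0 R d c.
pose k := vol c / v c.1; have k0 : 0 < k by rewrite divr_gt0.
have As0 C : A C -> s0 <= C.1.
  by move=> /Ac[+ _]; apply: le_trans; rewrite cg.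
have vA C : A C -> (0 <= (v C.1)%:E)%E by move=> /As0 sC; rewrite lee_fin ltW ?v0.
have [J0 J0P] := lev_unbounded d0 D0 hnu `|s0|%N.
have lv0 j : (J0 <= j)%N -> s0 <= (lev j)%:Z by move=> /J0P; lia.
(* First generation from [j] on whose cubes have volume at most [k * v (lev j)]. By minimality stage
   [j] contributes at least the minimum of [1] and [k / 2 ^ d * 2 ^ (j d) * v (lev j)]. *)
have /choice[i_ iP] (j : nat) : exists i : nat, (j <= i)%N /\ ((J0 <= j)%N ->
   (2 ^ (- i%:Z)) ^+ d <= k * v (lev j) /\
   (i = j \/ k * v (lev j) < 2 ^+ d * (2 ^ (- i%:Z)) ^+ d)).
  have [Jj|] := leqP J0 j; last by exists j.
  have kv : 0 < k * v (lev j) by rewrite mulr_gt0 // v0 // lv0.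
  pose p i := (j <= i)%N && ((2 ^ (- i%:Z)) ^+ d <= k * v (lev j)).
  have exp : exists i, p i.
    have [n nP] := @pow2_small R _ kv; exists (maxn j n); rewrite /p leq_maxl /=.
    apply: le_trans (ltW (nP (maxn j n) _)); last by rewrite lez_nat leq_maxr.
    have h1 : 2 ^ (- (maxn j n)%:Z) <= 1 :> R by rewrite -(expr0z 2) ler_pow2; lia.
    have h2 := ltW (@pow2_gt0 R (- (maxn j n)%:Z)).
    by rewrite -(prednK d0) exprS ler_piMr // exprn_ile1.
  case: (ex_minnP exp) => i /andP[ji pk] imin; exists i; split=> // _; split=> //.
  move: ji; rewrite leq_eqVlt => /orP[/eqP ->|ji]; [by left|right].
  rewrite ltNge; apply/negP => h.
  have i0 : (0 < i)%N by exact: leq_ltn_trans ji.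
  suff /imin : p i.-1 by rewrite leqNgt prednK ?leqnn.
  rewrite /p -ltnS prednK // ji /=.
  apply: le_trans h; rewrite -exprMn le_eqVlt; apply/orP; left; apply/eqP; congr (_ ^+ _).
  by rewrite -pow2S; congr (_ ^ _); lia.
have i_ge j : (j <= i_ j)%N by case: (iP j).
have divi J : exists n, 1 <= \sum_(J <= j < n) 2^-1 ^+ ((i_ j - j) * d) :> R.
  pose a j := k / 2 ^+ d * (2 ^+ (j * d) * v (lev j)).
  have kd0 : 0 < k / 2 ^+ d by rewrite divr_gt0 // exprn_gt0.
  apply: (@divergent_min R a _ J0) => //.
  - move=> J' B; have [n nP] := divv J' (B / (k / 2 ^+ d)); exists n.
    by rewrite /a -mulr_sumr mulrC -ler_pdivrMr.
  - by move=> j Jj; rewrite mulr_ge0 ?(ltW kd0) // mulr_ge0 ?exprn_ge0 // ltW // v0 // lv0.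
  move=> j Jj; have [_ /(_ Jj)[_ [->|h]]] := iP j.
    by rewrite subnn mul0n expr0 ge_min lexx.
  rewrite ge_min; apply/orP; right; rewrite /a.
  have e : 2^-1 ^+ ((i_ j - j) * d) = 2 ^+ (j * d) * (2 ^ (- (i_ j)%:Z)) ^+ d :> R.
    rewrite !exprM -exprMn; congr (_ ^+ _).
    by rewrite exprVn !exprnP invr_expz -pow2D; congr (_ ^ _); have := i_ge j; lia.
  rewrite e mulrCA ler_wpM2l ?exprn_ge0 // mulrAC ler_pdivrMr ?exprn_gt0 //.
  by rewrite mulrC [leRHS]mulrC (mulrC (v _)) ltW.
have [sel [us ss ds vs]] := select_Gopen s J0 cg cU i_ge divi.
set S := (\esum_(C in A) _)%E.
have S0 : (0 <= S)%E by apply: esum_ge0 => C /vA.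
pose P (a : I * nat) := `[< exists2 C, A C & sub a.1 C >].
have subc a : a \in sel -> sub a.1 c by move=> /ss[].
have volk C : sub C c -> vol C <= k * v C.1.
  move=> [gC _]; rewrite /k mulrAC ler_pdivlMr // mulrC.
  by rewrite [leRHS]mulrC; apply: vrat => //; rewrite cg.
have bound1 : ((\sum_(a <- sel | P a) vol a.1)%:E <= k%:E * S)%E.
  rewrite -big_filter.
  have uf : uniq [seq a <- sel | P a] by rewrite filter_uniq.
  have vge0 (a : I * nat) : 0 <= vol a.1 by rewrite ltW ?vol_gt0.
  rewrite -esum_seq //.
  pose F (C : I) := [set a | a \in [seq a <- sel | P a && `[< sub a.1 C >]]].
  apply: (@le_trans _ _ (\esum_(C in A) \esum_(a in F C) (vol a.1)%:E)%E).
    apply: le_esum_cover => [a|C a _ _]; last by rewrite lee_fin.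
    rewrite /= mem_filter => /andP[Pa asel]; have /asboolP[C AC aC] := Pa.
    by exists C => //; rewrite /F /= mem_filter Pa asel andbT; exact/asboolP.
  rewrite -esumZ //; apply: le_esum => C AC.
  rewrite /F esum_seq ?filter_uniq // -EFinM lee_fin.
  apply: le_trans (volk _ (Ac _ AC)).
  rewrite -(big_map fst xpredT (fun a : I => vol a)); apply: vol_packing.
  - rewrite map_inj_in_uniq ?filter_uniq // => a b; rewrite !mem_filter.
    move=> /andP[_ asel] /andP[_ bsel] e; apply: ds => //.
    by exists (corner a.1); rewrite -e; split; exact: cube_corner.
  - by move=> b /mapP[a]; rewrite mem_filter => /andP[/andP[_ /asboolP h] _] ->.
  - move=> b b' /mapP[a]; rewrite mem_filter => /andP[_ asel] ->.
    move=> /mapP[a']; rewrite mem_filter => /andP[_ a'sel] ->.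
    move=> ne; apply/seteqP; split=> // x [ax a'x]; move/negP: ne; apply.
    by rewrite (ds _ _ asel a'sel) //; exists x.
have bound2 : ((\sum_(a <- sel | ~~ P a) vol a.1)%:E <= k%:E * S)%E.
  rewrite -big_filter.
  have uf : uniq [seq a <- sel | ~~ P a] by rewrite filter_uniq.
  have vge0 (a : I * nat) : 0 <= vol a.1 by rewrite ltW ?vol_gt0.
  rewrite -esum_seq //.
  pose F (a : I * nat) := [set C | A C /\ sub C a.1].
  apply: (@le_trans _ _ (k%:E *
      \esum_(a in [set` [seq a <- sel | ~~ P a]]) \esum_(C in F a) (v C.1)%:E)%E); last first.
    apply: lee_wpmul2l; first by rewrite lee_fin ltW.
    apply: esum_disjoint_le => //.
      by move=> a _ C [].
    move=> a b C /=; rewrite !mem_filter => /andP[_ asel] /andP[_ bsel] [_ s1] [_ s2].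
    apply: ds => //; exists (corner C).
    by split; [apply: s1.2|apply: s2.2]; exact: cube_corner.
  have vF a C : F a C -> (0 <= (v C.1)%:E)%E by move=> [/vA].
  rewrite -esumZ // => [|a _]; last by apply: esum_ge0 => C; exact: vF.
  apply: le_esum => a; rewrite /= mem_filter => /andP[/asboolPn nP asel].
  have [Ja ag _ [q [qg qa qX]]] := ss _ asel.
  have [_ /(_ Ja)[ik _]] := iP a.2.
  (* If [lev a.2 <= i_ a.2], then [q] has the generation of [a] and the ratio condition on [v]
     applies; otherwise [q] has generation [lev a.2] and the choice of [i_] applies. *)
  have volq : vol a.1 <= k * v q.1.
    rewrite qg; have [li|il] := leqP (lev a.2) (i_ a.2).
      by rewrite -ag; exact: volk (subc _ asel).
    by rewrite /vol ag.
  have s0q : s0 <= q.1.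
    by apply: (le_trans s0g); rewrite -cg; apply: le_trans qa.1; case: (subc _ asel).
  apply: (@le_trans _ _ (k%:E * (v q.1)%:E)%E); first by rewrite -EFinM lee_fin.
  apply: lee_wpmul2l; first by rewrite lee_fin ltW.
  have covq x : cube q x -> exists2 C, F a C & cube C x.
    move=> qx; have [C AC Cx] := cov x (conj (qX _ qx) ((subc _ asel).2 _ (qa.2 _ qx))).
    exists C => //; split=> //.
    have [//|aC] := sub_total Cx (qa.2 _ qx).
    by exfalso; apply: nP; exists C.
  (* Either a covering cube inside [a] contains [q] and costs at least as much, or [q] is covered by
     its own subcubes. *)
  have [[C FC qC]|nC] := pselect (exists2 C, F a C & sub q C).
    apply: (@le_trans _ _ (v C.1)%:E).
      by rewrite lee_fin; apply: vmono; [exact: As0 FC.1|exact: qC.1].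
    rewrite -[leLHS](@esum_set1 R I C (fun C : I => (v C.1)%:E)); last exact: vF FC.
    by apply: subset_le_esum => [_ ->//|C' /vF].
  apply: (@le_trans _ _ (\esum_(C in F a `&` [set C | sub C q]) (v C.1)%:E)%E).
    apply: (weight_cover wv s0q) => [C [_]//|x qx].
    have [C FC Cx] := covq x qx; exists C => //; split=> //=.
    have [//|qC] := sub_total Cx qx.
    by exfalso; apply: nC; exists C.
  by apply: subset_le_esum => [C []//|C /vF].
have tot : ((vol c / 8)%:E <= (2 * k)%:E * S)%E.
  apply: (@le_trans _ _ (\sum_(a <- sel) vol a.1)%:E); first by rewrite lee_fin.
  rewrite (bigID P) /= EFinD.
  have -> : ((2 * k)%:E * S = k%:E * S + k%:E * S)%E.
    by rewrite -ge0_muleDl ?lee_fin ?(ltW k0) // -EFinD; congr (_%:E * _)%E; ring.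
  exact: leeD.
have [Sfin|] := boolP (S \is a fin_num); last first.
  by rewrite ge0_fin_numE // -leNgt leye_eq => /eqP ->; rewrite leey.
move: tot; rewrite -(fineK Sfin) -EFinM !lee_fin; move: (fine S) => S'.
rewrite /k => h.
have : vol c / 8 * v c.1 <= 2 * vol c * S'.
  by rewrite -ler_pdivlMr // -!mulrA; move: h; rewrite mulrA [X in _ <= X]mulrAC -!mulrA.
move: (v c.1) vg (vol c) vc => x x0 y y0 h'.
have : y * (x / 8) <= y * (2 * S') by lra.
by rewrite ler_pM2l // => ?; lra.
Qed.

(** With volume as weight, [i_ j] may be taken at least [lev j], so that the witness inside
    [Gopen s] is the selected cube itself. Every cube of nonnegative generation in [U] is then
    filled up to [7/8] of its volume, and iteration leaves a null set. *)
Lemma full_measure (s0 : int) :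
  (forall J (B : R), exists n, B <= \sum_(J <= j < n) 2 ^+ (j * d) * (2 ^ (- (lev j)%:Z)) ^+ d) ->
  tiny (fun j => ((2 ^ (- j)) ^+ d)%:E) s0 (U `\` \bigcap_s Gopen s).
Proof.
move=> divv.
pose i_ j := maxn j (lev j).
have i_ge j : (j <= i_ j)%N by exact: leq_maxl.
have divi J : exists n, 1 <= \sum_(J <= j < n) 2^-1 ^+ ((i_ j - j) * d) :> R.
  apply: (divergent_min (J0 := 0%N) divv) => [j|j _|j _].
  - by rewrite exprn_ge0.
  - by rewrite mulr_ge0 ?exprn_ge0 // ltW ?pow2_gt0.
  have -> : 2^-1 ^+ ((i_ j - j) * d) = 2 ^+ (j * d) * (2 ^ (- (i_ j)%:Z)) ^+ d :> R.
    rewrite !exprM -exprMn; congr (_ ^+ _).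
    by rewrite exprVn !exprnP invr_expz -pow2D; congr (_ ^ _); have := i_ge j; lia.
  rewrite /i_ ge_min; have [lj|jl] := leqP (lev j) j; last by rewrite lexx orbT.
  by rewrite exprM -exprMn exprnP -pow2D subrr expr0z expr1n lexx.
have key (s : nat) (c : I) : 0 <= c.1 -> cube c `<=` U -> exists r : seq I, [/\ uniq r,
    forall a, a \in r -> sub a c /\ cube a `<=` Gopen s,
    forall a b, a \in r -> b \in r -> a != b -> cube a `&` cube b = set0 &
    vol c / 8 <= \sum_(a <- r) vol a].
  move=> c0 cU.
  have cg : c.1 = `|c.1|%N%:Z by rewrite gez0_abs.
  have [sel [us ss ds vs]] := select_Gopen s 0 cg cU i_ge divi.
  exists [seq a.1 | a <- sel]; split.
  - rewrite map_inj_in_uniq // => a b asel bsel e; apply: ds => //.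
    by exists (corner a.1); rewrite -e; split; exact: cube_corner.
  - move=> _ /mapP[a asel ->]; have [_ ag ac [q [qg qa qX]]] := ss _ asel.
    split=> //; suff <- : q = a.1 by [].
    apply: (@sub_gen_eq R) => //; rewrite qg ag /i_ -maxnA maxnn //.
  - move=> _ _ /mapP[a asel ->] /mapP[b bsel ->] ab.
    apply/seteqP; split=> // x [ax bx]; move/negP: ab; apply.
    by rewrite (ds _ _ asel bsel) //; exists x.
  - by rewrite big_map.
pose E n : set V := if (pickle_inv n : option (nat * I)) is Some (s, c) then
  if `[< Order.max s0 0 <= c.1 /\ cube c `<=` U >] then cube c `\` Gopen s else set0 else set0.
have UE : U `\` \bigcap_s Gopen s `<=` \bigcup_n E n.
  move=> x [Ux nG].
  have [s ns] : exists s, ~ Gopen s x.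
    by apply: contrapT => h; apply: nG => s _; apply: contrapT => h'; apply: h; exists s.
  have [n nP] := open_cube oU Ux.
  pose j := Order.max (Order.max s0 0) n%:Z.
  exists (pickle (s, cof j x)); first by [].
  rewrite /E pickleK_inv; rewrite ifT; first by split=> //; exact: cube_cof.
  apply/asboolP; split; first by rewrite /= /j le_max lexx.
  by apply: nP; rewrite /j le_max lexx orbT.
apply: (tiny_subset UE); apply: tiny_bigcup => [j _|n].
  by rewrite lee_fin exprn_ge0 // ltW ?pow2_gt0.
rewrite /E; case: pickle_inv => [[s c]|].
  case: ifPn => [/asboolP[sc cU]|_].
    have c0 : 0 <= c.1 by apply: le_trans sc; rewrite le_max lexx orbT.
    have s0c : s0 <= c.1 by apply: le_trans sc; rewrite le_max lexx.
    move=> e e0; have vc := vol_gt0 (R := R) c.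
    have [|m mP] := @expr_small R (7 / 8) (e / vol c) _ (divr_gt0 e0 vc).
      by apply/andP; split; lra.
    have [A [A1 A2 A3]] := cube_remainder (key s) m c0 cU.
    exists A; split=> [C /A1|//|]; first exact: le_trans.
    apply: (le_trans A3); rewrite lee_fin ltW //.
    by rewrite -ltr_pdivlMr.
  by move=> e e0; exists set0; split=> //; rewrite esum_set0 lee_fin ltW.
by move=> e e0; exists set0; split=> //; rewrite esum_set0 lee_fin ltW.
Qed.

Lemma cbox_ex (y : V) : exists M, cbox M y.
Proof.
have h (i : 'I_d) : exists n : nat, `|y ord0 i| < n%:R.
  by exists (Num.bound `|y ord0 i|); exact: archi_boundP.
have [f fP] := choice h.
exists (\max_i f i)%N => i; rewrite !mxE.
have : (f i)%:R <= (\max_i f i)%:R :> R by rewrite ler_nat leq_bigmax.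
by have := fP i; rewrite ltr_norml; move: (_%:R) (_%:R) => a b; lra.
Qed.

Lemma reach_cbox (M : nat) : exists M', forall y z, cbox M y ->
  N (y - z) < 1 -> cbox M' z.
Proof.
have [C C0 CP] := norm_lower nN d0.
exists (M + (Num.bound C).+1)%N => y z yM yz i; rewrite !mxE.
have h1 : `|(y - z) ord0 i| <= C.
  by apply: (le_trans (CP _ i)); rewrite ler_piMr ?(ltW C0) // ltW.
have := yM i; rewrite !mxE natrD.
have h2 := archi_boundP (ltW C0).
have h3 : C < (Num.bound C).+1%:R by apply: lt_trans h2 _; rewrite ltr_nat.
move: h1; rewrite !mxE ler_norml.
by move: ((Num.bound C).+1%:R) (M%:R) h3 => a b h3; lra.
Qed.

Lemma measurable_reachS y : measurable (reach 0 y `&` Sset U).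
Proof. by apply: measurableI; [exact: measurable_reach|exact: measurable_Sset]. Qed.

(** Only finitely many points with radius above [delta s] can reach [y], so an infinite count forces
    smaller radii at every scale. Conversely, under a finite count the masses of [shoot 0 s y] would
    decrease to [0], whereas they are nonzero integers. *)
Lemma limsup_Gopen :
  [set y | Q (reach 0 y `&` Sset U) = +oo%E] = \bigcap_s Gopen s.
Proof.
apply/seteqP; split=> y.
  move=> /= Qoo s _; apply/negP => /eqP h.
  have [M yM] := cbox_ex y; have [M' M'P] := reach_cbox M.
  have [K K0 KP] := QU M'.
  have : (Q (reach 0 y `&` Sset U) <= Q (slab s (cbox M')))%E.
    apply: (@le_trans _ _ (Q (shoot 0 s y `|` slab s (cbox M')))).
      apply: le_measure; rewrite ?inE; first exact: measurable_reachS.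
        apply: measurableU; first exact: measurable_shoot.
        exact: measurable_slab_box.
      move=> z [z1 [/andP[z2 z3] z4]]; have [zs|sz] := leP z.1 (delta s).
        by left; split=> //; split=> //; apply/andP.
      right; split; first by apply/andP; split.
      apply: (M'P y) => //; rewrite /reach /= subr_gt0 in z1.
      exact: lt_le_trans z1 z3.
    have mS : measurable (slab s (cbox M' : set V)) by exact: measurable_slab_box.
    have hh : (Q (shoot 0 s y `|` slab s (cbox M')) <=
               Q (shoot 0 s y) + Q (slab s (cbox M')))%E.
      by apply: measureU2 => //; exact: measurable_shoot.
    by apply: (le_trans hh); rewrite h add0e.
  rewrite Qoo leye_eq => /eqP e; have := KP s; rewrite e leye_eq; by [].
move=> Gy /=.
have [//|[k kE]] := Qint (measurable_reachS y).
exfalso.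
have fin0 : (Q (shoot 0 0 y) < +oo)%E.
  apply: (@le_lt_trans _ _ (Q (reach 0 y `&` Sset U))); last by rewrite kE ltry.
  apply: le_measure; rewrite ?inE; first exact: measurable_shoot.
    exact: measurable_reachS.
  by move=> z [[z1 _] z2].
have ni : nonincreasing_seq (fun s => shoot 0 s y).
  move=> s t st; apply/subsetPset => z [[z1 z2] z3]; split=> //; split=> //.
  by apply: (le_trans z2); rewrite ler_delta // lez_nat.
have cap0 : \bigcap_s shoot 0 s y = set0.
  apply/seteqP; split=> // z zs; have [_ [/andP[z0 _] _]] := zs 0%N Logic.I.
  have [n nP] := delta_small D0 z0; have [[_ z2] _] := zs n Logic.I.
  by have := le_lt_trans z2 (nP n%:Z (lexx _)); rewrite ltxx.
have cv : (Q \o (fun s => shoot 0 s y)) s @[s --> \oo] --> Q (\bigcap_s shoot 0 s y).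
  apply: nonincreasing_cvg_mu => //.
    by move=> s; exact: measurable_shoot.
  by rewrite cap0; exact: measurable0.
rewrite cap0 measure0 in cv.
have : (1 <= (0 : \bar R))%E.
  apply: (cvge_ge _ cv); exists 0%N => // s _ /=.
  by apply: (Q_ge1); [exact: measurable_shoot|exact: Gy].
by rewrite lee_fin ler10.
Qed.

(** * The natural covering of the limsup set *)

Definition band (s : nat) (X : set V) : set (BSp R d) := slab s.+1 X `\` slab s X.

Lemma measurable_band s (a b : V) : measurable (band s (box a b)).
Proof. by apply: measurableD; exact: measurable_slab_box. Qed.

(* Summation by parts: the counting measure of the radii is dominated by
   [mass], so it integrates the weights [u] as well. *)
Lemma band_sum (M : nat) (s0 : nat) (u : nat -> R) (B : R) :
  (forall s, (s0 <= s)%N -> 0 <= u s) ->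
  (forall s, (s0 <= s)%N -> u s.+1 <= u s) ->
  (forall n, \sum_(s0 <= s < n) (mass s.+1 - mass s) * u s <= B) ->
  exists B', forall n, \sum_(s0 <= s < n) u s * fine (Q (band s (cbox M))) <= B'.
Proof.
move=> u0 um uB; have [K K0 KP] := QU M.
pose q s := fine (Q (slab s (cbox M))).
have qE s : Q (slab s (cbox M)) = (q s)%:E.
  by rewrite fineK // ge0_fin_numE // (le_lt_trans (KP s)) // ltry.
have qK s : q s <= K * (1 + mass s) by rewrite -lee_fin -qE.
have q0 s : 0 <= q s by rewrite -lee_fin -qE.
have bE s : fine (Q (band s (cbox M))) = q s.+1 - q s.
  have e : (Q (band s (cbox M)) = Q (slab s.+1 (cbox M)) - Q (slab s (cbox M)))%E.
    have lt : (Q (slab s.+1 (cbox M)) < +oo)%E by rewrite qE ltry.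
    have := measureD (measurable_slab_box D s.+1 _ _) (measurable_slab_box D s _ _) lt.
    by move=> ->; rewrite setIidr //; exact: slab_mono.
  by rewrite e !qE.
have um' s : (s0 <= s)%N -> u s <= u s0.
  elim: s => [|s IHs]; first by rewrite leqn0 => /eqP ->.
  rewrite leq_eqVlt => /orP[/eqP ->//|]; rewrite ltnS => ss.
  by apply: le_trans (um _ ss) (IHs ss).
exists (K * (1 + mass s0) * u s0 + K * B).
move=> n; have [sn|ns] := leqP s0 n; last first.
  have B0 : 0 <= B by have := uB s0; rewrite big_geq.
  by rewrite big_geq ?(ltnW ns) // addr_ge0 ?mulr_ge0 ?addr_ge0 ?mass_ge0 ?u0.
(* The boundary term [(q n' - K * (1 + mass n')) * u n'] is nonpositive by the bound on counts and
   disappears at the end. *)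
have aux n' : (s0 <= n')%N ->
    \sum_(s0 <= s < n') u s * fine (Q (band s (cbox M))) <=
    (q n' - K * (1 + mass n')) * u n' + K * (1 + mass s0) * u s0 +
      K * \sum_(s0 <= s < n') (mass s.+1 - mass s) * u s.
  elim: n' => [|m IHm].
    rewrite leqn0 => /eqP e; rewrite e !big_geq // mulr0 addr0 mulrBl.
    by rewrite subrK mulr_ge0 // u0 // e.
  rewrite leq_eqVlt => /orP[/eqP e|].
    rewrite -e !big_geq // mulr0 addr0 mulrBl subrK mulr_ge0 // u0 //.
  rewrite ltnS => sm; rewrite !big_nat_recr //= bE.
  have := IHm sm; have := um _ sm; have := u0 _ sm; have := u0 _ (leqW sm).
  have := qK m.+1; have := mass_ge0 D0 hnu m.
  set X := \sum_(_ <= _ < _) _; set Y := \sum_(_ <= _ < _) _.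
  move: (u m) (u m.+1) (q m) (q m.+1) (mass m) (mass m.+1) X Y.
  move=> a b p p' w w' X Y w0 pK b0 a0 ba H.
  have h1 : (p' - K * (1 + w')) * a <= (p' - K * (1 + w')) * b by nra.
  have -> : (p' - K * (1 + w')) * b + K * (1 + mass s0) * u s0 +
      K * (Y + (w' - w) * a) = (p' - K * (1 + w')) * b + K * (1 + mass s0) * u s0 +
      K * Y + K * (w' - w) * a by ring.
  have e2 : X + a * (p' - p) = X + a * p' - a * p by ring.
  rewrite e2; move: H h1; rewrite !mulrBl !mulrDr !mulr1.
  by lra.
apply: (le_trans (aux _ sn)).
have : K * \sum_(s0 <= s < n) (mass s.+1 - mass s) * u s <= K * B by rewrite ler_wpM2l.
have : (q n - K * (1 + mass n)) * u n <= 0.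
  by rewrite mulr_le0_ge0 ?subr_le0 ?u0.
move: (_ * _) (K * _) (K * B) (K * _ * _) => a b e f; lra.
Qed.

(** A point covered by a ball with radius in band [s] lies in a neighbour of the cube of generation
    [s] containing the centre. At most [b s] such cubes carry mass, so the cost is bounded by a
    constant times a tail of the sum of [u s * b s]. *)
Lemma upper_tiny (w : int -> \bar R) (u : nat -> R) (s0 : nat) (B : R) :
  (forall s : nat, (s0 <= s)%N -> w s%:Z = (u s)%:E) ->
  (forall s, (s0 <= s)%N -> 0 <= u s) ->
  (forall s, (s0 <= s)%N -> u s.+1 <= u s) ->
  (forall n, \sum_(s0 <= s < n) (mass s.+1 - mass s) * u s <= B) ->
  forall (M : nat) (t0 : int), tiny w t0 ((\bigcap_s Gopen s) `&` cbox M).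
Proof.
move=> wu u0 um uB M t0 e e0.
have [M' M'P] := reach_cbox M.
have [B' B'P] := band_sum M' u0 um uB.
have [K KP] := shift_near d0 nN D0.
pose F := {ffun 'I_d -> 'I_(K + K).+1}.
pose k : R := #|{: F}|%:R.
pose b s := fine (Q (band s (cbox M'))).
have mb s : measurable (band s (cbox M' : set V)) by exact: measurable_band.
have bE s : Q (band s (cbox M')) = (b s)%:E.
  rewrite /b fineK // ge0_fin_numE //.
  have [K0 _ K0P] := QU M'; apply: (@le_lt_trans _ _ (Q (slab s.+1 (cbox M')))).
    apply: le_measure; rewrite ?inE //; first exact: measurable_slab_box.
    by move=> z [].
  by apply: le_lt_trans (K0P _) _; rewrite ltry.
have b0 s : 0 <= b s by rewrite -lee_fin -bE.
have k0 : 0 < k + 1 by rewrite ltr_wpDl.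
have ub0 s : (s0 <= s)%N -> 0 <= u s * b s by move=> ss; rewrite mulr_ge0 ?u0.
have [s1 [s01 t1 s1P]] :=
  tail_small `|t0|%N ub0 B'P (divr_gt0 e0 k0).
pose bX (s : nat) (c : I) : set (BSp R d) := band s (cube c `&` cbox M').
have mbX s c : measurable (bX s c).
  have mX : measurable ([set z | (cube c `&` cbox M') z.2] : set (BSp R d)).
    rewrite (_ : [set z | _] = [set z : BSp R d | cube c z.2] `&` [set z : BSp R d | cbox M' z.2]) //.
    by apply: measurableI; rewrite ?cube_box; exact: measurable_snd_box.
  by apply: measurableD; exact: measurable_cyl.
pose H (s : nat) : set I := [set c | c.1 = s%:Z /\ Q (bX s c) != 0%E].
pose Fam (s : nat) : set I := \bigcup_(c in H s) (range (@shift d K c)).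
have gFam s C : Fam s C -> C.1 = s%:Z by move=> [c [cs _] [l _ <-]].
exists (\bigcup_(s in [set s | (s1 <= s)%N]) Fam s); split.
- by move=> C [s /= ss /gFam ->]; lia.
- move=> y [Gy yM].
  have Gy1 : Q (shoot 0 s1 y) != 0%E by exact: Gy.
  have inP (s : nat) (c : I) z : c.1 = s%:Z -> shoot 0 s1 y z -> z.1 <= delta s ->
      delta s.+1 < z.1 -> cube c z.2 -> bX s c z.
    move=> cs [[z1 z2] [/andP[z3 z4] z5]] zs zS cz; split.
      split; first by apply/andP; split.
      split=> //; apply: (M'P y) => //; rewrite /reach /= subr_gt0 in z1.
      exact: lt_le_trans z1 z4.
    by move=> [/andP[h _] _]; have := lt_le_trans h zs; rewrite ltxx.
  have sP z : shoot 0 s1 y z -> exists2 s : nat, (s1 <= s)%N & delta s.+1 < z.1 <= delta s.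
    move=> [[z1 z2] [/andP[z3 z4] z5]].
    have [n nP] := delta_small D0 z3.
    have exn : exists n : nat, delta n < z.1 by exists n; exact: nP.
    case: (ex_minnP exn) => m mz mmin.
    have s1m : (s1 < m)%N.
      rewrite ltnNge; apply/negP => ms1; have := lt_le_trans mz z2.
      by rewrite ltNge ler_delta // lez_nat ms1.
    case: m mz mmin s1m => // m mz mmin s1m; exists m; first by rewrite -ltnS.
    rewrite mz /= leNgt; apply/negP => h.
    by have := mmin _ h; rewrite ltnn.
  suff [s [c [ss cs cH [z zc]]]] : exists s c, [/\ (s1 <= s)%N, c.1 = s%:Z,
      Q (bX s c) != 0%E & exists z, [/\ shoot 0 s1 y z, z.1 <= delta s & cube c z.2]].
    have [[[z1 _] _] zd cz] := zc.
    have yz : N (y - z.2) < delta s.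
      by rewrite /reach /= subr_gt0 in z1; exact: lt_le_trans z1 zd.
    have [l lE] := KP s z.2 y c yz cs cz.
    exists (cof s%:Z y); last exact: cube_cof.
    by exists s => //; exists c => //; rewrite lE; exists l.
  (* If all cubes around such centres had zero mass, [shoot 0 s1 y] would be covered by countably
     many null sets. *)
  apply: contrapT => nex; move/negP: Gy1; apply.
  pose E n : set (BSp R d) := if (pickle_inv n : option (nat * I)) is Some (s, c) then
    if `[< [/\ (s1 <= s)%N, c.1 = s%:Z & Q (bX s c) = 0%E] >] then bX s c else set0 else set0.
  have mE n : measurable (E n).
    by rewrite /E; case: pickle_inv => [[s c]|] //; case: ifP.
  have E0 n : Q (E n) = 0%E.
    rewrite /E; case: pickle_inv => [[s c]|]; last by rewrite measure0.
    by case: ifPn => [/asboolP[]//|_]; rewrite measure0.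
  rewrite eq_le measure_ge0 andbT -(null_bigcup mE E0).
  apply: le_measure; rewrite ?inE.
  - exact: measurable_shoot.
  - by apply: bigcup_measurable.
  move=> z zs; have [s ss /andP[zS zd]] := sP z zs.
  pose c := cof s%:Z (z.2 : V).
  have cz : cube c z.2 by exact: cube_cof.
  exists (pickle (s, c)); first by [].
  rewrite /E pickleK_inv ifT; first exact: inP.
  apply/asboolP; split=> //; apply: contrapT => /eqP h.
  by apply: nex; exists s, c; split=> //; exists z.
have ws s : (s1 <= s)%N -> w s%:Z = (u s)%:E.
  by move=> ss; apply: wu; exact: leq_trans s01 ss.
have u0' s : (s1 <= s)%N -> 0 <= u s.
  by move=> ss; apply: u0; exact: leq_trans s01 ss.
have FamS s : (s1 <= s)%N -> (\esum_(C in Fam s) w C.1 <= (k * (u s * b s))%:E)%E.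
  move=> ss.
  apply: (@le_trans _ _ (\esum_(c in H s) \esum_(C in range (@shift d K c)) w C.1)%E).
    by apply: le_esum_cover => // c C [cs _] [l _ <-]; rewrite /= cs ws // lee_fin u0'.
  apply: (@le_trans _ _ (\esum_(c in H s) (k * u s)%:E)%E).
    apply: le_esum => c [cs _].
    apply: (@le_trans _ _ (\esum_(l in [set` enum {: F}]) \esum_(C in [set @shift d K c l]) w C.1)%E).
      apply: le_esum_cover => [_ [l _ <-]|l C _ ->]; last by rewrite /= cs ws // lee_fin u0'.
      by exists l => //=; rewrite mem_enum.
    rewrite (eq_esum (b := fun=> (u s)%:E)) => [|l _]; last first.
      by rewrite esum_set1 /= cs ws // lee_fin u0'.
    rewrite esum_seq ?enum_uniq // => [|l _]; last exact: u0'.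
    by rewrite lee_fin big_const_seq count_predT iter_addr_0 -cardE -[leLHS]mulr_natl.
  rewrite mulrA; apply: esum_cst_le; first by rewrite mulr_ge0 // u0'.
  move=> r ur rH; rewrite -lee_fin -bE.
  apply: (@size_le_measure _ r (fun c => if c \in r then bX s c else set0)) => //.
  - by move=> c; case: ifP.
  - by move=> c cr; rewrite cr; apply: (Q_ge1) => //; case: (rH _ cr).
  - move=> c; case: ifP => // _ z [[z1 [cz z2]] z3]; split=> //.
    by move=> [z4 z5]; apply: z3.
  - move=> c c' z; case: ifPn => // cr [[_ [cz _]] _]; case: ifPn => // c'r [[_ [c'z _]] _].
    apply: (@cube_uniq R d _ _ z.2) => //.
    by have [-> _] := rH _ cr; have [-> _] := rH _ c'r.
apply: (@le_trans _ _ (\esum_(s in [set s | (s1 <= s)%N]) \esum_(C in Fam s) w C.1)%E).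
  by apply: le_esum_cover => // s C /= ss /gFam ->; rewrite ws // lee_fin u0'.
apply: (@le_trans _ _ (\esum_(s in [set s | (s1 <= s)%N]) (k * (u s * b s))%:E)%E).
  by apply: le_esum => s ss; exact: FamS.
rewrite -nneseries_esum; last first.
  by move=> s ss; rewrite lee_fin !mulr_ge0 ?u0' // /k.
apply: lime_le; first apply: is_cvg_nneseries_cond => s _ ss.
  by rewrite lee_fin !mulr_ge0 ?u0' // /k.
apply: nearW => n /=.
have : \sum_(s1 <= s < n) u s * b s <= e / (k + 1) by exact: s1P.
have -> : (\sum_(0 <= s < n | (s1 <= s)%N) (k * (u s * b s))%:E = (k * \sum_(s1 <= s < n) u s * b s)%:E)%E.
  rewrite sumEFin mulr_sumr; congr EFin.
  have [sn|ns] := leqP s1 n; last first.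
    rewrite (big_geq (ltnW ns)) big_nat_cond big1 // => s /andP[/andP[_ sn] ss].
    by have := leq_ltn_trans ss sn; rewrite ltnNge (ltnW ns).
  rewrite (big_cat_nat (leq0n s1) sn) /= big_nat_cond big1 ?add0r; last first.
    by move=> s /andP[/andP[_ h1] h2]; have := leq_ltn_trans h2 h1; rewrite ltnn.
  rewrite [LHS]big_nat_cond [RHS]big_nat_cond; apply: eq_bigl => s.
  by rewrite andbT; case: (leqP s1 s) => //=; rewrite ?andbT.
move=> h; rewrite lee_fin; have kk : 0 <= k by rewrite /k.
apply: (le_trans (ler_wpM2l kk h)).
by rewrite mulrCA ler_piMr ?(ltW e0) // ler_pdivrMr // mul1r lerDl.
Qed.

Local Notation F := (\bigcap_s Gopen s).

(** The bound passes from [1/16] for [v] on the open sets to the full weight for the larger [u], and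
    then to the intersection. *)
Lemma limsup_content (s0 : nat) (u v : int -> R) :
  @weight R d s0 u -> @weight R d s0 v ->
  (forall i j, s0%:Z <= i -> i <= j -> u i * v j <= u j * v i) ->
  (forall M : R, exists n : int, forall j, n <= j -> M * v j <= u j) ->
  (forall J B, exists n, B <= \sum_(J <= j < n) 2 ^+ (j * d) * v (lev j)) ->
  forall (lam : I) (A : set I), s0%:Z <= lam.1 -> cube lam `<=` U ->
  (forall C, A C -> sub C lam) -> covers A (F `&` cube lam) ->
  ((u lam.1)%:E <= \esum_(C in A) (u C.1)%:E)%E.
Proof.
move=> wu wv uvm uvoo vdiv.
have Tsub lam mu : cube lam `<=` U -> sub mu lam -> cube mu `<=` U.
  by move=> lU [_ ml]; exact: subset_trans ml lU.
apply: (@gdelta_content R d s0 u Gopen [set lam | cube lam `<=` U] wu) => //.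
  by move=> k; exact: open_Gopen.
move=> k; apply: (@content_improve R d s0 u v (1 / 16)) => //.
  by apply/andP; split; lra.
move=> lam A sl lU; have [g gE] : exists g : nat, lam.1 = g%:Z.
  exists `|lam.1|%N; rewrite gez0_abs //; exact: le_trans sl.
by apply: (content_lower wv vdiv gE) => //; rewrite -gE.
Qed.

Lemma limsup_tiny (w : int -> \bar R) (u : nat -> R) (s0 : nat) (B : R) :
  (forall s : nat, (s0 <= s)%N -> w s%:Z = (u s)%:E) ->
  (forall j, (0 <= w j)%E) ->
  (forall s, (s0 <= s)%N -> u s.+1 <= u s) ->
  (forall n, \sum_(s0 <= s < n) (mass s.+1 - mass s) * u s <= B) ->
  forall t0 : int, tiny w t0 F.
Proof.
move=> wu w0 um uB t0.
have -> : F = \bigcup_M (F `&` cbox M).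
  by apply/seteqP; split=> [y Fy|y [M _ []] //]; have [M My] := cbox_ex y; exists M.
apply: tiny_bigcup => // M.
apply: (upper_tiny wu _ um uB) => s ss.
by rewrite -lee_fin -wu.
Qed.

(** * Lebesgue and Hausdorff measures of the limsup set *)

Lemma ginf_level g : G_infty d g -> exists e : R, exists s0 : nat,
  [/\ regular (d := d) e (fun r => fine (gd d g r%:E)), delta s0 <= e,
    forall r, 0 < r <= e -> gd d g r%:E = (fine (gd d g r%:E))%:E &
    forall r, 0 < r <= e -> 0 < fine (gd d g r%:E)].
Proof.
move=> gi; have [e [rg _ fin pos]] := ginf_regular gi; have [e0 _ _ _] := rg.
have [s0 s0P] := delta_small D0 e0; exists e, s0; split=> //.
by apply: ltW; exact: s0P.
Qed.

Lemma gd_sums_bounded g (e : R) (s0 : nat) : G_infty d g ->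
  regular (d := d) e (fun r => fine (gd d g r%:E)) ->
  (forall r, 0 < r <= e -> gd d g r%:E = (fine (gd d g r%:E))%:E) ->
  delta s0 <= e -> (\int[nu]_(r in unit) gd d g r%:E < +oo)%E ->
  exists B, forall n, \sum_(s0 <= s < n) (mass s.+1 - mass s) * fine (gd d g (delta s)%:E) <= B.
Proof.
move=> gi rg fin se foo; have [[g0 _] _] := gi.
have gd0 r : (0 <= gd d g r)%E by exact: gd_ge0.
apply: (finite_mass_sums D0 hnu (measurable_gd gi) _ rg fin _ se foo) => // r _.
by rewrite fine_ge0.
Qed.

Lemma gd_levels_unbounded g (e : R) (s0 : nat) : G_infty d g ->
  regular (d := d) e (fun r => fine (gd d g r%:E)) ->
  (forall r, 0 < r <= e -> gd d g r%:E = (fine (gd d g r%:E))%:E) ->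
  delta s0 <= e -> (\int[nu]_(r in unit) gd d g r%:E = +oo)%E ->
  forall J B, exists n, B <= \sum_(J <= j < n) 2 ^+ (j * d) * fine (gd d g (delta (lev j))%:E).
Proof.
move=> gi rg fin se foo; have [[g0 _] _] := gi.
have gd0 r : (0 <= gd d g r)%E by exact: gd_ge0.
have v0 s : 0 <= fine (gd d g (delta s)%:E) by rewrite fine_ge0.
have dn : 0 <= (2 : R) ^+ d by rewrite exprn_ge0.
have [_ mono _ _] := rg.
apply: (lev_divergent d0 D0 hnu dn v0).
- move=> s t ss st; apply: mono; rewrite ?delta_gt0 ?ler_delta ?lez_nat //.
  by have /andP[] := @delta_range R D D0 e s0 s se ss.
- by move=> s ss; exact: (regular_halve D0 rg se ss).
- apply: (infinite_mass_sums D0 hnu (measurable_gd gi) _ _ rg fin _ se foo) => // [r r0|r _].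
    exact: gd_bounded.
  by rewrite fine_ge0.
Qed.

Lemma cube_in_U (s0 : nat) (W : set V) : open W -> W !=set0 ->
  exists lam : I, s0%:Z <= lam.1 /\ cube lam `<=` W.
Proof.
move=> oW [x Wx]; have [n nP] := open_cube oW Wx.
exists (cof (maxn n s0)%:Z x); split; first by rewrite lez_nat leq_maxr.
by apply: nP; rewrite lez_nat leq_maxl.
Qed.

Lemma pow_delta (j : int) : (2 ^ (- j)) ^+ d = delta j ^+ d / D ^+ d.
Proof. by rewrite -expr_div_n /delta mulfK // gt_eqF. Qed.

Lemma limsup_null : (\int[nu]_(r in unit) (r ^+ d)%:E < +oo)%E ->
  lebesgue_d (F `&` U) = 0%E.
Proof.
move=> foo; have [s0 s0P] := delta_small D0 (@ltr01 R).
have [B hB] : exists B, forall n, \sum_(s0 <= s < n) (mass s.+1 - mass s) * delta s ^+ d <= B.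
  apply: (finite_mass_sums D0 hnu _ _ (regular_pow d0) _ _ _ foo) => //.
  - by apply/measurable_EFinP; apply: measurable_funTS; apply: exprn_measurable.
  - by move=> r /andP[r0 _]; rewrite lee_fin exprn_ge0 // ltW.
  - by move=> r /andP[r0 _]; rewrite exprn_ge0 // ltW.
  - by apply: ltW; exact: s0P.
apply: (@lebesgue_d_null R d 0) => //.
apply: (@tiny_subset _ _ _ _ _ F); first by move=> y [].
apply: (limsup_tiny (u := fun s : nat => delta s ^+ d / D ^+ d)
  (s0 := s0) (B := B / D ^+ d)) => // [s _|j|s _|n].
- by rewrite pow_delta.
- by rewrite lee_fin exprn_ge0 // ltW // pow2_gt0.
- apply: ler_wpM2r; first by rewrite invr_ge0 exprn_ge0 // ltW.
  have [p q] := (@delta_gt0 R D D0 s, @delta_gt0 R D D0 s.+1).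
  by apply: lerXn2r; rewrite ?nnegrE ?ler_delta ?lez_nat // ltW.
rewrite (eq_bigr (fun s : nat => ((mass s.+1 - mass s) * delta s ^+ d) / D ^+ d)); last first.
  by move=> s _; rewrite mulrA.
by rewrite -mulr_suml ler_wpM2r // invr_ge0 exprn_ge0 // ltW.
Qed.

Lemma limsup_full : (\int[nu]_(r in unit) (r ^+ d)%:E = +oo)%E ->
  lebesgue_d (U `\` F) = 0%E.
Proof.
move=> foo; have [s0 s0P] := delta_small D0 (@ltr01 R).
have se : delta s0 <= 1 by apply: ltW; exact: s0P.
have dD : 0 < D ^+ d by rewrite exprn_gt0.
apply: (@lebesgue_d_null R d 0) => //.
apply: (full_measure) => J B.
have dn : 0 <= (2 : R) ^+ d by rewrite exprn_ge0.
have v0 s : 0 <= delta s ^+ d by rewrite exprn_ge0 // ltW // delta_gt0.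
have [_ mono _ _] := regular_pow (R := R) d0.
have div : forall J B, exists n, B <= \sum_(J <= j < n) 2 ^+ (j * d) * delta (lev j) ^+ d.
  apply: (lev_divergent d0 D0 hnu (v := fun s : nat => delta s ^+ d) (s0 := s0) dn) => //.
  - move=> s t ss st; apply: mono; rewrite ?delta_gt0 ?ler_delta ?lez_nat //.
    by have /andP[] := @delta_range R D D0 1 s0 s se ss.
  - by move=> s ss; exact: (regular_halve D0 (regular_pow d0) se ss).
  - apply: (infinite_mass_sums D0 hnu _ _ _ (regular_pow d0) _ _ se foo) => //.
    + by apply/measurable_EFinP; apply: measurable_funTS; apply: exprn_measurable.
    + by move=> r /andP[r0 _]; rewrite lee_fin exprn_ge0 // ltW.
    + move=> e e0; exists 1 => // r /andP[er r1].
      by rewrite lee_fin exprn_ile1 // ltW // (lt_trans e0).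
    + by move=> r /andP[r0 _]; rewrite exprn_ge0 // ltW.
have [n nB] := div J (B * D ^+ d); exists n.
rewrite (eq_bigr (fun j => 2 ^+ (j * d) * delta (lev j) ^+ d / D ^+ d)); last first.
  by move=> j _; rewrite pow_delta mulrA.
by rewrite -mulr_suml ler_pdivlMr.
Qed.

Lemma limsup_hausdorff_null g : G_infty d g ->
  (\int[nu]_(r in unit) gd d g r%:E < +oo)%E -> hausdorff N g (F `&` U) = 0%E.
Proof.
move=> gi foo; have [gg _] := gi; have [g0 _] := gg.
have [e [s0 [rg se fin pos]]] := ginf_level gi.
have [B hB] := gd_sums_bounded gi rg fin se foo.
have [_ mono _ _] := rg.
apply: (hausdorff_null nN D0 hD gg) => t0.
apply: (tiny_gd_gauge D0 gi) => t1.
apply: (@tiny_subset _ _ _ _ _ F); first by move=> y [].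
apply: (limsup_tiny (s0 := s0) (B := B) (u := fun s : nat => fine (gd d g (delta s)%:E))) => // [s ss|j|s ss].
- by rewrite -fin //; exact: delta_range se _.
- exact: gd_ge0.
- have /andP[p q] := @delta_range R D D0 e s0 s se ss.
  by apply: mono; rewrite ?delta_gt0 ?ler_delta ?lez_nat.
Qed.

(** A concave profile [chi] of the ratio of gauge to volume yields a weight [v], negligible against
    [u], whose level sums still diverge. The full content bound for [u] then contradicts the cheap
    coverings that a null Hausdorff measure provides. *)
Lemma limsup_hausdorff_pos g : G_infty d g ->
  (\int[nu]_(r in unit) gd d g r%:E = +oo)%E -> hausdorff N g (F `&` U) <> 0%E.
Proof.
move=> gi foo hF; have [gg _] := gi; have [g0 _] := gg.
have [e [s0 [rg se fin pos]]] := ginf_level gi.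
pose u (j : int) := fine (gd d g (delta j)%:E).
have wu : @weight R d s0 u by exact: (regular_weight D0 rg se).
have u0 j : 0 <= u j by rewrite fine_ge0 // gd_ge0.
pose P (j : int) : R := (2 ^ (- j)) ^+ d.
have P0 j : 0 < P j by rewrite exprn_gt0 // pow2_gt0.
pose X j := u j / P j.
have X0 j : 0 <= X j by rewrite divr_ge0 // ltW.
have XP j : X j * P j = u j by rewrite divfK // gt_eqF.
have udiv := gd_levels_unbounded gi rg fin se foo.
pose a j := 2 ^+ (j * d) * u (lev j).
have a0 j : 0 <= a j by rewrite mulr_ge0 // exprn_ge0.
have [chi [c0 cm cr coo cdiv]] := divergent_profile a0 (fun j => X0 (lev j)) udiv.
have [upos umono urat] := wu.
have Xpos j : s0%:Z <= j -> 0 < X j by move=> sj; rewrite divr_gt0 // upos.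
have Xm i j : s0%:Z <= i -> i <= j -> X i <= X j.
  move=> si ij; rewrite /X ler_pdivrMr // mulrAC ler_pdivlMr //; exact: urat.
pose v j := chi (X j) * P j.
have uvm i j : s0%:Z <= i -> i <= j -> u i * v j <= u j * v i.
  move=> si ij; rewrite -(XP i) -(XP j) /v.
  have -> : X i * P i * (chi (X j) * P j) = X i * chi (X j) * (P i * P j) by ring.
  have -> : X j * P j * (chi (X i) * P i) = X j * chi (X i) * (P i * P j) by ring.
  by rewrite ler_wpM2r ?mulr_ge0 ?(ltW (P0 _)) // cr ?Xpos ?Xm.
have wv : @weight R d s0 v.
  split.
  - by move=> j sj; rewrite mulr_gt0 // c0 // Xpos.
  - move=> i j si ij; rewrite -(ler_pM2l (upos _ si)); apply: (le_trans (uvm _ _ si ij)).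
    by rewrite ler_wpM2r ?umono // mulr_ge0 ?(ltW (P0 _)) // ltW // c0 // Xpos.
  - move=> i j si ij; rewrite -/(P i) -/(P j) /v.
    rewrite -!mulrA [P j * P i]mulrC ler_wpM2r ?mulr_ge0 ?(ltW (P0 _)) //.
    by rewrite cm // Xm.
(* The ratio [X] tends to infinity because [ell d g] is infinite, so [chi] is evaluated where it is
   negligible against its argument. *)
have uvoo M : exists n : int, forall j, n <= j -> M * v j <= u j.
  have [Y Y0 hY] := coo `|M| (normr_ge0 M).
  have [eta eta0 heta] := ginf_large (Y / D ^+ d) gi.
  have [n nP] := delta_small D0 eta0.
  exists (Num.max s0%:Z n%:Z) => j; rewrite ge_max => /andP[sj nj].
  have XY : Y <= X j.
    have dj := @delta_gt0 R D D0 j.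
    have := heta (delta j); rewrite dj nP // => /(_ isT).
    rewrite -gdK // fin ?(delta_range D0 se) // -EFinM lee_fin ler_pdivrMr ?exprn_gt0 //.
    by rewrite /X /P pow_delta invf_div mulrA mulrAC -/(u j).
  apply: (@le_trans _ _ (`|M| * v j)).
    by rewrite ler_wpM2r ?ler_norm // mulr_ge0 ?(ltW (P0 _)) // ltW // c0 // Xpos.
  by rewrite -(XP j) /v mulrA ler_wpM2r ?(ltW (P0 _)) // hY.
have vdiv J B : exists n, B <= \sum_(J <= j < n) 2 ^+ (j * d) * v (lev j).
  have y0 (j : nat) : 0 <= 2 ^+ (j * d) * P (lev j) by rewrite mulr_ge0 ?exprn_ge0 // ltW.
  have xy (j : nat) : X (lev j) * (2 ^+ (j * d) * P (lev j)) = a j by rewrite mulrCA XP.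
  have [n nB] := cdiv _ y0 xy J B; exists n; apply: (le_trans nB).
  by apply: ler_sum => j _; rewrite /v mulrCA.
have [lam [sl lU]] := cube_in_U s0 oU U0.
have [t lt] : exists t : nat, lam.1 = t%:Z.
  by exists `|lam.1|%N; rewrite gez0_abs //; exact: le_trans sl.
have tE := hausdorff_tiny d0 nN D0 gi hF t.
have : ((u lam.1)%:E <= 0)%E.
  apply: (tiny_content (w := fun j => gd d g (delta j)%:E) (X := F) (lam := lam) _ _ _ tE).
  - by move=> j; exact: gd_ge0.
  - by rewrite lt.
  - by move=> y [Fy ly]; split=> //; exact: lU.
  move=> A Asub cA.
  apply: (le_trans (limsup_content wu wv uvm uvoo vdiv sl lU Asub cA)).
  apply: le_esum => C AC; have [h _] := Asub _ AC.
  by rewrite -fin // (delta_range D0 se) // (le_trans sl).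
by rewrite lee_fin leNgt upos.
Qed.

(** * Membership in the large intersection class, and its converse *)

Lemma Minf_subset h (X Y : set V) : X `<=` Y -> (Minf N h X <= Minf N h Y)%E.
Proof.
move=> XY; apply: le_ereal_inf_tmp => _ [lam [h1 [h2 ->]]].
by apply: ereal_inf_lbound; exists lam; split=> //; split=> //; exact: subset_trans h2.
Qed.

(** Here [g_d] is itself the smaller weight and [h] the larger one: [prec] supplies the comparison
    required for self-improvement. Full content in the small cubes of [W] turns a covering of [F] in
    [W] into one of [W]. *)
Lemma limsup_large g : G_infty d g -> (\int[nu]_(r in unit) gd d g r%:E = +oo)%E ->
  large_int N g U F.
Proof.
move=> gi foo; have [gg _] := gi.
split; first by exists Gopen; split=> // s; exact: open_Gopen.
move=> h gh nh phg W oW WU.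
apply/eqP; rewrite eq_le Minf_subset => [|y []//]; rewrite andTb.
have [e [s0 [rg se fin pos]]] := ginf_level gi; have [e0 _ _ _] := rg.
have [e2 [rh hfin h0 eps]] := gauge_regular gh nh; have [e20 _ _ _] := rh.
pose G r := fine (gd d g r%:E); pose H r := fine (h r%:E).
(* The degenerate case of [prec] is excluded, as [g_d] is positive near [0]. *)
have [[e3 e30 hz]|[[e3 e30 hmono] hoo]] := phg.
  have ee : 0 < Num.min e e3 by rewrite lt_min e0.
  have := pos (Num.min e e3); rewrite hz ?ltxx; last 2 first.
  - exact: ltW.
  - by rewrite ge_min lexx orbT.
  by rewrite ee ge_min lexx => /(_ isT).
have [e4 e40 Hpos] := hoo 0.
pose E := Num.min (Num.min e e2) (Num.min e3 (e4 / 2)).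
have E0 : 0 < E by rewrite !lt_min e0 e20 e30 divr_gt0.
have Ee : E <= e by rewrite !ge_min lexx.
have Ee2 : E <= e2 by rewrite !ge_min lexx orbT.
have Ee3 : E <= e3 by rewrite !ge_min lexx !orbT.
have Ee4 : E < e4.
  by apply: (@le_lt_trans _ _ (e4 / 2)); [rewrite !ge_min lexx !orbT|lra].
have [s1 s1P] := delta_small D0 E0.
have s1E : delta s1 < E by exact: s1P.
have GP r : 0 < r <= E -> 0 < G r by move=> /andP[p q]; apply: pos; rewrite p (le_trans q).
have HP r : 0 < r <= E -> 0 < H r.
  move=> /[dup] /GP Gp /andP[p q].
  by have := Hpos r p (le_lt_trans q Ee4); rewrite -/(G r) -/(H r) pmulr_lgt0 ?invr_gt0.
have rE (J : R -> R) e' : E <= e' -> regular (d := d) e' J -> regular (d := d) E J.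
  move=> EE [_ m r s]; split=> // a b a0 ab bE; [apply: m => //|apply: r => //]; exact: le_trans EE.
have wu : @weight R d s1 (fun j => H (delta j)).
  by apply: (regular_weight D0 (rE _ _ Ee2 rh) (ltW s1E)).
have wv : @weight R d s1 (fun j => G (delta j)).
  by apply: (regular_weight D0 (rE _ _ Ee rg) (ltW s1E)).
have uvm i j : s1%:Z <= i -> i <= j -> H (delta i) * G (delta j) <= H (delta j) * G (delta i).
  move=> si ij; have ri := delta_range D0 (ltW s1E) si.
  have rj := delta_range D0 (ltW s1E) (le_trans si ij).
  have /andP[pj qj] := rj; have /andP[p q] := ri.
  have dij : delta j <= delta i by rewrite ler_delta.
  have [_] := hmono (delta j) (delta i) pj dij (le_trans q Ee3).
  by rewrite -/(G _) -/(H _) ler_pdivrMr ?GP // mulrAC ler_pdivlMr ?GP.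
have uvoo M : exists n : int, forall j, n <= j -> M * G (delta j) <= H (delta j).
  have [e5 e50 hM] := hoo M; have ee5 : 0 < Num.min E e5 by rewrite lt_min E0.
  have [n nP] := delta_small D0 ee5; exists n%:Z => j nj.
  have dj := @delta_gt0 R D D0 j.
  have := nP _ nj; rewrite lt_min => /andP[jE j5].
  have Gj : 0 < G (delta j) by rewrite GP // dj ltW.
  by have := hM _ dj j5; rewrite -/(G _) -/(H _) ltr_pdivlMr // => /ltW.
have udiv := gd_levels_unbounded gi rg fin se foo.
apply: (Minf_ge D0 hD gh) => A Aeps cA.
have hA0 (j : int) : (0 <= h (delta j)%:E)%E.
  by have [h00 _] := gh; apply: h00; rewrite lee_fin ltW // delta_gt0.
have hH (j : int) : s1%:Z <= j -> h (delta j)%:E = (H (delta j))%:E.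
  move=> sj; apply: hfin; have /andP[-> q] := delta_range D0 (ltW s1E) sj.
  exact: le_trans q Ee2.
have full (lam : I) (B : set I) : s1%:Z <= lam.1 -> cube lam `<=` W ->
    (forall C, B C -> sub C lam) -> covers B (F `&` cube lam) ->
    (h (delta lam.1)%:E <= \esum_(C in B) h (delta C.1)%:E)%E.
  move=> sl lW Bsub cB; rewrite hH //.
  have lU := subset_trans lW WU.
  apply: (le_trans (limsup_content wu wv uvm uvoo udiv sl lU Bsub cB)).
  apply: le_esum => C BC; have [k _] := Bsub _ BC.
  by rewrite hH // (le_trans sl).
have [A' [cA' A'P sA']] := refine_cover oW hA0 full cA.
(* The added cubes have generation at least [s1], so their diameter is below [eps_h]. *)
apply: le_trans sA'; apply: (Minf_le D0 hD gh) => // C /A'P[/Aeps //|sC].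
apply: lt_le_trans eps; rewrite lte_fin.
have dC : delta C.1 <= delta s1 by rewrite ler_delta.
exact: lt_le_trans (le_lt_trans dC s1E) Ee2.
Qed.

(** For a small cube [lam] in [W], either a covering cube contains [lam] and costs at least as much,
    by monotonicity of [h] below [eps_h], or [lam] is covered by its own subcubes and volume gives
    the bound. *)
Lemma Minf_pos h (W : set V) : gauge h -> (forall r, 0 < r -> (0 < h r%:E)%E) ->
  d_normalized d h -> open W -> W !=set0 -> Minf N h W <> 0%E.
Proof.
move=> gh hpos nh oW W0 hW.
have [e [rh hfin h0 eps]] := gauge_regular gh nh; have [e0 _ _ _] := rh.
have [s0 s0P] := delta_small D0 e0.
have se : delta s0 <= e by exact/ltW/s0P.
have hP r : 0 < r <= e -> 0 < fine (h r%:E).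
  by move=> re; rewrite -lte_fin -hfin //; apply: hpos; case/andP: re.
have wu : @weight R d s0 (fun j => fine (h (delta j)%:E)) by exact: (regular_weight D0 rh se).
have [lam [sl lW]] := cube_in_U s0 oW W0.
have hA0 (j : int) : (0 <= h (delta j)%:E)%E by apply/ltW/hpos/delta_gt0.
suff : (h (delta lam.1)%:E <= Minf N h W)%E by rewrite hW leNgt hpos // delta_gt0.
apply: (Minf_ge D0 hD gh) => A Aeps cA.
have [[C [AC lC]]|nC] := pselect (exists C, A C /\ sub lam C).
  apply: (@le_trans _ _ (h (delta C.1)%:E)).
    have := Aeps _ AC; move=> /ereal_sup_gt[_ [e' [e'0 [hm _]] <-]]; rewrite lte_fin => Ce'.
    apply: hm; [exact/ltW/delta_gt0| |exact: ltW].
    by rewrite ler_delta //; case: lC.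
  rewrite -[leLHS](_ : \esum_(k in [set C]) h (delta k.1)%:E = _)%E; last by rewrite esum_set1.
  by apply: subset_le_esum => // _ ->.
apply: (@le_trans _ _ (\esum_(C in A `&` [set C | sub C lam]) h (delta C.1)%:E)%E); last first.
  by apply: subset_le_esum => // C [].
have lamr := delta_range D0 se sl; rewrite hfin //.
have Bsub C : (A `&` [set C | sub C lam]) C -> sub C lam by move=> [].
have cB : covers (A `&` [set C | sub C lam]) (cube lam).
  move=> x lx; have [C AC Cx] := cA _ (lW _ lx); exists C => //; split=> //=.
  by have [|] := sub_total lx Cx; [move=> lC; case: nC; exists C|].
apply: (le_trans (weight_cover wu sl Bsub cB)).
apply: le_esum => C /Bsub[k _]; rewrite -hfin //.
by apply: (delta_range D0 se); exact: le_trans sl k.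
Qed.

(* A gauge [h] slightly larger than [g_d] for which [F] is still null contradicts
   the full [h]-content of a large intersection subset. *)
Lemma limsup_small g (F' : set V) : G_infty d g ->
  (\int[nu]_(r in unit) gd d g r%:E < +oo)%E -> large_int N g U F' -> ~ F' `<=` F.
Proof.
move=> gi foo [_ big] F'F; have [gg _] := gi; have [g0 _] := gg.
have [e [s0 [rg se fin pos]]] := ginf_level gi; have [e0 Gm Gr Gs] := rg.
have [B hB] := gd_sums_bounded gi rg fin se foo.
pose G r := fine (gd d g r%:E).
have dm0 s : 0 <= mass s.+1 - mass s by rewrite subr_ge0 mass_homo.
have v0 s : 0 <= G (delta s%:Z) by rewrite fine_ge0 // gd_ge0.
have [psi [pge pm pr [poo ps] [B' pB]]] := convergent_profile dm0 v0 hB.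
(* Freezing the argument at [e] keeps the new gauge positive and finite at every positive radius. *)
pose H r := psi (G (Num.min r e)).
have mine r : 0 < r -> 0 < Num.min r e <= e by move=> r0; rewrite lt_min r0 e0 ge_min lexx orbT.
have Gp r : 0 < r -> 0 < G (Num.min r e) by move=> r0; apply/pos/mine.
have Hp r : 0 < r -> 0 < H r by move=> r0; apply: lt_le_trans (Gp _ r0) (pge _ (ltW (Gp _ r0))).
pose h (x : \bar R) : \bar R := match x with
  | EFin r => if r <= 0 then 0%E else (H r)%:E | +oo%E => +oo%E | -oo%E => 0%E end.
have hE r : 0 < r -> h r%:E = (H r)%:E by move=> r0; rewrite /h leNgt r0.
have h00 : h 0%E = 0%E by rewrite /h /= lexx.
have hpos r : 0 < r -> (0 < h r%:E)%E by move=> r0; rewrite hE // lte_fin Hp.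
have h_ge0 x : (0 <= h x)%E.
  case: x => [r| |]; [|exact: leey|exact: lexx].
  have [r0|r0] := leP r 0; first by rewrite /h r0.
  exact/ltW/hpos.
have HE r : r <= e -> H r = psi (G r) by move=> re; rewrite /H min_l.
have gh : gauge h.
  split; first by move=> x _; exact: h_ge0.
  split.
    exists e => // r s; rewrite le_eqVlt => /orP[/eqP <-|r0] rs se'; first by rewrite h00.
    have s0' := lt_le_trans r0 rs.
    rewrite !hE // lee_fin !HE //; last exact: le_trans se'.
    apply: pm; last exact: Gm.
    by apply/ltW/pos; rewrite r0 (le_trans rs).
  split=> //; split=> //; apply/cvg0_right => // eta eta0.
  have [rho rho0 hrho] := ps _ eta0; have [rho1 rho10 hrho1] := Gs _ rho0.
  exists (Num.min e rho1); first by rewrite lt_min e0.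
  move=> r /andP[r0]; rewrite lt_min => /andP[re rr]; rewrite hE // lte_fin HE ?(ltW re) //.
  by apply: hrho; rewrite hrho1 ?r0 // andbT pos // r0 ltW.
have hratio r s : 0 < r -> r <= s -> s <= e ->
    (h s%:E * (s ^- d)%:E <= h r%:E * (r ^- d)%:E)%E.
  move=> r0 rs se'; have s0' := lt_le_trans r0 rs; have re := le_trans rs se'.
  rewrite !hE // -!EFinM lee_fin !HE // ler_pdivrMr ?exprn_gt0 // mulrAC.
  rewrite ler_pdivlMr ?exprn_gt0 //.
  have Gr0 : 0 < G r by rewrite pos // r0.
  have Gs0 : 0 < G s by rewrite pos // s0'.
  rewrite -(ler_pM2l Gr0) mulrA.
  apply: (@le_trans _ _ (G s * psi (G r) * r ^+ d)).
    by rewrite ler_wpM2r ?exprn_ge0 ?(ltW r0) // pr // Gm.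
  rewrite mulrAC [leRHS]mulrCA mulrC ler_wpM2l; first by [].
    exact: le_trans (ltW Gr0) (pge _ (ltW Gr0)).
  exact: Gr.
have nh : d_normalized d h.
  by exists e => // r r0 re; apply: (ratio_normalized h00 hratio).
have phg : prec h (gd d g).
  right; split.
    exists e => // r s r0 rs se'; have s0' := lt_le_trans r0 rs; have re := le_trans rs se'.
    have Gr0 : 0 < G r by rewrite pos // r0.
    have Gs0 : 0 < G s by rewrite pos // s0'.
    split; first by rewrite fin ?r0 // lte_fin.
    rewrite !hE //= !HE // -/(G r) -/(G s) ler_pdivrMr // mulrAC ler_pdivlMr //.
    by rewrite mulrC [leRHS]mulrC pr // Gm.
  move=> M; have [eta eta0 heta] := poo M; have [rho rho0 hrho] := Gs _ eta0.
  exists (Num.min e rho); first by rewrite lt_min e0.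
  move=> r r0; rewrite lt_min => /andP[re rr].
  have Gr0 : 0 < G r by rewrite pos // r0 ltW.
  rewrite hE //= HE ?(ltW re) // -/(G r) ltr_pdivlMr // heta // Gr0 /=.
  by apply: hrho; rewrite r0.
(* The content of [F'] in [U] equals that of [U], which is positive, while the cheap coverings of
   [F] make it [0]. *)
have := big h gh nh phg U oU (@subset_refl _ U).
apply/eqP; rewrite eq_sym; apply/eqP => hU; apply: (Minf_pos gh hpos nh oU U0).
rewrite hU; apply/eqP; rewrite eq_le; apply/andP; split; last first.
  apply: le_ereal_inf_tmp => _ [lam [_ [_ ->]]]; exact: nneseries_ge0.
apply/lee_addgt0Pr => eta eta0; rewrite add0e.
have [e1 [[e10 _ _ _] _ _ eps]] := gauge_regular gh nh.
have [t0 t0P] := delta_small D0 e10.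
have tE : tiny (fun j => h (delta j)%:E) t0%:Z F.
  apply: (limsup_tiny (s0 := s0) (B := B')
    (u := fun s : nat => psi (G (delta s)))) => // s ss.
    by have /andP[p q] := @delta_range R D D0 e s0 s se ss; rewrite hE // HE.
  have sr := @delta_range R D D0 e s0 s se ss; have /andP[p q] := sr.
  have sr1 := @delta_range R D D0 e s0 s.+1 se (leqW ss); have /andP[p1 q1] := sr1.
  have dd : delta s.+1 <= delta s by rewrite ler_delta // lez_nat.
  by apply: pm; [exact/ltW/pos|exact: Gm].
have [A [At cA sA]] := tE eta eta0; apply: le_trans sA.
apply: (Minf_le D0 hD gh) => [C /At Ct|y [/F'F Fy _]]; last exact: cA.
by apply: lt_le_trans eps; rewrite lte_fin t0P.
Qed.
Lemma limsup_describable : classRd d nu -> nu_describable N nu F U.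
Proof.
move=> [_ rd]; split; [|split].
- split; last exact: (limsup_null rd).
  by apply: borel_gdelta; exists Gopen; split=> // s; exact: open_Gopen.
- apply/seteqP; split=> g.
    move=> [gi hF]; split=> // -[_ foo].
    exact: (limsup_hausdorff_pos gi foo hF).
  move=> [gi ng]; split=> //.
  apply: (limsup_hausdorff_null gi).
  by rewrite ltey; apply/eqP => foo; apply: ng.
apply/seteqP; split=> g.
  move=> [[_ [F' lF' F'F]] gi]; split=> //; apply: contrapT => /eqP.
  rewrite -ltey => foo.
  exact: (limsup_small gi foo lF' F'F).
move=> [gi foo]; have [gg gl] := gi; split=> //; split.
  by split=> //; rewrite gl.
exists F => //; exact: (limsup_large gi foo).
Qed.

Lemma limsup_covering : ~ classRd d nu -> lebesgue_d (U `\` F) = 0%E.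
Proof.
move=> nrd; apply: limsup_full.
by apply: contrapT => /eqP; rewrite -ltey => foo; apply: nrd.
Qed.

Lemma covered_limsup :
  [set y | (\int[Q]_(z in Sset U) (\1_[set z : BSp R d | (N (y - z.2) < z.1)%R] z)%:E)%E = +oo%E] = F.
Proof.
rewrite -limsup_Gopen.
have e y : [set z : BSp R d | N (y - z.2) < z.1] = reach 0 y.
  by apply/seteqP; split=> z; rewrite /reach /= subr_gt0.
apply/seteqP; split=> y /=; rewrite integral_indic ?e //.
- exact: measurable_Sset.
- exact: measurable_reach.
- exact: measurable_Sset.
- exact: measurable_reach.
Qed.

End LimsupSet.

(** * Conclusion on one almost sure event *)

Theorem theorem14p1 (R : realType) (d : nat) (N : 'rV[R]_d -> R)
  (dO : measure_display) (Omega : measurableType dO) (P : probability Omega R)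
  (nu : {measure set R -> \bar R}) (U : set 'rV[R]_d)
  (Pi : Omega -> {measure set (BSp R d) -> \bar R}) :
  (0 < d)%N ->
  is_norm N ->
  classR nu ->
  open U -> U !=set0 ->
  poisson_point_measure P (Sset U) (intensity nu U) Pi ->
  (~ classRd d nu ->
     {ae P, forall w, lebesgue_d (U `\` Fnu N U Pi w) = 0%E}) /\
  (classRd d nu ->
     {ae P, forall w, nu_describable N nu (Fnu N U Pi w) U}).
Proof.
move=> d0 nN hnu oU U0 poi.
have [D D0 hD] := diam_cube nN d0.
have upper : {ae P, forall w, forall M : nat, exists2 K : R, 0 <= K &
    forall s : nat, (Pi w (slab D s (cbox M)) <= (K * (1 + mass D nu s))%:E)%E}.
  by apply/ae_foralln => M; exact: (upper_event d0 D0 hnu poi M).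
(* Quantifying over codes of cubes makes this a countable intersection; codes that give no cube of
   nonnegative generation inside [U] impose no condition. *)
have lower : {ae P, forall w, forall n : nat, forall (g : nat) (c : @cidx d),
    unpickle n = Some c -> c.1 = g%:Z -> @cube R d c `<=` U ->
    exists J, forall j, (J <= j)%N -> (g <= j)%N ->
      (2 ^ ((j - g) * d) <= 2 * #|hits D (Pi w) c (lev d D0 hnu j) (j - g)|)%N}.
  apply/ae_foralln => n; case: (unpickle n) => [c|]; last by apply: aeW.
  have [[g [cg cU]]|nc] := pselect (exists g : nat, c.1 = g%:Z /\ @cube R d c `<=` U).
    apply: filterS (lower_event d0 D0 hnu poi cg cU) => w hw g' _ [<-].
    by rewrite cg => -[<-] _.
  by apply: aeW => w g' _ [<-] cg cU; exfalso; apply: nc; exists g'.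
have good : {ae P, forall w,
    (~ classRd d nu -> lebesgue_d (U `\` Fnu N U Pi w) = 0%E) /\
    (classRd d nu -> nu_describable N nu (Fnu N U Pi w) U)}.
  have [Pint [PS _]] := poi.
  apply: filterS2 upper lower => w QU lw.
  have QL (g : nat) (c : @cidx d) : c.1 = g%:Z -> @cube R d c `<=` U ->
      exists J, forall j, (J <= j)%N -> (g <= j)%N ->
      (2 ^ ((j - g) * d) <= 2 * #|hits D (Pi w) c (lev d D0 hnu j) (j - g)|)%N.
    by apply: (lw (pickle c)); rewrite pickleK.
  rewrite /Fnu (covered_limsup d0 nN D0 oU (Pint w) QU); split=> h.
    exact: (limsup_covering d0 nN oU hD (Pint w) (PS w) QU QL).
  exact: (limsup_describable d0 nN oU hD (Pint w) (PS w) QU QL U0).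
by split=> h; apply: filterS good => w [h1 h2]; [exact: h1|exact: h2].
Qed.
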